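(* Let $\{y_t\}$ follow the sAGARCH(1,1) model with true parameter $\theta_0=(\omega_0,\phi_{0+},\phi_{0-},\psi_0,\alpha_0)'$. Suppose $\{\eta_t\}$ is i.i.d. with density $f_{\alpha_0}$ for some $\alpha_0\in(0,2)$, and that the parameter space $\Theta\subset(0,\infty)^4\times(0,2)$ is compact with $\theta_0\in\Theta$. Let $\widehat\theta_n=(\widehat\omega_n,\widehat\vartheta_n')'$ be the MLE. (i) If $\gamma_{\alpha_0}<0$ and $\psi<1$ for every $\theta=(\omega,\phi_+,\phi_-,\psi,\alpha)'\in\Theta$, then $\widehat\theta_n\to\theta_0$ almost surely as $n\to\infty$. (ii) If $\gamma_{\alpha_0}>0$, then $\widehat\vartheta_n\to\vartheta_0$ almost surely as $n\to\infty$, where $\vartheta_0=(\phi_{0+},\phi_{0-},\psi_0,\alpha_0)'$.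
   Context: For $\alpha\in(0,2]$, $f_\alpha(x)=\frac1\pi\int_0^\infty \exp(-s^\alpha)\cos(sx)\,ds$, $x\in\mathbb R$, is the density of the standardized symmetric stable law with characteristic function $\exp(-|s|^\alpha)$. For $x\in\mathbb R$, $x^+=\max\{x,0\}$, $x^-=-\min\{x,0\}$. The sAGARCH(1,1) model is $y_t=\sigma_t\eta_t$, $\sigma_t^2=\omega+\phi_+(y_{t-1}^+)^2+\phi_-(y_{t-1}^-)^2+\psi\sigma_{t-1}^2$, $t=1,2,\dots$, with initial values $y_0$ and $\sigma_0\ge0$, where $\{\eta_t\}$ is i.i.d. with density $f_\alpha$, $\alpha\in(0,2)$. Write $\theta=(\omega,\vartheta')'=(\omega,\phi_+,\phi_-,\psi,\alpha)'\in(0,\infty)^4\times(0,2)$. The top Lyapunov exponent at the true parameter is $\gamma_{\alpha_0}=E\log a_0(\eta)$ with $a_0(x)=\phi_{0+}(x^+)^2+\phi_{0-}(x^-)^2+\psi_0$ and $\eta\sim f_{\alpha_0}$. Given observations $y_0,\dots,y_n$, define recursively $\widetilde\sigma_t^2(\theta)=\omega+\phi_+(y_{t-1}^+)^2+\phi_-(y_{t-1}^-)^2+\psi\widetilde\sigma_{t-1}^2(\theta)$, $t\ge1$, with initial values $(y_0,\widetilde\sigma_0(\theta))\equiv(0,0)$ used in the recursion; the log-likelihood is $\widetilde L_n(\theta)=\sum_{t=1}^n\{-\log\widetilde\sigma_t(\theta)+\log f_\alpha(y_t/\widetilde\sigma_t(\theta))\}$ and the MLE is $\widehat\theta_n=\arg\max_{\theta\in\Theta}\widetilde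 L_n(\theta)$, written $\widehat\theta_n=(\widehat\omega_n,\widehat\phi_{n+},\widehat\phi_{n-},\widehat\psi_n,\widehat\alpha_n)'$ and $\widehat\vartheta_n=(\widehat\phi_{n+},\widehat\phi_{n-},\widehat\psi_n,\widehat\alpha_n)'$. *)

(* Defs.v *)
From HB Require Import structures.
From mathcomp Require Import all_boot all_order all_algebra.
From mathcomp Require Import all_classical all_reals all_analysis.
Set Implicit Arguments. Unset Strict Implicit. Unset Printing Implicit Defensive.
Import Order.TTheory GRing.Theory Num.Theory.
Import numFieldNormedType.Exports.
Local Open Scope classical_set_scope.
Local Open Scope ring_scope.

Section Defs.
Variable R : realType.

Definition posp (x : R) : R := Num.max x 0.
Definition negp (x : R) : R := - Num.min x 0.

(* symmetric stable density f_alpha(x) = 1/pi int_0^oo exp(-s^alpha) cos(sx) ds *)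
Definition f_alpha (a x : R) : R :=
  (Rintegral (@lebesgue_measure R) `[0%R, +oo[%classic
     (fun s => expR (- (s `^ a)) * cos (s * x))) / pi.

(* parameter theta = (omega, vartheta), vartheta = (((phi+, phi-), psi), alpha) *)
Definition param := (R * (R * R * R * R))%type.
Definition p_om (th : param) : R := th.1.
Definition p_php (th : param) : R := th.2.1.1.1.
Definition p_phm (th : param) : R := th.2.1.1.2.
Definition p_psi (th : param) : R := th.2.1.2.
Definition p_alpha (th : param) : R := th.2.2.

Definition a_fun (th : param) (x : R) : R :=
  p_php th * posp x ^+ 2 + p_phm th * negp x ^+ 2 + p_psi th.

Definition lyap (th : param) : \bar R :=
  (\int[@lebesgue_measure R]_x ((ln (a_fun th x) * f_alpha (p_alpha th) x)%:E))%E.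

(* the sAGARCH(1,1) path: (y_t, sigma_t^2), driven by innovations e t (t >= 1),
   initial values y0 and sigma0 *)
Fixpoint sagarch (th : param) (y0 s0 : R) (e : nat -> R) (t : nat) : R * R :=
  match t with
  | 0 => (y0, s0 ^+ 2)
  | t'.+1 =>
      let p := sagarch th y0 s0 e t' in
      let s2 := p_om th + p_php th * posp p.1 ^+ 2 + p_phm th * negp p.1 ^+ 2
                + p_psi th * p.2 in
      (Num.sqrt s2 * e t, s2)
  end.

(* tilde sigma_t^2(theta) computed from observations y, with (y_0, sigma_0) = (0,0) *)
Fixpoint sig2t (th : param) (y : nat -> R) (t : nat) : R :=
  match t with
  | 0 => 0
  | t'.+1 =>
      let yp := if t' is 0 then 0 else y t' in
      p_om th + p_php th * posp yp ^+ 2 + p_phm th * negp yp ^+ 2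
      + p_psi th * sig2t th y t'
  end.

Definition loglik (n : nat) (th : param) (y : nat -> R) : R :=
  \sum_(1 <= t < n.+1)
    (- ln (Num.sqrt (sig2t th y t))
     + ln (f_alpha (p_alpha th) (y t / Num.sqrt (sig2t th y t)))).

Definition is_mle (Theta : set param) (n : nat) (y : nat -> R) (th : param) :=
  Theta th /\ forall th', Theta th' -> loglik n th' y <= loglik n th y.

Definition param_space (Theta : set param) :=
  forall th, Theta th ->
    [/\ 0 < p_om th, 0 < p_php th, 0 < p_phm th, 0 < p_psi th
      & 0 < p_alpha th < 2].

End Defs.

Definition mutually_indep (d : measure_display) (T : measurableType d) (R : realType)
  (P : probability T R) (X : nat -> T -> R) :=
  forall (s : seq nat) (A : nat -> set R), uniq s ->
    (forall i, measurable (A i)) ->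
    P (\big[setI/setT]_(i <- s) (X i @^-1` A i)) =
    (\prod_(i <- s) P (X i @^-1` A i))%E.

Definition iid_density (d : measure_display) (T : measurableType d) (R : realType)
  (P : probability T R) (X : nat -> T -> R) (f : R -> R) :=
  (forall i, measurable_fun setT (X i)) /\ mutually_indep P X /\
  forall i (A : set R), measurable A ->
    P (X i @^-1` A) = (\int[@lebesgue_measure R]_(x in A) (f x)%:E)%E.

(* Main.v *)
(** Wald's argument, with exponential inequalities in place of ergodic theorems. Let [e n] be the
    innovations, [sv n] the true squared volatility and [fv th n] the one filtered with the
    parameter [th]. Up to a term free of [th], the log-likelihood is the sum of the logarithms of
    the densities of [e n] predicted by [th]. Given the past, the square root of the ratio of such
    a predicted density to the true one has mean the Hellinger affinity of two scaled stable
    densities. The affinity is at most 1, and it stays below [1 - c] if the indices differ or if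
    [fv th n / sv n] stays away from 1. If one of these happens with positive frequency, Markov's
    inequality and Borel-Cantelli make the log-likelihood ratio smaller than a negative multiple
    of [n]. This survives the passage to a neighbourhood of [th], where [fv] lies between the
    volatilities filtered with [(1 - dl) th] and [(1 + dl) th]: either these two are close, or the
    predicted densities are spread out so much that the affinity is small, except at rare times.

    If [phi+], [phi-] or [psi] differs from its true value, innovations in suitable fixed
    intervals force [fv th n / sv n] away from 1, whatever the size of the volatility. If only
    [omega] differs, this works at times of bounded volatility, and [lyap th0 < 0] gives them a
    positive frequency. At the true parameter the filter forgets its initial value exponentially
    fast, so the log-likelihood ratio is at least [- eps n]. Compactness of [Theta] finishes the
    proof. *)
Require Import Defs.
From HB Require Import structures.
From mathcomp Require Import all_boot all_order all_algebra.
From mathcomp Require Import all_classical all_reals all_analysis.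
From mathcomp Require Import measurable_realfun ring lra.
Set Implicit Arguments. Unset Strict Implicit. Unset Printing Implicit Defensive.
Import Order.TTheory GRing.Theory Num.Theory.
Import numFieldNormedType.Exports.
Local Open Scope classical_set_scope.
Local Open Scope ring_scope.

(* [lra] and [nra] reify the whole context, which is the bulk of their cost, but fail when
   section variables are missing: [clear_after m] drops what follows the section variable [m]. *)
Ltac clear_after m :=
  lazymatch goal with
  | H : _ |- _ => tryif constr_eq H m then intros else (first [clear H | revert H]; clear_after m)
  end.

(** * Integration and differentiation on the line *)

Section integral_tools.
Variable R : realType.
Local Notation mu := (@lebesgue_measure R).

Lemma integrable_dom d (T : measurableType d) (m : {measure set T -> \bar R})
    (D : set T) (f g : T -> R) :
  measurable D -> measurable_fun D f -> m.-integrable D (EFin \o g) ->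
  (forall x, D x -> `|f x| <= g x) -> m.-integrable D (EFin \o f).
Proof.
move=> mD mf ig fg; apply: le_integrable ig => //; first exact/measurable_EFinP.
by move=> x Dx /=; rewrite lee_fin (le_trans (fg _ Dx))// ler_norm.
Qed.

Lemma Rintegral_dominated_cvg d (T : measurableType d) (m : {measure set T -> \bar R})
    (D : set T) (f_ : nat -> T -> R) (f g : T -> R) :
  measurable D -> (forall n, measurable_fun D (f_ n)) ->
  (forall x, D x -> f_ n x @[n --> \oo] --> f x) ->
  m.-integrable D (EFin \o g) ->
  (forall n x, D x -> `|f_ n x| <= g x) ->
  \int[m]_(x in D) f_ n x @[n --> \oo] --> \int[m]_(x in D) f x.
Proof.
move=> mD mf cf ig fg.
have mfl : measurable_fun D f.
  by apply: (measurable_fun_cvg mf) => x Dx; exact: cf.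
have il : m.-integrable D (EFin \o f).
  apply: integrable_dom ig _ => // x Dx.
  have cn : `|f_ n x| @[n --> \oo] --> `|f x| by apply: cvg_norm; exact: cf.
  rewrite -(cvg_lim _ cn)//; apply: limr_le; first by apply/cvg_ex; eexists; exact: cn.
  by apply: nearW => n; exact: fg.
apply: fine_cvg; rewrite fineK; last exact: integrable_fin_num.
apply: (@dominated_cvg _ _ _ m D mD (fun n x => (f_ n x)%:E) (fun x => (f x)%:E)
  (fun x => (g x)%:E)) => //.
- by move=> n; exact/measurable_EFinP.
- by move=> x Dx; apply/fine_cvgP; split; [exact: nearW|exact: cf].
Qed.

Lemma integrable_dom_leb (D : set R) (f g : R -> R) :
  measurable D -> measurable_fun D f -> mu.-integrable D (EFin \o g) ->
  (forall x, D x -> `|f x| <= g x) -> mu.-integrable D (EFin \o f).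
Proof. exact: (@integrable_dom _ (measurableTypeR R)). Qed.

Lemma dominated_cvg_leb (D : set R) (f_ : nat -> R -> R) (f g : R -> R) :
  measurable D -> (forall n, measurable_fun D (f_ n)) ->
  (forall x, D x -> f_ n x @[n --> \oo] --> f x) ->
  mu.-integrable D (EFin \o g) ->
  (forall n x, D x -> `|f_ n x| <= g x) ->
  \int[mu]_(x in D) f_ n x @[n --> \oo] --> \int[mu]_(x in D) f x.
Proof. exact: (@Rintegral_dominated_cvg _ (measurableTypeR R)). Qed.

Lemma measurable_int_leb (D : set R) (f : R -> R) :
  mu.-integrable D (EFin \o f) -> measurable_fun D f.
Proof. by move=> /integrableP[/measurable_EFinP]. Qed.

Lemma integrableZ_leb (D : set R) (f : R -> R) (k : R) : measurable D ->
  mu.-integrable D (EFin \o f) -> mu.-integrable D (EFin \o (fun x => k * f x)).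
Proof. by move=> mD fi; apply: (@integrableZl _ (measurableTypeR R) R mu D mD k (EFin \o f) fi). Qed.

Lemma integrableD_leb (D : set R) (f g : R -> R) : measurable D ->
  mu.-integrable D (EFin \o f) -> mu.-integrable D (EFin \o g) ->
  mu.-integrable D (EFin \o (fun x => f x + g x)).
Proof. by move=> mD fi gi; exact: (@integrableD _ (measurableTypeR R) R mu D mD (EFin \o f) (EFin \o g) fi gi). Qed.

Lemma integrableB_leb (D : set R) (f g : R -> R) : measurable D ->
  mu.-integrable D (EFin \o f) -> mu.-integrable D (EFin \o g) ->
  mu.-integrable D (EFin \o (fun x => f x - g x)).
Proof. by move=> mD fi gi; exact: (@integrableB _ (measurableTypeR R) R mu D mD (EFin \o f) (EFin \o g) fi gi). Qed.

Lemma integrable_norm_leb (D : set R) (f : R -> R) : 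
  mu.-integrable D (EFin \o f) -> mu.-integrable D (EFin \o (fun x => `|f x|)).
Proof. by move=> fi; exact: integrable_norm fi. Qed.

Lemma le_Rintegral_leb (D : set R) (f g : R -> R) : measurable D ->
  mu.-integrable D (EFin \o f) -> mu.-integrable D (EFin \o g) ->
  (forall x, D x -> f x <= g x) ->
  \int[mu]_(x in D) f x <= \int[mu]_(x in D) g x.
Proof. exact: (@le_Rintegral _ (measurableTypeR R)). Qed.

Lemma integrable_cst_leb (D : set R) (k : R) : measurable D ->
  (mu D < +oo)%E -> mu.-integrable D (EFin \o (fun=> k)).
Proof.
move=> mD D0; apply/integrableP; split; first by apply/measurable_EFinP; exact: measurable_cst.
by rewrite integral_cst//= lte_mul_pinfty.
Qed.

Lemma integrableS_leb (E D : set R) (f : R -> R) : measurable E -> measurable D ->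
  D `<=` E -> mu.-integrable E (EFin \o f) -> mu.-integrable D (EFin \o f).
Proof. by move=> mE mD DE; exact: (@integrableS _ (measurableTypeR R) R mu E D). Qed.

Lemma FTC2_closed (g G : R -> R) (a b : R) : a < b ->
  (forall x, a <= x <= b -> {for x, continuous g}) ->
  (forall x, a <= x <= b -> is_derive x 1 G (g x)) ->
  (\int[mu]_(x in `[a, b]) (g x)%:E = (G b - G a)%:E)%E.
Proof.
move=> ab cg dG.
have cG x : a <= x <= b -> {for x, continuous G}.
  by move=> /dG ?; apply/differentiable_continuous/derivable1_diffP.
rewrite (@continuous_FTC2 _ g G a b ab) ?EFinB//.
- apply: continuous_in_subspaceT => x; rewrite inE/= in_itv/= => xab.
  exact: cg.
- split.
  + by move=> x; rewrite in_itv/= => /andP[ax xb]; apply: (@ex_derive _ _ _ _ _ _ _ (dG x _)); rewrite !ltW.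
  + by apply/cvg_at_right_filter/cG; rewrite lexx ltW.
  + by apply/cvg_at_left_filter/cG; rewrite lexx ltW.
- move=> x; rewrite in_itv/= => /andP[ax xb]; rewrite derive1E.
  by apply: (@derive_val _ _ _ _ _ _ _ (dG x _)); rewrite !ltW.
Qed.

Lemma continuous_itvoy_measurable (h : R) (g : R -> R) :
  (forall x, h < x -> {for x, continuous g}) -> measurable_fun `]h, +oo[ g.
Proof.
move=> cg; apply: open_continuous_measurable_fun => //.
by move=> x; rewrite inE/= in_itv/= andbT; exact: cg.
Qed.

Let exh (h : R) (n : nat) : set R := `[h + n.+2%:R^-1, h + n.+1%:R].

Let exh_lt (h : R) n : h + n.+2%:R^-1 < h + n.+1%:R.
Proof.
rewrite ltrD2l (@lt_le_trans _ _ 1)// ?invf_lt1 ?ltr1n ?ler1n//.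
Qed.

Let exh_gt (h : R) n x : exh h n x -> h < x.
Proof.
rewrite /exh/= in_itv/= => /andP[+ _]; apply: lt_le_trans.
by rewrite ltrDl invr_gt0.
Qed.

Let exh_ex (h x : R) : h < x -> exists N, forall n, (N <= n)%N -> exh h n x.
Proof.
move=> hx.
have d0 : 0 < x - h by rewrite subr_gt0.
pose N := maxn (Num.truncn (x - h)) (Num.truncn (x - h)^-1).
exists N => n Nn; rewrite /exh/= in_itv/= -lerBrDl -[X in _ && X]lerBlDl; apply/andP; split.
  rewrite -[leRHS]invrK lef_pV2 ?posrE ?invr_gt0//.
  rewrite ltW// (lt_le_trans (truncnS_gt _))// ler_nat ltnS.
  by rewrite (leq_trans _ (leqnSn _))// (leq_trans _ Nn)// leq_maxr.
rewrite ltW// (lt_le_trans (truncnS_gt _))// ler_nat ltnS.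
by rewrite (leq_trans _ Nn)// leq_maxl.
Qed.

Let exh_cup (h : R) : \bigcup_n exh h n = `]h, +oo[%classic.
Proof.
apply/seteqP; split => [x [n _ /exh_gt hx]|x /=]; rewrite /= in_itv/= ?andbT//.
by move=> /exh_ex[N] /(_ N (leqnn _)) ?; exists N.
Qed.

Let exh_nd (h : R) : nondecreasing_seq (exh h).
Proof.
move=> m n mn; apply/subsetPset => x; rewrite /exh/= !in_itv/= => /andP[ax xb].
rewrite (le_trans _ ax) ?(le_trans xb)// ?lerD2l ?ler_nat//.
by rewrite lef_pV2 ?posrE// ler_nat.
Qed.

Lemma FTC2_ge0_halfline (h m M : R) (g G : R -> R) :
  (forall x, h < x -> 0 <= g x) ->
  (forall x, h < x -> {for x, continuous g}) ->
  (forall x, h < x -> is_derive x 1 G (g x)) ->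
  (forall x, h < x -> m <= G x <= M) ->
  (\int[mu]_(x in `]h, +oo[) (g x)%:E <= (M - m)%:E)%E.
Proof.
move=> g0 cg dG Gb; rewrite -exh_cup.
have cvI := @ge0_nondecreasing_set_cvg_integral _ (measurableTypeR R) R (exh h) (fun x => (g x)%:E) mu (exh_nd h).
have mg n : measurable_fun (exh h n) (fun x => (g x)%:E).
  apply/measurable_EFinP; apply: (measurable_funS _ _ (continuous_itvoy_measurable cg)) => //.
  by move=> x /exh_gt; rewrite /= in_itv/= andbT.
have {}cvI := cvI (fun n => measurable_itv _) mg (fun n x e => g0 x (exh_gt e)).
rewrite -(cvg_lim _ cvI)//.
apply: lime_le; first by apply/cvg_ex; eexists; exact: cvI.
apply: nearW => n.
have -> : (\int[mu]_(x in exh h n) (g x)%:E = (G (h + n.+1%:R) - G (h + n.+2%:R^-1))%:E)%E.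
  apply: FTC2_closed; first exact: exh_lt.
    by move=> x xI; apply: cg; apply: (@exh_gt _ n); rewrite /exh/= in_itv.
  by move=> x xI; apply: dG; apply: (@exh_gt _ n); rewrite /exh/= in_itv.
have /andP[? ?] : m <= G (h + n.+1%:R) <= M by apply: Gb; rewrite ltrDl.
have /andP[? ?] : m <= G (h + n.+2%:R^-1) <= M by apply: Gb; rewrite ltrDl invr_gt0.
by rewrite lee_fin lerB.
Qed.

Lemma integrable_FTC2_ge0_halfline (h m M : R) (g G : R -> R) :
  (forall x, h < x -> 0 <= g x) ->
  (forall x, h < x -> {for x, continuous g}) ->
  (forall x, h < x -> is_derive x 1 G (g x)) ->
  (forall x, h < x -> m <= G x <= M) ->
  mu.-integrable `]h, +oo[ (EFin \o g).
Proof.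
move=> g0 cg dG Gb; apply/integrableP; split.
  by apply/measurable_EFinP; apply: continuous_itvoy_measurable.
have -> : (\int[mu]_(x in `]h, +oo[) `|(EFin \o g) x| = \int[mu]_(x in `]h, +oo[) (g x)%:E)%E.
  by apply: eq_integral => x; rewrite inE/= in_itv/= andbT => hx; rewrite /= ger0_norm ?g0.
by rewrite (le_lt_trans (FTC2_ge0_halfline g0 cg dG Gb))// ltry.
Qed.

Lemma FTC2_halfline (h l m : R) (g G : R -> R) :
  mu.-integrable `]h, +oo[ (EFin \o g) ->
  (forall x, h < x -> {for x, continuous g}) ->
  (forall x, h < x -> is_derive x 1 G (g x)) ->
  G (h + n.+2%:R^-1) @[n --> \oo] --> m ->
  G (h + n.+1%:R) @[n --> \oo] --> l ->
  \int[mu]_(x in `]h, +oo[) g x = l - m.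
Proof.
move=> ig cg dG cm cl.
have c1 : (fun n => \int[mu]_(x in `]h, +oo[) (g \_ (exh h n)) x) @ \oo -->
    \int[mu]_(x in `]h, +oo[) g x.
  apply: (@Rintegral_dominated_cvg _ (measurableTypeR R) mu _ _ g (fun x => `|g x|)) => //.
  - move=> n; apply: measurable_funS (measurableT) _ _ => //.
    apply/(measurable_restrictT _ _).1; first exact: measurable_itv.
    apply: (measurable_funS _ _ (continuous_itvoy_measurable cg)) => //.
    by move=> x /exh_gt; rewrite /= in_itv/= andbT.
  - move=> x /=; rewrite in_itv/= andbT => /exh_ex[N HN].
    apply: (@cvg_near_cst _ _ _ _ _ (@eventually_filter)); exists N => // n /= Nn.
    by rewrite patchE mem_set//; exact: HN.
  - exact: integrable_norm ig.
  - by move=> n x _; rewrite patchE; case: ifP => // _; rewrite normr0.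
have c2 : (fun n => \int[mu]_(x in `]h, +oo[) (g \_ (exh h n)) x) @ \oo --> l - m.
  rewrite (_ : (fun n => _) = (fun n => G (h + n.+1%:R) - G (h + n.+2%:R^-1))).
    exact: cvgB.
  apply/funext => n; rewrite -Rintegral_mkcondr.
  rewrite (_ : _ `&` _ = exh h n); last first.
    by apply/setIidr => x /exh_gt; rewrite /= in_itv/= andbT.
  have -> // : (\int[mu]_(x in exh h n) g x)%R = fine ((G (h + n.+1%:R) - G (h + n.+2%:R^-1))%:E).
  congr fine; apply: FTC2_closed; first exact: exh_lt.
    by move=> x xI; apply: cg; apply: (@exh_gt _ n); rewrite /exh/= in_itv.
  by move=> x xI; apply: dG; apply: (@exh_gt _ n); rewrite /exh/= in_itv.
exact: (cvg_unique _ c1 c2).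
Qed.

Let lebesgue_measure_affine (nu : {measure set (measurableTypeR R) -> \bar R})
    (c : {nonneg R}) (b : R) (A : set (measurableTypeR R)) :
  0 < c%:num ->
  (forall B : set (measurableTypeR R), nu B = mu ((fun x => c%:num * x + b) @^-1` B)) ->
  measurable A -> (mu A = mscale c nu A)%E.
Proof.
move=> c0 nuE mA.
apply: (@lebesgue_measure_unique R (mscale c nu)) => // _ [[x y]] _ <-.
rewrite -[RHS]/(c%:num%:E * nu `]x, y]%classic)%E nuE/=.
rewrite (_ : _ @^-1` _ = `]((x - b) / c%:num), ((y - b) / c%:num)]%classic); last first.
  apply/seteqP; split => z /=; rewrite !in_itv/= ltr_pdivrMr// ler_pdivlMr//.
    by rewrite ltrBlDr lerBrDr mulrC.
  by rewrite ltrBlDr lerBrDr mulrC.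
rewrite !lebesgue_measure_itv/= !lte_fin ltr_pM2r ?invr_gt0// ltrD2r.
case: ifPn => xy; last by rewrite mule0.
rewrite -!EFinD -EFinM; congr EFin; field; exact: lt0r_neq0.
Qed.

Lemma ge0_integral_affine (c b : R) (D : set R) (f : R -> \bar R) : 0 < c ->
  measurable D -> measurable_fun D f -> (forall x, D x -> 0 <= f x)%E ->
  (\int[mu]_(x in D) f x =
   c%:E * \int[mu]_(x in (fun x : R => (c * x + b)%R) @^-1` D) f (c * x + b)%R)%E.
Proof.
move=> c0 mD mf f0.
have ma : measurable_fun [set: measurableTypeR R] (fun x : measurableTypeR R => c * x + b : measurableTypeR R).
  by apply: measurable_funD => //; exact: measurable_funM.
pose nu := @measure_function_pushforward__canonical__measure_function_Measure _ _ _ _ _ mu _ ma.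
transitivity (c%:E * \int[nu]_(x in D) f x)%E; last first.
  congr (_ * _)%E; apply: (@ge0_integral_pushforward _ _ _ _ R _ ma mu D f mD mf).
  by move=> x; rewrite inE; exact: f0.
rewrite -[X in X%:E]/((NngNum (ltW c0))%:num).
rewrite -(@ge0_integral_mscale _ _ R nu D mD (NngNum (ltW c0)) f mf f0).
apply: eq_measure_integral => A mA _.
exact: (@lebesgue_measure_affine nu (NngNum (ltW c0)) b).
Qed.

End integral_tools.

Section elementary.
Variable R : realType.
Implicit Types p b c x y K : R.
Local Notation mu := (@lebesgue_measure R).
Local Notation Rp := (`]0%R, +oo[%classic : set R).

Lemma is_derive_inv (f : R -> R) (x df : R) : f x != 0 -> is_derive x 1 f df ->
  is_derive x 1 (fun y => (f y)^-1) (- (f x) ^- 2 * df).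
Proof.
move=> fx0 dfx; apply: DeriveDef; first by apply: derivableV => //; exact: ex_derive.
by rewrite deriveV// derive_val.
Qed.

Lemma is_derive_compR (f g : R -> R) (x df dg : R) :
  is_derive (g x) 1 f df -> is_derive x 1 g dg ->
  is_derive x 1 (fun y => f (g y)) (df * dg).
Proof. by move=> h1 h2; exact: (@is_derive1_comp _ f g x df dg h1 h2). Qed.

Lemma is_deriveMR (f g : R -> R) (x df dg : R) :
  is_derive x 1 f df -> is_derive x 1 g dg ->
  is_derive x 1 (fun y => f y * g y) (f x * dg + g x * df).
Proof. by move=> h1 h2; exact: is_deriveM. Qed.

Lemma is_deriveDR (f g : R -> R) (x df dg : R) :
  is_derive x 1 f df -> is_derive x 1 g dg ->
  is_derive x 1 (fun y => f y + g y) (df + dg).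
Proof. by move=> h1 h2; exact: is_deriveD. Qed.

Lemma is_deriveNR (f : R -> R) (x df : R) :
  is_derive x 1 f df -> is_derive x 1 (fun y => - f y) (- df).
Proof. by move=> h1; exact: is_deriveN. Qed.

Lemma is_derive_cstR (c x : R) : is_derive x 1 (fun _ : R => c) 0.
Proof. exact: is_derive_cst. Qed.

Lemma is_derive_idR (x : R) : is_derive x 1 (fun y : R => y) 1.
Proof. exact: is_derive_id. Qed.

Lemma is_derive_val_eq (f : R -> R) (x d1 d2 : R) :
  is_derive x 1 f d1 -> d1 = d2 -> is_derive x 1 f d2.
Proof. by move=> ? <-. Qed.

Lemma is_derive_continuous (f : R -> R) (x df : R) :
  is_derive x 1 f df -> {for x, continuous f}.
Proof. by move=> ?; apply/differentiable_continuous/derivable1_diffP. Qed.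

Lemma cvgn_continuous (u : nat -> R) (G : R -> R) (h : R) :
  u n @[n --> \oo] --> h -> {for h, continuous G} -> G (u n) @[n --> \oo] --> G h.
Proof. by move=> cu cG; apply: (cvg_comp u G cu). Qed.

Lemma is_derive_sinM (s x : R) : is_derive s 1 (fun s => sin (s * x)) (x * cos (s * x)).
Proof.
have D := @is_derive_compR sin (fun s => s * x) s _ _ (is_derive_sin (s * x))
  (is_deriveMR (is_derive_idR s) (is_derive_cstR x s)).
by apply: (is_derive_val_eq D); rewrite mulr0 add0r mulr1 mulrC.
Qed.

Lemma is_derive_cosM (s x : R) : is_derive s 1 (fun s => cos (s * x)) (- (x * sin (s * x))).
Proof.
have D := @is_derive_compR cos (fun s => s * x) s _ _ (is_derive_cos (s * x))
  (is_deriveMR (is_derive_idR s) (is_derive_cstR x s)).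
by apply: (is_derive_val_eq D); rewrite mulr0 add0r mulr1 mulrC mulrN.
Qed.

Lemma is_derive_lipschitz (f df : R -> R) (L : R) :
  (forall x : R, is_derive x 1 f (df x)) -> (forall x, `|df x| <= L) ->
  forall x y, `|f x - f y| <= L * `|x - y|.
Proof.
move=> dfE dfL.
have H x y : x < y -> `|f y - f x| <= L * `|y - x|.
  move=> xy; have [|c _ ->] := @MVT R f df x y xy (fun z _ => dfE z).
    by apply: continuous_subspaceT => z; exact: is_derive_continuous.
  by rewrite normrM ler_wpM2r.
move=> x y; have [xy|yx|->] := ltgtP x y; last 2 first.
- exact: H.
- by rewrite !subrr normr0 mulr0.
- by rewrite distrC (distrC x); exact: H.
Qed.

Lemma sin_lipschitz (x y : R) : `|sin x - sin y| <= `|x - y|.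
Proof.
rewrite -[leRHS]mul1r.
exact: (@is_derive_lipschitz sin cos 1 (fun=> _) (fun z => cos_max z)).
Qed.

Lemma cos_lipschitz (x y : R) : `|cos x - cos y| <= `|x - y|.
Proof.
rewrite -[leRHS]mul1r.
apply: (@is_derive_lipschitz cos (fun z => - sin z) 1) => z.
by rewrite normrN sin_max.
Qed.

Lemma norm_sin_le (x : R) : `|sin x| <= `|x|.
Proof. by have := sin_lipschitz x 0; rewrite sin0 !subr0. Qed.

Lemma oneBcos_le (x : R) : 0 <= 1 - cos x <= x ^+ 2 / 2.
Proof.
rewrite subr_ge0 cos_le1/=.
have -> : cos x = 1 - 2 * sin (x / 2) ^+ 2.
  have {1}-> : x = (x / 2) *+ 2 by rewrite -mulr_natr divfK.
  rewrite cos_mulr2n cos2sin2; ring.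
have : `|sin (x / 2)| ^+ 2 <= `|x / 2| ^+ 2 by rewrite lerXn2r ?nnegrE// norm_sin_le.
by rewrite !real_normK ?num_real// => h; nra.
Qed.

Definition wfun (p x : R) : R := x `^ (p - 1) / (1 + x `^ p) ^+ 2.

Lemma wfun_ge0 p x : 0 <= wfun p x.
Proof. by rewrite divr_ge0 ?powR_ge0// exprn_ge0// addr_ge0// powR_ge0. Qed.

Lemma powR_continuous_pt (p x : R) : 0 < x -> {for x, continuous (fun y => y `^ p)}.
Proof. by move=> x0; apply: (@is_derive_continuous _ _ (p * x `^ (p - 1))); exact: is_derive1_powR. Qed.

Lemma wfun_derive p x : 0 < p -> 0 < x ->
  is_derive x 1 (fun y : R => - (p * (1 + y `^ p))^-1) (wfun p x).
Proof.
move=> p0 x0.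
have xp0 : 0 < 1 + x `^ p by rewrite ltr_pwDl// powR_ge0.
have nz : p * (1 + x `^ p) != 0 by rewrite mulf_neq0// gt_eqF.
have D := is_deriveNR (@is_derive_inv (fun y => p * (1 + y `^ p)) x _ nz (is_deriveMR (is_derive_cstR p x)
  (is_deriveDR (is_derive_cstR 1 x) (is_derive1_powR p x0)))).
apply: (is_derive_val_eq D).
rewrite /wfun mulr0 addr0 add0r; field.
by rewrite !gt_eqF.
Qed.

Lemma wfun_continuous p x : 0 < x -> {for x, continuous (wfun p)}.
Proof.
move=> x0; apply: continuousM; first exact: powR_continuous_pt.
apply: continuousV; first by rewrite expf_neq0// gt_eqF// ltr_pwDl// powR_ge0.
have c : {for x, continuous (fun y : R => 1 + y `^ p)}.
  by apply: continuousD; [exact: cvg_cst|exact: powR_continuous_pt].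
exact: (@continuousM _ _ _ _ x c c).
Qed.

Lemma wfun_integrable p : 0 < p -> mu.-integrable Rp (EFin \o wfun p).
Proof.
move=> p0.
apply: (@integrable_FTC2_ge0_halfline R 0 (- p^-1) 0 (wfun p) (fun y : R => - (p * (1 + y `^ p))^-1)).
- by move=> x _; exact: wfun_ge0.
- by move=> x x0; exact: wfun_continuous.
- by move=> x x0; exact: wfun_derive.
- move=> x x0; have h : 1 <= 1 + x `^ p by rewrite lerDl powR_ge0.
  have h0 : 0 < 1 + x `^ p by exact: lt_le_trans h.
  have ph : 0 < p * (1 + x `^ p) by exact: mulr_gt0.
  apply/andP; split; last by rewrite oppr_le0 invr_ge0 ltW.
  by rewrite lerN2 lef_pV2 ?posrE// ler_peMr// ltW.
Qed.

Lemma wfun_integrable_dom p K (f : R -> R) : 0 < p -> measurable_fun Rp f ->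
  (forall x, 0 < x -> `|f x| <= K * wfun p x) -> mu.-integrable Rp (EFin \o f).
Proof.
move=> p0 mf fK.
apply: (@integrable_dom_leb _ Rp f (fun x => K * wfun p x)) => //.
- exact: integrableZ_leb (wfun_integrable p0).
- by move=> x; rewrite /= in_itv/= andbT => x0; exact: fK.
Qed.

(* [wfun p] is comparable to [x^(p-1)] near [0] and to [x^(-p-1)] at infinity. *)
Lemma powR_le_wfun p b x : 0 < p -> 0 < x <= 1 -> b <= 1 - p -> x `^ (- b) <= 4 * wfun p x.
Proof.
move=> p0 /andP[x0 x1] pb.
have xp1 : x `^ p <= 1 by rewrite -(powRr0 x) ger_powR// ?x0// ltW.
have h : x `^ (- b) <= x `^ (p - 1) by rewrite ger_powR ?x0//; lra.
apply: (le_trans h); rewrite /wfun mulrCA ler_peMr ?powR_ge0//.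
have xp0 := powR_ge0 x p.
by rewrite ler_pdivlMr ?exprn_gt0//; nra.
Qed.

Lemma powR_le_wfun_infty p c x : 0 < p -> 1 <= x -> 1 + p <= c -> x `^ (- c) <= 4 * wfun p x.
Proof.
move=> p0 x1 pc.
have x0 : 0 < x by lra.
have xp1 : 1 <= x `^ p by rewrite -{1}(powRr0 x) ler_powR// ltW.
have h : x `^ (- c) <= x `^ (- p - 1) by rewrite ler_powR//; lra.
apply: (le_trans h); rewrite /wfun.
have -> : x `^ (- p - 1) = x `^ (p - 1) / (x `^ p) ^+ 2.
  rewrite -powR_mulrn ?powR_ge0// -powRrM -powRN -powRD; last by rewrite (gt_eqF x0) implybT.
  by congr (_ `^ _); ring.
rewrite mulrCA ler_wpM2l ?powR_ge0//.
have xx : 0 < (1 + x `^ p) ^+ 2 by rewrite exprn_gt0//; lra.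
have yy : 0 < (x `^ p) ^+ 2 by rewrite exprn_gt0//; lra.
rewrite ler_pdivlMr// mulrC ler_pdivrMr//; nra.
Qed.

End elementary.

(** * Symmetric stable densities *)

Section stable_transform.
Variable R : realType.
Local Notation mu := (@lebesgue_measure R).
Local Notation Rp := (`]0%R, +oo[%classic : set R).
Implicit Types a al be s x y e K L : R.

Definition stable_cf (al s : R) : R := expR (- (s `^ al)).

Definition cos_transform (m : R -> R) (x : R) : R :=
  \int[mu]_(s in Rp) (m s * cos (s * x)).

Local Notation phi := stable_cf.
Local Notation ct := cos_transform.

Lemma RpP s : Rp s <-> 0 < s.
Proof. by rewrite /= in_itv/= andbT. Qed.

Lemma phi_gt0 al s : 0 < phi al s. Proof. exact: expR_gt0. Qed.

Lemma phi_le1 al s : phi al s <= 1.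
Proof. by rewrite expR_le1 oppr_le0 powR_ge0. Qed.

Lemma phi_measurable al D : measurable_fun D (phi al).
Proof.
apply: measurable_funTS; apply: measurableT_comp => //.
by apply: measurableT_comp => //; exact: measurable_powR.
Qed.

Lemma cosM_measurable x D : measurable_fun D (fun s : R => cos (s * x)).
Proof.
apply: measurable_funTS; apply: continuous_measurable_fun => s.
apply: (@continuous_comp _ _ _ (fun s : R => s * x) cos); last exact: continuous_cos.
by apply: cvgM; [exact: cvg_id|exact: cvg_cst].
Qed.

Lemma phi_decay a k : 0 < a ->
  exists2 K : R, 0 < K & forall al s, a <= al -> 0 < s -> (1 + s) ^+ k * phi al s <= K.
Proof.
move=> a0; pose m := Num.truncn (k%:R / a).
have fm : 1 <= (m.+1)`!%:R :> R by rewrite ler1n fact_gt0.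
have km : k%:R <= a * m.+1%:R.
  by rewrite -ler_pdivrMl// mulrC ltW// truncnS_gt.
exists (2 ^+ k * (m.+1)`!%:R); first by rewrite mulr_gt0 ?exprn_gt0// (lt_le_trans _ fm).
move=> al s aal s0; have [s1|s1] := leP s 1.
  apply: ler_pM; rewrite ?(ltW (phi_gt0 _ _)) ?exprn_ge0 ?addr_ge0 ?(ltW s0)//.
    by rewrite lerXn2r ?nnegrE//; lra.
  exact: le_trans (phi_le1 _ _) fm.
have s1' := ltW s1.
have h1 : (1 + s) ^+ k <= 2 ^+ k * s ^+ k.
  by rewrite -exprMn lerXn2r ?nnegrE//; lra.
have h2 : s ^+ k * phi al s <= (m.+1)`!%:R.
  rewrite /phi expRN ler_pdivrMr ?expR_gt0//.
  have h3 : s `^ a <= s `^ al by rewrite ler_powR.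
  have h4 : 1 + (s `^ a) ^+ m.+1 / (m.+1)`!%:R <= expR (s `^ al).
    by rewrite (le_trans (expR_ge1Dxn _ (powR_ge0 _ _)))// ler_expR.
  have h5 : s ^+ k <= (s `^ a) ^+ m.+1.
    rewrite -!powR_mulrn ?powR_ge0//; last lra.
    by rewrite -powRrM ler_powR.
  rewrite (le_trans h5)// mulrC -ler_pdivrMr ?(lt_le_trans _ fm)//.
  by rewrite (le_trans _ h4)// lerDr.
apply: (@le_trans _ _ (2 ^+ k * (s ^+ k * phi al s))).
  by rewrite mulrA ler_wpM2r// ltW// phi_gt0.
by rewrite ler_wpM2l// exprn_ge0.
Qed.

Lemma wfun1 s : 0 < s -> wfun 1 s = (1 + s) ^- 2.
Proof. by move=> s0; rewrite /wfun subrr powRr0 powRr1 ?ltW// mul1r. Qed.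

Lemma phi_dom a j : 0 < a ->
  exists2 K : R, 0 < K & forall al s, a <= al -> 0 < s -> (1 + s) ^+ j * phi al s <= K * wfun 1 s.
Proof.
move=> /(phi_decay (j + 2))[K K0 H]; exists K => // al s aal s0.
rewrite wfun1// ler_pdivlMr ?exprn_gt0 ?addr_gt0//.
by rewrite mulrAC -exprD H.
Qed.

Lemma phi_integrable al : 0 < al -> mu.-integrable Rp (EFin \o phi al).
Proof.
move=> al0; have [K K0 H] := phi_dom 0 al0.
apply: (@wfun_integrable_dom R 1 K) => //; first exact: phi_measurable.
move=> s s0; rewrite gtr0_norm ?phi_gt0//.
by have := H al s (lexx _) s0; rewrite expr0 mul1r.
Qed.

Lemma cos_transform_integrable (m : R -> R) x : mu.-integrable Rp (EFin \o m) ->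
  mu.-integrable Rp (EFin \o (fun s => m s * cos (s * x))).
Proof.
move=> im.
apply: (@integrable_dom_leb _ Rp _ (fun s => `|m s|)) => //.
- apply: measurable_funM; last exact: cosM_measurable.
  exact: measurable_int_leb.
- exact: integrable_norm_leb im.
- by move=> s _; rewrite normrM ler_piMr// cos_max.
Qed.

Lemma cos_transform_le (m : R -> R) x : mu.-integrable Rp (EFin \o m) ->
  `|ct m x| <= \int[mu]_(s in Rp) `|m s|.
Proof.
move=> im; have ic := cos_transform_integrable x im.
rewrite (le_trans (le_normr_Rintegral _ ic))//.
apply: le_Rintegral_leb => //; [exact: integrable_norm_leb ic|exact: integrable_norm_leb im|].
by move=> s _; rewrite normrM ler_piMr// cos_max.
Qed.

Lemma cos_transform_lipschitz (m : R -> R) x y :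
  mu.-integrable Rp (EFin \o m) -> mu.-integrable Rp (EFin \o (fun s => s * m s)) ->
  `|ct m x - ct m y| <= (\int[mu]_(s in Rp) `|s * m s|) * `|x - y|.
Proof.
move=> im ism; rewrite /ct -RintegralB//; [|exact: cos_transform_integrable..].
have ic := integrableB_leb (measurable_itv _) (cos_transform_integrable x im) (cos_transform_integrable y im).
rewrite (le_trans (le_normr_Rintegral _ ic))//.
rewrite -RintegralZr//; last exact: integrable_norm_leb ism.
apply: le_Rintegral_leb => //; first exact: integrable_norm_leb ic.
  have := integrableZ_leb `|x - y| (measurable_itv _) (integrable_norm_leb ism).
  by apply: eq_integrable => // s _ /=; rewrite mulrC.
move=> s /RpP s0.
rewrite -mulrBr normrM (le_trans (ler_wpM2l _ (cos_lipschitz _ _)))//.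
by rewrite -mulrBr (normrM s) mulrA (mulrC s) normrM (mulrC `|m s|).
Qed.

Lemma cos_transform_dominated_cvg (m_ : nat -> R -> R) (m g : R -> R) x :
  (forall n, measurable_fun Rp (m_ n)) ->
  (forall s, 0 < s -> m_ n s @[n --> \oo] --> m s) ->
  mu.-integrable Rp (EFin \o g) ->
  (forall n s, 0 < s -> `|m_ n s| <= g s) ->
  ct (m_ n) x @[n --> \oo] --> ct m x.
Proof.
move=> mm cm ig mg.
apply: (@dominated_cvg_leb _ Rp _ _ g) => //.
- by move=> n; apply: measurable_funM => //; exact: cosM_measurable.
- by move=> s /RpP s0; apply: cvgM; [exact: cm|exact: cvg_cst].
- by move=> n s /RpP s0; rewrite normrM (le_trans _ (mg n s s0))// ler_piMr// cos_max.
Qed.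

Lemma f_alphaE al x : 0 < al -> f_alpha al x = ct (phi al) x / pi.
Proof.
move=> al0; congr (_ / _); rewrite /ct.
by rewrite (@Rintegral_itv_obnd_cbnd R)//; exact: cos_transform_integrable (phi_integrable al0).
Qed.

Lemma f_alphaN al x : f_alpha al (- x) = f_alpha al x.
Proof. by congr (_ / _); apply: eq_Rintegral => s _; rewrite mulrN cosN. Qed.

Lemma f_alpha_bounded a : 0 < a ->
  exists2 K : R, 0 < K & forall al x, a <= al -> `|f_alpha al x| <= K.
Proof.
move=> a0; have [K K0 H] := phi_dom 0 a0.
have iw : mu.-integrable Rp (EFin \o (fun s => K * wfun 1 s)).
  by apply: integrableZ_leb => //; exact: wfun_integrable.
have I0 : 0 <= \int[mu]_(s in Rp) (K * wfun 1 s).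
  by apply: Rintegral_ge0 => s _; rewrite mulr_ge0 ?wfun_ge0 ?ltW.
exists (\int[mu]_(s in Rp) (K * wfun 1 s) + 1); first by rewrite ltr_pwDr.
move=> al x aal; have al0 : 0 < al by exact: lt_le_trans aal.
rewrite f_alphaE// normrM (@le_trans _ _ `|ct (phi al) x|)//.
  by rewrite ler_piMr// ger0_norm ?invr_ge0 ?pi_ge0// invf_le1 ?pi_gt0// (le_trans _ (pi_ge2 _))// ler1n.
rewrite (le_trans (cos_transform_le x (phi_integrable al0)))//.
rewrite (@le_trans _ _ (\int[mu]_(s in Rp) (K * wfun 1 s)))// ?lerDl//.
apply: le_Rintegral_leb => //; first exact: integrable_norm_leb (phi_integrable al0).
move=> s /RpP s0; rewrite gtr0_norm ?phi_gt0//.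
by have := H al s aal s0; rewrite expr0 mul1r.
Qed.

Lemma f_alpha_lipschitz a : 0 < a ->
  exists2 L : R, 0 < L & forall al x y, a <= al ->
    `|f_alpha al x - f_alpha al y| <= L * `|x - y|.
Proof.
move=> a0; have [K K0 H] := phi_dom 1 a0.
have iw : mu.-integrable Rp (EFin \o (fun s => K * wfun 1 s)).
  by apply: integrableZ_leb => //; exact: wfun_integrable.
have I0 : 0 <= \int[mu]_(s in Rp) (K * wfun 1 s).
  by apply: Rintegral_ge0 => s _; rewrite mulr_ge0 ?wfun_ge0 ?ltW.
exists (\int[mu]_(s in Rp) (K * wfun 1 s) + 1); first by rewrite ltr_pwDr.
move=> al x y aal; have al0 : 0 < al by exact: lt_le_trans aal.
have le1 s : 0 < s -> `|s * phi al s| <= K * wfun 1 s.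
  move=> s0; rewrite ger0_norm ?mulr_ge0 ?(ltW s0) ?(ltW (phi_gt0 _ _))//.
  rewrite (le_trans _ (H al s aal s0))// expr1 ler_pM2r ?phi_gt0//; lra.
have is1 : mu.-integrable Rp (EFin \o (fun s => s * phi al s)).
  apply: (@wfun_integrable_dom R 1 K) => //.
  by apply: measurable_funM => //; exact: phi_measurable.
rewrite !f_alphaE// -mulrBl normrM (@le_trans _ _ `|ct (phi al) x - ct (phi al) y|)//.
  by rewrite ler_piMr// ger0_norm ?invr_ge0 ?pi_ge0// invf_le1 ?pi_gt0// (le_trans _ (pi_ge2 _))// ler1n.
rewrite (le_trans (cos_transform_lipschitz x y (phi_integrable al0) is1))//.
rewrite ler_wpM2r//.
rewrite (@le_trans _ _ (\int[mu]_(s in Rp) (K * wfun 1 s)))// ?lerDl//.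
apply: le_Rintegral_leb => //; first exact: integrable_norm_leb is1.
by move=> s /RpP s0; exact: le1.
Qed.

Lemma f_alpha_continuous al x : 0 < al -> {for x, continuous (f_alpha al)}.
Proof.
move=> al0; have [L L0 H] := f_alpha_lipschitz al0.
apply/cvgrPdist_le => e e0; near=> y.
rewrite (le_trans (H _ _ _ (lexx _)))// -ler_pdivlMl//.
by near: y; apply: (@cvgr_dist_le _ _ _ _ _ id x) => //; rewrite mulr_gt0// invr_gt0.
Unshelve. all: by end_near. Qed.

Lemma f_alpha_measurable al D : 0 < al -> measurable_fun D (f_alpha al).
Proof.
move=> al0; apply: measurable_funTS; apply: continuous_measurable_fun => x.
exact: f_alpha_continuous.
Qed.

Lemma powR_exponent_continuous s x : 0 < s -> {for x, continuous (fun be => s `^ be)}.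
Proof.
move=> s0.
have -> : (fun be => s `^ be) = (fun be => expR (be * ln s)).
  by apply/funext => be; rewrite /powR gt_eqF.
apply: (@continuous_comp _ _ _ (fun be : R => be * ln s) expR); last exact: continuous_expR.
by apply: cvgM; [exact: cvg_id|exact: cvg_cst].
Qed.

Lemma f_alpha_index_continuous al e : 0 < al -> 0 < e ->
  exists2 d : R, 0 < d & forall be x, `|be - al| < d -> `|f_alpha be x - f_alpha al x| <= e.
Proof.
move=> al0 e0.
have a20 : 0 < al / 2 by rewrite divr_gt0.
have [K K0 H] := phi_dom 0 a20.
have phile be s : al / 2 <= be -> 0 < s -> phi be s <= K * wfun 1 s.
  by move=> h s0; have := H be s h s0; rewrite expr0 mul1r.
have iw : mu.-integrable Rp (EFin \o (fun s => K * wfun 1 s)).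
  by apply: integrableZ_leb => //; exact: wfun_integrable.
have iw2 : mu.-integrable Rp (EFin \o (fun s => K * wfun 1 s + K * wfun 1 s)).
  by apply: integrableD_leb.
pose F be := \int[mu]_(s in Rp) `|phi be s - phi al s|.
have lew be s : al / 2 < be -> 0 < s -> `|phi be s - phi al s| <= K * wfun 1 s + K * wfun 1 s.
  move=> h s0; rewrite (le_trans (ler_normB _ _))// !gtr0_norm ?phi_gt0//.
  by rewrite lerD// phile//; lra.
have cF : {in `](al / 2), (al + 1)[%classic, continuous F}.
  apply: (@continuity_under_integral R _ (measurableTypeR R) mu
      (fun be s => `|phi be s - phi al s|) Rp _ (al / 2) (al + 1) _ _ (fun s => K * wfun 1 s + K * wfun 1 s)) => //.
  - move=> be; rewrite /= in_itv/= => /andP[be1 be2].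
    apply: (@integrable_dom_leb _ Rp _ (fun s => K * wfun 1 s + K * wfun 1 s)) => //.
      apply: measurableT_comp => //.
      by apply: measurable_funB; exact: phi_measurable.
    by move=> s /RpP s0; rewrite normr_id; exact: lew.
  - apply: aeW => s /RpP s0 be _.
    apply: cvg_norm; apply: cvgB; last exact: cvg_cst.
    apply: (@continuous_comp _ _ _ (fun be : R => - (s `^ be)) expR); last exact: continuous_expR.
    by apply: continuousN; exact: powR_exponent_continuous.
  - move=> be; rewrite /= in_itv/= => /andP[be1 be2]; apply: aeW => s /RpP s0.
    by rewrite normr_id; exact: lew.
have Fal : F al = 0.
  rewrite /F; under eq_Rintegral do rewrite subrr normr0.
  by rewrite Rintegral_cst// mul0r.
have alI : al \in `](al / 2), (al + 1)[%classic by rewrite inE/= in_itv/=; apply/andP; split; lra.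
have /cvgrPdist_le/(_ e e0) := cF _ alI.
rewrite Fal => /nbhs_ballP[d /= d0 Hd].
exists (Num.min d (al / 2)); first by rewrite lt_min d0.
move=> be x; rewrite lt_min => /andP[bed]; rewrite ltr_norml => /andP[be1 be2].
have be0 : 0 < be by lra.
rewrite !f_alphaE// -mulrBl normrM (@le_trans _ _ `|ct (phi be) x - ct (phi al) x|)//.
  by rewrite ler_piMr// ger0_norm ?invr_ge0 ?pi_ge0// invf_le1 ?pi_gt0// (le_trans _ (pi_ge2 _))// ler1n.
have ibe := phi_integrable be0; have ial := phi_integrable al0.
have iba := integrableB_leb (measurable_itv _) ibe ial.
rewrite /ct -RintegralB//; [|exact: cos_transform_integrable..].
under eq_Rintegral do rewrite -mulrBl.
have := @cos_transform_le (fun s => phi be s - phi al s) x iba.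
move=> /le_trans; apply.
have := Hd be; rewrite /ball/= distrC => /(_ bed).
by rewrite sub0r normrN => /(le_trans (ler_norm _)).
Qed.

End stable_transform.

Section stable_tail.
Variable R : realType.
Local Notation mu := (@lebesgue_measure R).
Local Notation Rp := (`]0%R, +oo[%classic : set R).
Local Notation phi := (@stable_cf R).
Local Notation ct := (@cos_transform R).
Implicit Types a al be s x y h K L : R.

Let phi1 al s : R := - (al * s `^ (al - 1)) * phi al s.
Let phi2 al s : R :=
  (al ^+ 2 * (s `^ (al - 1)) ^+ 2 - al * (al - 1) * s `^ (al - 2)) * phi al s.

Lemma phi_derive al s : 0 < s -> is_derive s 1 (phi al) (phi1 al s).
Proof.
move=> s0.
have D := @is_derive_compR R expR (fun s => - (s `^ al)) s _ _ (is_derive_expR (- (s `^ al))) (is_deriveNR (is_derive1_powR al s0)).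
by apply: (is_derive_val_eq D); rewrite mulrC.
Qed.

Lemma phi1_derive al s : 0 < s -> is_derive s 1 (phi1 al) (phi2 al s).
Proof.
move=> s0.
have D := is_deriveMR (is_deriveNR (is_deriveMR (is_derive_cstR al s) (is_derive1_powR (al - 1) s0)))
  (phi_derive al s0).
apply: (is_derive_val_eq D); rewrite /phi1 /phi2 mulr0 addr0.
rewrite (_ : al - 1 - 1 = al - 2); last by ring.
ring.
Qed.

Let phi1_bound a : 0 < a -> exists2 K : R, 0 < K & forall al s, a <= al <= 2 -> 0 < s ->
  `|phi1 al s| <= K * s `^ (a - 1).
Proof.
move=> a0; have [K K0 H] := phi_decay 2 a0; exists (2 + 2 * K); first by lra.
move=> al s /andP[aal al2] s0.
have al0 : 0 < al by exact: lt_le_trans aal.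
have p0 := phi_gt0 al s.
rewrite /phi1 normrM normrN (gtr0_norm p0) ger0_norm ?mulr_ge0 ?powR_ge0 ?(ltW al0)//.
have [s1|s1] := leP s 1.
  have h1 : s `^ (al - 1) <= s `^ (a - 1) by rewrite ger_powR ?s0//; lra.
  have h2 := phi_le1 al s; have h3 := powR_ge0 s (al - 1).
  have h4 : al * s `^ (al - 1) * phi al s <= 2 * s `^ (a - 1) * 1.
    by apply: ler_pM => //; [rewrite mulr_ge0 ?(ltW al0)|exact: ltW|apply: ler_pM => //; exact: ltW].
  have h5 : 0 <= 2 * K * s `^ (a - 1) by rewrite !mulr_ge0 ?powR_ge0 ?(ltW K0).
  by rewrite mulrDl; lra.
have h1 : s `^ (al - 1) <= s by rewrite -[leRHS]powRr1 ?(ltW s0)// ler_powR ?(ltW s1)//; lra.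
have h2 : s ^+ 2 * phi al s <= K.
  rewrite (le_trans _ (H al s aal s0))// ler_wpM2r ?(ltW p0)// lerXn2r ?nnegrE//; lra.
have h3 : s * phi al s <= K * s `^ (-1).
  by rewrite powR_inv1 ?(ltW s0)// ler_pdivlMr// mulrAC -expr2.
have h4 : s `^ (-1) <= s `^ (a - 1) by rewrite ler_powR ?(ltW s1)//; lra.
have h5 : al * s `^ (al - 1) * phi al s <= 2 * s * phi al s.
  by rewrite ler_pM2r// ler_pM ?powR_ge0 ?(ltW al0).
have h6 := powR_ge0 s (a - 1).
nra.
Qed.

Let phi2_bound a : 0 < a <= 1 -> exists2 K : R, 0 < K & forall al s, a <= al <= 2 -> 0 < s ->
  `|phi2 al s| <= K * s `^ (a - 2).
Proof.
move=> /andP[a0 a1]; have [K K0 H] := phi_decay 4 a0; exists (8 + 8 * K); first by lra.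
move=> al s /andP[aal al2] s0.
have al0 : 0 < al by exact: lt_le_trans aal.
have p0 := phi_gt0 al s.
rewrite /phi2 normrM (gtr0_norm p0).
have q0 := powR_ge0 s (a - 2).
have t1 : `|al ^+ 2 * (s `^ (al - 1)) ^+ 2 - al * (al - 1) * s `^ (al - 2)| <=
    4 * (s `^ (al - 1)) ^+ 2 + 4 * s `^ (al - 2).
  rewrite (le_trans (ler_normB _ _))// lerD//.
    by rewrite ger0_norm ?mulr_ge0 ?exprn_ge0 ?powR_ge0 ?(ltW al0)// ler_wpM2r ?exprn_ge0 ?powR_ge0//; nra.
  rewrite normrM [X in _ * X]ger0_norm ?powR_ge0//  ler_wpM2r ?powR_ge0// ler_norml.
  by apply/andP; split; nra.
have e2 : (s `^ (al - 1)) ^+ 2 = s `^ (2 * al - 2).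
  by rewrite -powR_mulrn ?powR_ge0// -powRrM; congr (_ `^ _); ring.
rewrite e2 in t1.
have [s1|s1] := leP s 1.
  have h1 : s `^ (2 * al - 2) <= s `^ (a - 2) by rewrite ger_powR ?s0//; lra.
  have h2 : s `^ (al - 2) <= s `^ (a - 2) by rewrite ger_powR ?s0//; lra.
  have h3 := phi_le1 al s.
  have h4 : `|al ^+ 2 * (s `^ (al - 1)) ^+ 2 - al * (al - 1) * s `^ (al - 2)| * phi al s <=
    8 * s `^ (a - 2) * 1.
    by rewrite ler_pM// ?(ltW p0)// e2; lra.
  by rewrite (le_trans h4)// mulr1 ler_wpM2r//; lra.
have h1 : s `^ (2 * al - 2) <= s ^+ 2.
  by rewrite -[leRHS]powR_mulrn ?(ltW s0)// ler_powR ?(ltW s1)//; lra.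
have h2 : s `^ (al - 2) <= s ^+ 2.
  by rewrite -[leRHS]powR_mulrn ?(ltW s0)// ler_powR ?(ltW s1)//; lra.
have h3 : s ^+ 4 * phi al s <= K.
  rewrite (le_trans _ (H al s aal s0))// ler_wpM2r ?(ltW p0)// lerXn2r ?nnegrE//; lra.
have h4 : s ^+ 2 * phi al s <= K * s `^ (- 2).
  rewrite (powR_invn 2) ?(ltW s0)// ler_pdivlMr ?exprn_gt0//.
  by rewrite mulrAC -exprD.
have h5 : s `^ (- 2) <= s `^ (a - 2) by rewrite ler_powR ?(ltW s1)//; lra.
have h6 : `|al ^+ 2 * (s `^ (al - 1)) ^+ 2 - al * (al - 1) * s `^ (al - 2)| * phi al s <=
    8 * s ^+ 2 * phi al s.
  by rewrite ler_pM2r// e2; lra.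
nra.
Qed.

Let powR_tail_integrable h a : 0 < h -> a < 1 ->
  mu.-integrable `]h, +oo[ (EFin \o (fun s => s `^ (a - 2))) /\
  \int[mu]_(s in `]h, +oo[) s `^ (a - 2) <= h `^ (a - 1) / (1 - a).
Proof.
move=> h0 a1.
pose G s := - (s `^ (a - 1) / (1 - a)).
have g0 x : h < x -> 0 <= x `^ (a - 2) by move=> _; exact: powR_ge0.
have x0 x : h < x -> 0 < x by exact: lt_trans.
have cg x : h < x -> {for x, continuous (fun s => s `^ (a - 2))}.
  by move=> /x0; exact: powR_continuous_pt.
have dG x : h < x -> is_derive x 1 G (x `^ (a - 2)).
  move=> /x0 hx.
  have D := is_deriveNR (is_deriveMR (is_derive1_powR (a - 1) hx) (is_derive_cstR (1 - a)^-1 x)).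
  apply: (is_derive_val_eq D); rewrite mulr0 add0r (_ : a - 1 - 1 = a - 2); last by ring.
  by field; lra.
have bG x : h < x -> - (h `^ (a - 1) / (1 - a)) <= G x <= 0.
  move=> hx; rewrite lerN2 oppr_le0 mulr_ge0 ?powR_ge0 ?invr_ge0 ?subr_ge0 ?(ltW a1)// andbT.
  rewrite ler_pM2r ?invr_gt0 ?subr_gt0//.
  have -> : a - 1 = - (1 - a) by ring.
  rewrite !powRN lef_pV2 ?posrE ?powR_gt0 ?(x0 _ hx)//.
  by rewrite ge0_ler_powR ?nnegrE ?(ltW h0) ?(ltW hx) ?subr_ge0 ?(ltW a1) ?(ltW (x0 _ hx)).
have I := integrable_FTC2_ge0_halfline g0 cg dG bG; split => //.
have := FTC2_ge0_halfline g0 cg dG bG.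
rewrite -[X in (X <= _)%E -> _]fineK; last exact: integrable_fin_num.
by rewrite lee_fin sub0r opprK.
Qed.

Lemma Rintegral_split_halfline h (m : R -> R) : 0 < h -> mu.-integrable Rp (EFin \o m) ->
  \int[mu]_(s in Rp) m s = \int[mu]_(s in `]0, h]) m s + \int[mu]_(s in `]h, +oo[) m s.
Proof.
move=> h0 im.
have e : Rp = `]0, h]%classic `|` `]h, +oo[%classic.
  apply/seteqP; split => s /=; rewrite !in_itv/= !andbT.
    by move=> s0; have [sh|sh] := leP s h; [left; rewrite s0|right].
  by move=> [/andP[]//|]; exact: lt_trans.
rewrite {1}e Rintegral_setU//; first by rewrite -e.
by apply/disj_setPS => s [/=]; rewrite !in_itv/= andbT => /andP[_ sh] /(le_lt_trans sh); rewrite ltxx.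
Qed.

Lemma f_alpha_tail a : 0 < a <= 2^-1 ->
  exists2 K : R, 0 < K & forall al x, a <= al <= 2 -> 0 < x ->
    `|f_alpha al x| <= K * x `^ (- 1 - a).
Proof.
move=> /andP[a0 a12].
have a1 : a < 1 by lra.
have [K1 K10 H1] := phi1_bound a0.
have [K2 K20 H2] : exists2 K : R, 0 < K & forall al s, a <= al <= 2 -> 0 < s ->
  `|phi2 al s| <= K * s `^ (a - 2) by apply: phi2_bound; rewrite a0 ltW.
have [K3 K30 H3] := phi_decay 1 a0.
pose C := 1 + K1 + K2 / (1 - a).
have C0 : 0 < C by rewrite /C !addr_gt0 ?divr_gt0 ?subr_gt0.
exists (C * pi `^ (1 + a)); first by rewrite mulr_gt0 ?powR_gt0 ?pi_gt0.
move=> al x /[dup] ala /andP[aal al2] x0.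
have al0 : 0 < al by exact: lt_le_trans aal.
pose h := pi / x.
have h0 : 0 < h by rewrite divr_gt0 ?pi_gt0.
have hx : h * x = pi by rewrite divfK ?gt_eqF.
have hE : pi `^ (1 + a) * x `^ (- 1 - a) = h `^ (1 + a).
  rewrite /h powRM ?pi_ge0 ?invr_ge0 ?(ltW x0)//; congr (_ * _).
  by rewrite -powR_inv1 ?(ltW x0)// -powRrM; congr (_ `^ _); ring.
rewrite -mulrA hE.
have h1aE : h `^ (1 + a) = h * h `^ a.
  by rewrite powRD ?(gt_eqF h0) ?implybT// powRr1 ?(ltW h0).
have hm1E : h `^ (a - 1) * h ^+ 2 = h `^ (1 + a).
  rewrite -powR_mulrn ?(ltW h0)// -powRD ?(gt_eqF h0) ?implybT//; congr (_ `^ _); ring.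
have xh : x^-1 <= h.
  by rewrite /h -[leLHS]mul1r ler_pM2r ?invr_gt0// (le_trans _ (pi_ge2 _))// ler1n.
have x2h : x ^- 2 <= h ^+ 2 by rewrite -exprVn lerXn2r ?nnegrE ?invr_ge0 ?(ltW x0) ?(ltW h0).
have ip := phi_integrable al0.
have ic := cos_transform_integrable x ip.
suff B : `|ct (phi al) x| <= C * h `^ (1 + a).
  rewrite f_alphaE// normrM (le_trans _ B)//.
  by rewrite ler_piMr// ger0_norm ?invr_ge0 ?pi_ge0// invf_le1 ?pi_gt0// (le_trans _ (pi_ge2 _))// ler1n.
rewrite /ct (Rintegral_split_halfline h0 ic).
have B1 : `|\int[mu]_(s in `]0, h]) (phi al s * cos (s * x))| <= h `^ (1 + a).
  have z : (\int[mu]_(s in `]0, h]) cos (s * x))%R = 0.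
    rewrite (@Rintegral_itv_obnd_cbnd R); last first.
      apply: (@integrable_dom_leb _ _ _ (fun=> 1)) => //; first exact: cosM_measurable.
        by apply: integrable_cst_leb => //=; rewrite lebesgue_measure_itv/= lte_fin h0 ltry.
      by move=> s _; exact: cos_max.
    have dd s : 0 <= s <= h -> is_derive s 1 (fun s => sin (s * x) / x) (cos (s * x)).
      move=> _.
      have D := is_deriveMR (is_derive_sinM s x) (is_derive_cstR x^-1 s).
      by apply: (is_derive_val_eq D); rewrite mulr0 add0r; field; rewrite gt_eqF.
    have cc s : 0 <= s <= h -> {for s, continuous (fun s => cos (s * x))}.
      by move=> _; exact: is_derive_continuous (is_derive_cosM s x).
    by rewrite /Rintegral (FTC2_closed h0 cc dd)/= hx sinpi !mul0r sin0 mul0r subr0.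
  have fin01 : mu `]0, h] \is a fin_num by rewrite lebesgue_measure_itv/= lte_fin h0.
  have ib (k : R) : mu.-integrable `]0, h] (EFin \o (fun=> k)).
    by apply: integrable_cst_leb => //=; rewrite lebesgue_measure_itv/= lte_fin h0 ltry.
  have i2 : mu.-integrable `]0, h] (EFin \o (fun s => cos (s * x))).
    apply: (@integrable_dom_leb _ _ _ (fun=> 1)) => //; first exact: cosM_measurable.
    by move=> s _; exact: cos_max.
  have i1 : mu.-integrable `]0, h] (EFin \o (fun s => phi al s * cos (s * x))).
    apply: (@integrable_dom_leb _ _ _ (fun=> 1)) => //.
      by apply: measurable_funM; [exact: phi_measurable|exact: cosM_measurable].
    move=> s _; rewrite normrM (gtr0_norm (phi_gt0 _ _)).
    by rewrite mulr_ile1 ?phi_le1 ?cos_max ?(ltW (phi_gt0 _ _)).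
  have -> : \int[mu]_(s in `]0, h]) (phi al s * cos (s * x)) =
      \int[mu]_(s in `]0, h]) (phi al s * cos (s * x) - cos (s * x)).
    by rewrite RintegralB// z subr0.
  have i3 := integrableB_leb (measurable_itv _) i1 i2.
  rewrite (le_trans (le_normr_Rintegral _ i3))//.
  apply: (@le_trans _ _ (\int[mu]_(s in `]0, h]) (h `^ a))).
    apply: le_Rintegral_leb => //; first exact: integrable_norm_leb i3.
    move=> s; rewrite /= in_itv/= => /andP[s0 sh].
    rewrite -[X in _ - X]mul1r -mulrBl normrM (@le_trans _ _ `|phi al s - 1|)//.
      by rewrite ler_piMr ?cos_max.
    rewrite ler0_norm ?subr_le0 ?phi_le1// opprB.
    have sa : s `^ a <= h `^ a by rewrite ge0_ler_powR ?nnegrE ?(ltW s0) ?(ltW a0) ?(ltW h0).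
    rewrite (le_trans _ sa)//.
    have [s1|s1] := leP s 1.
      have q : 1 - s `^ al <= phi al s by rewrite /stable_cf (le_trans _ (expR_ge1Dx _))// lexx.
      have q2 : s `^ al <= s `^ a by rewrite ger_powR ?s0.
      by move: q q2; clear_after powR_tail_integrable; lra.
    have q : 1 <= s `^ a by rewrite -{1}(powRr0 s) ler_powR ?(ltW s1) ?(ltW a0).
    by have := phi_gt0 al s; move: q; clear_after powR_tail_integrable; lra.
  rewrite Rintegral_cst//= lebesgue_measure_itv/= lte_fin h0/= subr0 h1aE mulrC//.
have [I3 B3] := powR_tail_integrable h0 a1.
have B2 : `|\int[mu]_(s in `]h, +oo[) (phi al s * cos (s * x))| <= (K1 + K2 / (1 - a)) * h `^ (1 + a).
  pose G s := phi al s * (sin (s * x) / x) + phi1 al s * (cos (s * x) / x ^+ 2).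
  pose g1 s := phi al s * cos (s * x).
  pose g2 s := phi2 al s * (cos (s * x) / x ^+ 2).
  have s0 s : h < s -> 0 < s by exact: lt_trans.
  have xn : x != 0 by rewrite gt_eqF.
  have dsin s := is_derive_sinM s x.
  have dcos s := is_derive_cosM s x.
  have dG s : h < s -> is_derive s 1 G (g1 s + g2 s).
    move=> /s0 ss.
    have D := is_deriveDR (is_deriveMR (phi_derive al ss) (is_deriveMR (dsin s) (is_derive_cstR x^-1 s)))
      (is_deriveMR (phi1_derive al ss) (is_deriveMR (dcos s) (is_derive_cstR (x ^+ 2)^-1 s))).
    apply: (is_derive_val_eq D); rewrite /g1 /g2.
    move: (phi al s) (phi1 al s) (phi2 al s) (cos _) (sin _) => A B C' c' s'.
    by field.
  have ccos s : {for s, continuous (fun s => cos (s * x))} := is_derive_continuous (dcos s).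
  have cphi s : 0 < s -> {for s, continuous (phi al)} by move=> ss; exact: is_derive_continuous (phi_derive al ss).
  have cphi2 s : 0 < s -> {for s, continuous (phi2 al)}.
    move=> ss; apply: continuousM; last exact: cphi.
    apply: continuousB.
      apply: continuousM; first exact: cvg_cst.
      have c := @powR_continuous_pt R (al - 1) s ss.
      exact: (@continuousM _ _ _ _ s c c).
    by apply: continuousM; [exact: cvg_cst|exact: powR_continuous_pt].
  have cg s : h < s -> {for s, continuous (fun s => g1 s + g2 s)}.
    move=> /s0 ss; apply: continuousD; apply: continuousM.
    - exact: cphi.
    - exact: ccos.
    - exact: cphi2.
    - by apply: continuousM; [exact: ccos|exact: cvg_cst].
  have Dsub : `]h, +oo[ `<=` Rp by move=> s /=; rewrite !in_itv/= !andbT; exact: s0.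
  have ig1 : mu.-integrable `]h, +oo[ (EFin \o g1).
    by apply: (integrableS_leb _ _ Dsub ic).
  have g2le s : h < s -> `|g2 s| <= K2 / x ^+ 2 * s `^ (a - 2).
    move=> /s0 ss; rewrite /g2 normrM.
    have e1 := H2 al s ala ss.
    have e2 : `|cos (s * x) / x ^+ 2| <= (x ^+ 2)^-1.
      by rewrite normrM normfV (ger0_norm (sqr_ge0 x)) ler_piMl ?cos_max// invr_ge0 sqr_ge0.
    apply: (le_trans (ler_pM _ _ e1 e2)) => //.
    by rewrite mulrAC.
  have mg2 : measurable_fun `]h, +oo[ g2.
    apply: continuous_itvoy_measurable => s /s0 ss.
    by apply: continuousM; [exact: cphi2|apply: continuousM; [exact: ccos|exact: cvg_cst]].
  have iK2 := integrableZ_leb (K2 / x ^+ 2) (measurable_itv _) I3.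
  have ig2 : mu.-integrable `]h, +oo[ (EFin \o g2).
    apply: (integrable_dom_leb _ mg2 iK2) => //.
    by move=> s; rewrite /= in_itv/= andbT; exact: g2le.
  have clim : G (h + n.+1%:R) @[n --> \oo] --> (0 : R).
    apply/cvgr0Pnorm_le => e e0; near=> n.
    have sn0 : 0 < h + n.+1%:R by rewrite addr_gt0.
    have sn1 : 1 <= h + n.+1%:R by rewrite (@le_trans _ _ n.+1%:R) ?ler1n// lerDr ltW.
    have p0 := phi_gt0 al (h + n.+1%:R).
    have u := H3 al _ aal sn0; rewrite expr1 in u.
    have v : `|phi1 al (h + n.+1%:R)| <= K1 * (h + n.+1%:R) `^ (a - 1) by exact: H1.
    have w1 : `|G (h + n.+1%:R)| <= phi al (h + n.+1%:R) / x + `|phi1 al (h + n.+1%:R)| / x ^+ 2.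
      rewrite (le_trans (ler_normD _ _))// lerD//.
        rewrite normrM (gtr0_norm p0) ler_pM2l// normrM normfV (gtr0_norm x0).
        by rewrite ler_piMl ?sin_max// invr_ge0 ltW.
      rewrite normrM ler_wpM2l// normrM normfV (ger0_norm (sqr_ge0 x)).
      by rewrite ler_piMl ?cos_max// invr_ge0 sqr_ge0.
    rewrite (le_trans w1)// [leRHS](_ : e = e / 2 + e / 2); last by field.
    rewrite lerD//.
      rewrite ler_pdivrMr// -(@ler_pM2l _ (1 + (h + n.+1%:R))) ?addr_gt0//.
      rewrite (le_trans u)// -ler_pdivrMr ?mulr_gt0 ?divr_gt0//.
      rewrite (@le_trans _ _ n%:R)//; first by near: n; exact: nbhs_infty_ger.
      by rewrite -addn1 natrD; move: h0; clear_after powR_tail_integrable; lra.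
    rewrite (le_trans (ler_wpM2r _ v)) ?invr_ge0 ?sqr_ge0//.
    rewrite ler_pdivrMr ?exprn_gt0// -ler_pdivlMl//.
    have q : (h + n.+1%:R) `^ (a - 1) <= (n.+1%:R : R) `^ (a - 1).
      have -> : a - 1 = - (1 - a) by ring.
      rewrite !powRN lef_pV2 ?posrE ?powR_gt0//.
      by rewrite ge0_ler_powR ?nnegrE ?subr_ge0 ?(ltW a1) ?addr_ge0 ?(ltW h0)// lerDr ltW.
    rewrite (le_trans q)//.
    have q2 : (n.+1%:R : R) `^ (a - 1) <= (n.+1%:R : R) `^ (- 2^-1) by rewrite ler_powR ?ler1n//; move: a12; clear_after powR_tail_integrable; lra.
    rewrite (le_trans q2)// powRN powR12_sqrt// -[leRHS]invrK lef_pV2 ?posrE ?sqrtr_gt0// ?invr_gt0 ?mulr_gt0 ?invr_gt0 ?divr_gt0 ?exprn_gt0//.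
    set z := _^-1; have z0 : 0 <= z by rewrite invr_ge0 ltW// !mulr_gt0 ?invr_gt0 ?exprn_gt0.
    rewrite -(ger0_norm z0) -sqrtr_sqr ler_sqrt ?ler0n//.
    rewrite (@le_trans _ _ n%:R)//; first by near: n; exact: nbhs_infty_ger.
    by rewrite ler_nat.
  have cG : {for h, continuous G}.
    have D := is_deriveDR (is_deriveMR (phi_derive al h0) (is_deriveMR (dsin h) (is_derive_cstR x^-1 h)))
      (is_deriveMR (phi1_derive al h0) (is_deriveMR (dcos h) (is_derive_cstR (x ^+ 2)^-1 h))).
    exact: (is_derive_continuous D).
  have clow : G (h + n.+2%:R^-1) @[n --> \oo] --> G h.
    have c : h + n.+2%:R^-1 @[n --> \oo] --> h.
      rewrite -[X in _ --> X]addr0; apply: cvgD; first exact: cvg_cst.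
      have := @cvg_harmonic R; rewrite -(cvg_shiftS (@harmonic R)); exact.
    exact: (cvgn_continuous c cG).
  have I12 := integrableD_leb (measurable_itv _) ig1 ig2.
  have E := FTC2_halfline I12 cg dG clow clim.
  have Gh : G h = - (phi1 al h / x ^+ 2).
    by rewrite /G hx sinpi cospi mul0r mulr0 add0r mulrA mulrN1 mulNr.
  have E2 : \int[mu]_(s in `]h, +oo[) g1 s = phi1 al h / x ^+ 2 - \int[mu]_(s in `]h, +oo[) g2 s.
    move: E; rewrite RintegralD// Gh sub0r opprK => <-.
    by rewrite addrK.
  rewrite -/(g1 _) E2 (le_trans (ler_normB _ _))// mulrDl lerD//.
    rewrite normrM normfV (ger0_norm (sqr_ge0 x)).
    have v : `|phi1 al h| <= K1 * h `^ (a - 1) by exact: H1.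
    rewrite (@le_trans _ _ (K1 * h `^ (a - 1) * h ^+ 2))//.
      by apply: ler_pM => //; rewrite invr_ge0 sqr_ge0.
    by rewrite -mulrA hm1E.
  rewrite (le_trans (le_normr_Rintegral _ ig2))//.
  apply: (@le_trans _ _ (\int[mu]_(s in `]h, +oo[) (K2 / x ^+ 2 * s `^ (a - 2)))).
    apply: le_Rintegral_leb => //; first exact: integrable_norm_leb ig2.
    by move=> s; rewrite /= in_itv/= andbT; exact: g2le.
  rewrite RintegralZl//.
  rewrite (le_trans (ler_wpM2l _ B3)) ?divr_ge0 ?sqr_ge0 ?(ltW K20)//.
  rewrite -hm1E.
  have -> : K2 / x ^+ 2 * (h `^ (a - 1) / (1 - a)) = K2 / (1 - a) * h `^ (a - 1) * x ^- 2 by ring.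
  rewrite -mulrA ler_wpM2l ?divr_ge0 ?(ltW K20) ?subr_ge0 ?(ltW a1)//.
  by rewrite ler_wpM2l ?powR_ge0.
rewrite (le_trans (ler_normD _ _))//.
apply: (le_trans (lerD B1 B2)).
by rewrite /C -{1}[X in X + _]mul1r -mulrDl addrA.
Unshelve. all: by end_near. Qed.

End stable_tail.

Section parseval.
Variable R : realType.
Local Notation mu := (@lebesgue_measure R).
Local Notation Rp := (`]0%R, +oo[%classic : set R).
Local Notation phi := (@stable_cf R).
Local Notation ct := (@cos_transform R).
Implicit Types a al be s u x y c d e K L : R.

Lemma measurable_cosR : measurable_fun [set: R] (@cos R).
Proof. by apply: continuous_measurable_fun; exact: continuous_cos. Qed.

Lemma restrict_measurable_leb (D : set R) (f : R -> R) : measurable D ->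
  measurable_fun D f -> measurable_fun [set: R] (f \_ D).
Proof. by move=> mD mf; exact/(measurable_restrictT _ _).1. Qed.

Lemma cos_transform_parseval (m b : R -> R) :
  mu.-integrable Rp (EFin \o m) -> mu.-integrable Rp (EFin \o b) ->
  \int[mu]_(s in Rp) (m s * ct b s) = \int[mu]_(u in Rp) (b u * ct m u).
Proof.
move=> im ib.
pose M := m \_ Rp; pose B := b \_ Rp.
have mM : measurable_fun [set: measurableTypeR R] M.
  by apply: restrict_measurable_leb => //; exact: measurable_int_leb.
have mB : measurable_fun [set: measurableTypeR R] B.
  by apply: restrict_measurable_leb => //; exact: measurable_int_leb.
have iM : mu.-integrable [set: measurableTypeR R] (EFin \o M).
  by move: im => /integrable_mkcond -/(_ (measurable_itv _)); rewrite restrict_EFin.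
have iB : mu.-integrable [set: measurableTypeR R] (EFin \o B).
  by move: ib => /integrable_mkcond -/(_ (measurable_itv _)); rewrite restrict_EFin.
pose f (z : measurableTypeR R * measurableTypeR R) : \bar R := (M z.1 * B z.2 * cos (z.1 * z.2))%:E.
have mf : measurable_fun setT f.
  apply/measurable_EFinP; apply: measurable_funM; first apply: measurable_funM.
  - exact: (measurableT_comp mM measurable_fst).
  - exact: (measurableT_comp mB measurable_snd).
  - apply: (measurableT_comp measurable_cosR).
    by apply: measurable_funM; [exact: measurable_fst|exact: measurable_snd].
have fle x y : (`|f (x, y)| <= `|M x|%:E * `|B y|%:E)%E.
  by rewrite /f/= -EFinM lee_fin !normrM ler_piMr ?cos_max// mulr_ge0.
have maf : measurable_fun setT (fun z => `|f z|%E) by apply: measurableT_comp.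
have intf : ((mu \x mu)%E).-integrable setT f.
  apply/integrable12ltyP => //.
  apply: (@le_lt_trans _ _ (\int[mu]_x (`|M x|%:E * \int[mu]_y `|B y|%:E))%E).
    apply: ge0_le_integral => //.
    - by move=> x _; apply: integral_ge0.
    - exact: (@measurable_fun_fubini_tonelli_F _ _ _ _ _ mu (fun z => `|f z|%E)).
    - apply: emeasurable_funM => //; first by apply/measurable_EFinP; exact: measurableT_comp.
    - move=> x _; rewrite -ge0_integralZl//; last by apply/measurable_EFinP; exact: measurableT_comp.
      apply: ge0_le_integral => //.
      + by apply: measurableT_comp => //; exact: measurableT_comp mf _.
      + by apply: emeasurable_funM => //; apply/measurable_EFinP; exact: measurableT_comp.
  rewrite ge0_integralZr//; last 2 first.
  - by apply/measurable_EFinP; exact: measurableT_comp.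
  - by apply: integral_ge0.
  have /integrableP[_ h1] := iM; have /integrableP[_ h2] := iB.
  by apply: lte_mul_pinfty => //; [exact: integral_ge0|rewrite ge0_fin_numE//; exact: integral_ge0].
have E1 x : (\int[mu]_y f (x, y) = (M x * ct b x)%:E)%E.
  have -> : ct b x = \int[mu]_y (B y * cos (y * x)).
    rewrite /ct Rintegral_mkcond; apply: eq_Rintegral => y _.
    by rewrite /B !patchE; case: ifPn => // _; rewrite mul0r.
  have i1 : mu.-integrable [set: measurableTypeR R] (EFin \o (fun y => B y * cos (y * x))).
    apply: (@integrable_dom_leb _ _ _ (fun y => `|B y|)) => //.
    - by apply: measurable_funM => //; exact: cosM_measurable.
    - exact: integrable_norm_leb iB.
    - by move=> y _; rewrite normrM ler_piMr ?cos_max.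
  rewrite EFinM /Rintegral fineK; last exact: integrable_fin_num.
  rewrite -integralZl//; apply: eq_integral => y _.
  by rewrite /f/= -EFinM mulrA (mulrC x).
have E2 y : (\int[mu]_x f (x, y) = (B y * ct m y)%:E)%E.
  have -> : ct m y = \int[mu]_x (M x * cos (x * y)).
    rewrite /ct Rintegral_mkcond; apply: eq_Rintegral => x _.
    by rewrite /M !patchE; case: ifPn => // _; rewrite mul0r.
  have i1 : mu.-integrable [set: measurableTypeR R] (EFin \o (fun x => M x * cos (x * y))).
    apply: (@integrable_dom_leb _ _ _ (fun y => `|M y|)) => //.
    - by apply: measurable_funM => //; exact: cosM_measurable.
    - exact: integrable_norm_leb iM.
    - by move=> x _; rewrite normrM ler_piMr ?cos_max.
  rewrite EFinM /Rintegral fineK; last exact: integrable_fin_num.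
  rewrite -integralZl//; apply: eq_integral => x _.
  by rewrite /f/= -EFinM mulrA (mulrC (B y)).
transitivity (fine (\int[mu]_x (M x * ct b x)%:E)%E).
  rewrite /Rintegral integral_mkcond; congr fine; apply: eq_integral => s _.
  by rewrite /M !patchE; case: ifPn => // _; rewrite mul0r.
transitivity (fine (\int[mu]_x (B x * ct m x)%:E)%E); last first.
  rewrite /Rintegral integral_mkcond; congr fine; apply: eq_integral => s _.
  by rewrite /B !patchE; case: ifPn => // _; rewrite mul0r.
apply: (congr1 fine).
transitivity (\int[mu]_x \int[mu]_y f (x, y))%E.
  by apply: eq_integral => x _; rewrite E1.
transitivity (\int[mu]_y \int[mu]_x f (x, y))%E; last first.
  by apply: eq_integral => x _; rewrite E2.
transitivity (\int[mu \x mu]_z f z)%E.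
  exact: (integral12_prod_meas1 intf).
exact/esym/(integral21_prod_meas1 intf).
Qed.

Lemma Rintegral_gt0 (D : set R) (g : R -> R) (x0 : R) : measurable D -> nbhs x0 D ->
  mu.-integrable D (EFin \o g) -> (forall x, D x -> 0 <= g x) ->
  {for x0, continuous g} -> 0 < g x0 -> 0 < \int[mu]_(x in D) g x.
Proof.
move=> mD /nbhs_ballP[e1 /= e10 D1] ig g0 cg gx0.
have h0 : 0 < g x0 / 2 by rewrite divr_gt0.
have /cvgrPdist_le/(_ _ h0)/nbhs_ballP[e2 /= e20 D2] := cg.
pose e := Num.min e1 e2 / 2.
have m0 : 0 < Num.min e1 e2 by rewrite lt_min e10.
have e0 : 0 < e by rewrite divr_gt0.
have elt : e < Num.min e1 e2 by rewrite /e; lra.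
have sub y : `[x0, x0 + e]%classic y -> `|x0 - y| < Num.min e1 e2.
  by rewrite /= in_itv/= => /andP[? ?]; rewrite ler0_norm; lra.
have subD : `[x0, x0 + e] `<=` D.
  by move=> y /sub; rewrite lt_min => /andP[h _]; exact: D1.
have lb y : `[x0, x0 + e]%classic y -> g x0 / 2 <= g y.
  move=> /sub; rewrite lt_min => /andP[_ h]; have := D2 y h.
  by rewrite ler_norml => /andP[? ?]; lra.
have fin : (mu `[x0, (x0 + e)%R] < +oo)%E by rewrite lebesgue_measure_itv/= lte_fin ltrDl e0 ltry.
have ic := integrable_cst_leb (g x0 / 2) (measurable_itv _) fin.
have iS := integrableS_leb mD (measurable_itv _) subD ig.
apply: (@lt_le_trans _ _ (\int[mu]_(x in `[x0, (x0 + e)%R]) (g x0 / 2))).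
  rewrite Rintegral_cst//= lebesgue_measure_itv/= lte_fin ltrDl e0/=.
  by rewrite mulr_gt0//; lra.
apply: (@le_trans _ _ (\int[mu]_(x in `[x0, (x0 + e)%R]) g x)).
  exact: le_Rintegral_leb.
rewrite /Rintegral fine_le//; [exact: integrable_fin_num|exact: integrable_fin_num|].
apply: ge0_subset_integral => //.
by apply/measurable_EFinP; exact: measurable_int_leb.
Qed.

Lemma integrable_scale (f : R -> R) c : 0 < c -> mu.-integrable Rp (EFin \o f) ->
  mu.-integrable Rp (EFin \o (fun x => f (c * x))).
Proof.
move=> c0 fi.
have mf := measurable_int_leb fi.
have pre : (fun x : R => c * x + 0) @^-1` Rp = Rp.
  by apply/seteqP; split => x /=; rewrite !in_itv/= !andbT addr0 pmulr_rgt0.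
have mfc : measurable_fun Rp (fun x => f (c * x)).
  apply: (@measurable_comp _ _ _ R R R Rp f _ (fun x => c * x)) => //.
    by move=> _ [x /= + <-]; rewrite !in_itv/= !andbT => ?; rewrite pmulr_rgt0.
  exact: measurable_funM.
apply/integrableP; split; first exact/measurable_EFinP.
have /integrableP[_] := fi.
rewrite (@ge0_integral_affine R c 0 Rp (fun x => `|(EFin \o f) x|)%E)//; last first.
  by apply: measurableT_comp => //; exact/measurable_EFinP.
rewrite pre; under eq_integral do rewrite addr0.
move=> h; rewrite ltey; apply/eqP => e; move: h; rewrite e.
by rewrite gt0_muley ?lte_fin.
Qed.

Lemma Rintegral_scale (f : R -> R) c : 0 < c -> mu.-integrable Rp (EFin \o f) ->
  \int[mu]_(x in Rp) f x = c * \int[mu]_(x in Rp) f (c * x).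
Proof.
move=> c0.
have pre : (fun x : R => c * x + 0) @^-1` Rp = Rp.
  by apply/seteqP; split => x /=; rewrite !in_itv/= !andbT addr0 pmulr_rgt0.
have H (g : R -> R) : mu.-integrable Rp (EFin \o g) -> (forall x, 0 <= g x) ->
    \int[mu]_(x in Rp) g x = c * \int[mu]_(x in Rp) g (c * x).
  move=> gi g0; have gci := integrable_scale c0 gi.
  have := @ge0_integral_affine R c 0 Rp (fun x => (g x)%:E) c0 (measurable_itv _).
  rewrite pre => E; rewrite /Rintegral E//; last 2 first.
  - by apply/measurable_EFinP; exact: measurable_int_leb.
  - by move=> x _; rewrite lee_fin.
  have -> : (\int[mu]_(x in Rp) (g (c * x + 0)%R)%:E = \int[mu]_(x in Rp) (g (c * x)%R)%:E)%E.
    by apply: eq_integral => x _; rewrite addr0.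
  by rewrite fineM//; exact: integrable_fin_num.
move=> fi; have fci := integrable_scale c0 fi.
have ni := integrable_norm_leb fi; have nci := integrable_scale c0 ni.
have pi1 := integrableD_leb (measurable_itv _) ni fi.
have E1 := H _ ni (fun x => normr_ge0 _).
have E2 : \int[mu]_(x in Rp) (`|f x| + f x) = c * \int[mu]_(x in Rp) (`|f (c * x)| + f (c * x)).
  by apply: (H (fun x => `|f x| + f x)) => // x; have := ler_norm (- f x); rewrite normrN; lra.
move: E2; rewrite !RintegralD// E1 mulrDr.
by move=> /addrI.
Qed.

Lemma cos_transform_scale (m : R -> R) c x : 0 < c -> mu.-integrable Rp (EFin \o m) ->
  ct (fun s => m (c * s)) x = c^-1 * ct m (x / c).
Proof.
move=> c0 im; have ic := cos_transform_integrable (x / c) im.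
rewrite /ct (Rintegral_scale c0 ic) mulrA mulVf ?gt_eqF// mul1r.
apply: eq_Rintegral => s _; congr (_ * cos _).
by field; rewrite gt_eqF.
Qed.

Definition exp_decay (d u : R) : R := expR (- (d * u)).
Local Notation ed := exp_decay.

Lemma exp_decay_derive d u : is_derive u 1 (ed d) (- d * ed d u).
Proof.
have D := @is_derive_compR R expR (fun u => - (d * u)) u _ _ (is_derive_expR (- (d * u)))
  (is_deriveNR (is_deriveMR (is_derive_cstR d u) (is_derive_idR u))).
by apply: (is_derive_val_eq D); rewrite mulr1 mulr0 addr0 mulrC.
Qed.

Lemma exp_decay_integrable d : 0 < d -> mu.-integrable Rp (EFin \o ed d).
Proof.
move=> d0.
apply: (@integrable_FTC2_ge0_halfline R 0 (- d^-1) 0 (ed d) (fun u => - d^-1 * ed d u)).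
- by move=> x _; exact: expR_ge0.
- by move=> x _; exact: is_derive_continuous (exp_decay_derive d x).
- move=> x _; have D := is_deriveMR (is_derive_cstR (- d^-1) x) (exp_decay_derive d x).
  by apply: (is_derive_val_eq D); field; rewrite gt_eqF.
- move=> x x0; have e1 : ed d x <= 1 by rewrite expR_le1 oppr_le0 mulr_ge0 ?ltW.
  have e0 : 0 <= ed d x by exact: expR_ge0.
  have d1 : 0 < d^-1 by rewrite invr_gt0.
  by apply/andP; split; nra.
Qed.

Lemma cos_transform_exp_decay d s : 0 < d -> ct (ed d) s = d / (d ^+ 2 + s ^+ 2).
Proof.
move=> d0; have id0 := exp_decay_integrable d0.
have den0 : 0 < d ^+ 2 + s ^+ 2 by rewrite ltr_pwDl ?exprn_gt0// sqr_ge0.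
pose G u := ed d u * ((s * sin (u * s) - d * cos (u * s)) / (d ^+ 2 + s ^+ 2)).
have dG u : is_derive u 1 G (ed d u * cos (u * s)).
  have D := is_deriveMR (exp_decay_derive d u) (is_deriveMR (is_deriveDR
    (is_deriveMR (is_derive_cstR s u) (is_derive_sinM u s))
    (is_deriveNR (is_deriveMR (is_derive_cstR d u) (is_derive_cosM u s))))
    (is_derive_cstR (d ^+ 2 + s ^+ 2)^-1 u)).
  apply: (is_derive_val_eq D); move: (ed d u) (sin _) (cos _) => E S C.
  by field; rewrite gt_eqF.
have cG u : {for u, continuous G} by exact: is_derive_continuous (dG u).
have clow : G (0 + n.+2%:R^-1) @[n --> \oo] --> G 0.
  apply: cvgn_continuous (cG 0).
  rewrite -[X in _ --> X]addr0; apply: cvgD; first exact: cvg_cst.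
  by have := @cvg_harmonic R; rewrite -(cvg_shiftS (@harmonic R)); exact.
have chigh : G (0 + n.+1%:R) @[n --> \oo] --> (0 : R).
  pose B := (`|s| + d) / (d ^+ 2 + s ^+ 2).
  have B0 : 0 <= B by rewrite divr_ge0 ?(ltW den0)// addr_ge0 ?(ltW d0).
  apply/cvgr0Pnorm_le => e e0; near=> n.
  rewrite add0r /G normrM normrM (gtr0_norm (expR_gt0 _)).
  have t : `|s * sin (n.+1%:R * s) - d * cos (n.+1%:R * s)| * `|(d ^+ 2 + s ^+ 2)^-1| <= B.
    rewrite normfV (gtr0_norm den0) ler_pM2r ?invr_gt0// (le_trans (ler_normB _ _))//.
    by rewrite !normrM (gtr0_norm d0) lerD ?ler_piMr ?sin_max ?cos_max ?(ltW d0).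
  rewrite (le_trans (ler_wpM2l _ t)) ?expR_ge0//.
  rewrite /ed expRN mulrC ler_pdivrMr ?expR_gt0//.
  rewrite (@le_trans _ _ (e * (1 + d * n.+1%:R)))//; last by rewrite ler_pM2l// expR_ge1Dx.
  rewrite -ler_pdivrMl// (@le_trans _ _ (d * n%:R))//; last first.
    by rewrite -addn1 natrD mulrDr; lra.
  by rewrite -ler_pdivrMl//; near: n; exact: nbhs_infty_ger.
have cg u : 0 < u -> {for u, continuous (fun u => ed d u * cos (u * s))}.
  move=> _; apply: continuousM; first exact: is_derive_continuous (exp_decay_derive d u).
  exact: is_derive_continuous (is_derive_cosM u s).
rewrite /ct (FTC2_halfline (cos_transform_integrable s id0) cg (fun u _ => dG u) clow chigh).
rewrite /G /ed mulr0 oppr0 expR0 !mul0r sin0 cos0 mulr0 mulr1 mul1r !sub0r mulNr opprK//.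
Unshelve. all: by end_near. Qed.

End parseval.

Section stable_positive.
Variable R : realType.
Local Notation mu := (@lebesgue_measure R).
Local Notation Rp := (`]0%R, +oo[%classic : set R).
Local Notation phi := (@stable_cf R).
Local Notation ct := (@cos_transform R).
Local Notation ed := (@exp_decay R).
Implicit Types a al be s u x y c d e p q K L : R.

Lemma eq_cos_transform (m m' : R -> R) x : (forall s, 0 < s -> m s = m' s) -> ct m x = ct m' x.
Proof. by move=> E; apply: eq_Rintegral => s /set_mem/RpP s0; rewrite E. Qed.

Lemma cos_transformZ (m : R -> R) c x : mu.-integrable Rp (EFin \o m) ->
  ct (fun s => c * m s) x = c * ct m x.
Proof.
move=> im; rewrite /ct -RintegralZl//; last exact: cos_transform_integrable.
by apply: eq_Rintegral => s _; rewrite mulrA.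
Qed.

Lemma cos_transformD (m m' : R -> R) x :
  mu.-integrable Rp (EFin \o m) -> mu.-integrable Rp (EFin \o m') ->
  ct (fun s => m s + m' s) x = ct m x + ct m' x.
Proof.
move=> im im'; rewrite /ct -RintegralD//; [|exact: cos_transform_integrable..].
by apply: eq_Rintegral => s _; rewrite mulrDl.
Qed.

Lemma cos_transform_continuous (m : R -> R) x :
  mu.-integrable Rp (EFin \o m) -> mu.-integrable Rp (EFin \o (fun s => s * m s)) ->
  {for x, continuous (ct m)}.
Proof.
move=> im ism; set L := \int[mu]_(s in Rp) `|s * m s|.
have L0 : 0 <= L by apply: Rintegral_ge0 => s _.
apply/cvgrPdist_le => e e0; near=> y.
rewrite (le_trans (cos_transform_lipschitz _ _ im ism))// -/L.
apply: (@le_trans _ _ ((L + 1) * `|x - y|)); first by rewrite ler_wpM2r//; lra.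
rewrite -ler_pdivlMl; last by lra.
near: y; apply: (@cvgr_dist_le _ _ _ _ _ id x) => //.
by rewrite mulr_gt0// invr_gt0; lra.
Unshelve. all: by end_near. Qed.

Section multiplier.
Variable b : R -> R.
Hypothesis b_ge0 : forall u, 0 <= b u.
Hypothesis ib : mu.-integrable Rp (EFin \o b).
Hypothesis iub : mu.-integrable Rp (EFin \o (fun u => u * b u)).

Let B := \int[mu]_(u in Rp) `|b u|.

Let ctb_le s : `|ct b s| <= B. Proof. exact: cos_transform_le. Qed.

Let ctb_meas D : measurable_fun D (ct b).
Proof.
apply: measurable_funTS; apply: continuous_measurable_fun => s.
exact: cos_transform_continuous.
Qed.

Let mul_integrable (m : R -> R) : mu.-integrable Rp (EFin \o m) ->
  mu.-integrable Rp (EFin \o (fun s => m s * ct b s)).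
Proof.
move=> im; apply: (@integrable_dom_leb _ _ _ (fun s => B * `|m s|)) => //.
- by apply: measurable_funM => //; exact: measurable_int_leb.
- by apply: integrableZ_leb => //; exact: integrable_norm_leb.
- by move=> s _; rewrite normrM mulrC ler_wpM2r.
Qed.

Lemma cos_transform_mul (m : R -> R) x : mu.-integrable Rp (EFin \o m) ->
  ct (fun s => m s * ct b s) x =
  \int[mu]_(u in Rp) (b u * ((ct m (x + u) + ct m (x - u)) / 2)).
Proof.
move=> im; have ic := cos_transform_integrable x im.
rewrite -[LHS]/(\int[mu]_(s in Rp) (m s * ct b s * cos (s * x))).
rewrite (_ : \int[mu]_(s in Rp) _ = \int[mu]_(s in Rp) (m s * cos (s * x) * ct b s)); last first.
  by apply: eq_Rintegral => s _; ring.
rewrite (cos_transform_parseval ic ib); apply: eq_Rintegral => u _; congr (_ * _).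
have i1 := cos_transform_integrable (x + u) im.
have i2 := cos_transform_integrable (x - u) im.
rewrite /ct -RintegralD// -RintegralZr//; last exact: integrableD_leb.
apply: eq_Rintegral => s _.
by rewrite mulrDr mulrBr cosD cosB; field.
Qed.

Lemma cos_transform_mul_ge0 (m : R -> R) x : mu.-integrable Rp (EFin \o m) ->
  (forall y, 0 <= ct m y) -> 0 <= ct (fun s => m s * ct b s) x.
Proof.
move=> im m0; rewrite cos_transform_mul//; apply: Rintegral_ge0 => u _.
by rewrite mulr_ge0// divr_ge0// addr_ge0.
Qed.

Let pow_integrable (m : R -> R) k : mu.-integrable Rp (EFin \o m) ->
  mu.-integrable Rp (EFin \o (fun s => m s * ct b s ^+ k)).
Proof.
elim: k => [|k IH] in m *.
  by move=> im; apply: eq_integrable im => // s _ /=; rewrite expr0 mulr1.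
move=> /mul_integrable/IH; apply: eq_integrable => // s _ /=.
by rewrite exprS mulrA.
Qed.

Let pow_ge0 (m : R -> R) k x : mu.-integrable Rp (EFin \o m) ->
  (forall y, 0 <= ct m y) -> 0 <= ct (fun s => m s * ct b s ^+ k) x.
Proof.
elim: k m => [|k IH] m im m0.
  by rewrite (@eq_cos_transform _ m)// => s _; rewrite expr0 mulr1.
rewrite (@eq_cos_transform _ (fun s => m s * ct b s * ct b s ^+ k)); last first.
  by move=> s _; rewrite exprS mulrA.
by apply: IH => [|y]; [exact: mul_integrable|exact: cos_transform_mul_ge0].
Qed.

Let S n (t : R) : R := \sum_(0 <= k < n) t ^+ k / k`!%:R.

Let S_le n t : `|S n t| <= expR `|t|.
Proof.
rewrite (le_trans (ler_norm_sum _ _ _))//.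
have -> : \sum_(0 <= k < n) `|t ^+ k / k`!%:R| = series (exp_coeff `|t|) n.
  by apply: eq_bigr => k _; rewrite normrM normrX normfV (@ger0_norm _ k`!%:R).
rewrite /expR; apply: nondecreasing_cvgn_le; last exact: is_cvg_series_exp_coeff.
by apply: nondecreasing_series => k _ _; rewrite /exp_coeff/= divr_ge0 ?exprn_ge0.
Qed.

Let S_cvg t : S n t @[n --> \oo] --> expR t.
Proof. exact: (is_cvg_series_exp_coeff t). Qed.

Lemma cos_transform_exp_ge (m : R -> R) x : mu.-integrable Rp (EFin \o m) ->
  (forall y, 0 <= ct m y) ->
  ct (fun s => m s * ct b s) x <= ct (fun s => m s * expR (ct b s)) x /\
  0 <= ct (fun s => m s * expR (ct b s)) x.
Proof.
move=> im m0.
have B0 : 0 <= B by apply: Rintegral_ge0 => s _.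
have mm := measurable_int_leb im.
have Sint n : mu.-integrable Rp (EFin \o (fun s => m s * S n (ct b s))).
  elim: n => [|n IH].
    apply: (@integrable_dom_leb _ _ _ (fun s => `|m s|)) => //; last 2 first.
    - exact: integrable_norm_leb.
    - by move=> s _; rewrite /S big_geq// mulr0 normr0.
    have -> : (fun s => m s * S 0 (ct b s)) = cst 0 by apply/funext => s; rewrite /S big_geq// mulr0.
    exact: measurable_cst.
  have := integrableD_leb (measurable_itv _) IH
    (integrableZ_leb (n`!%:R)^-1 (measurable_itv _) (pow_integrable n im)).
  apply: eq_integrable => // s _ /=; congr EFin.
  by rewrite /S [in RHS]big_nat_recr//= mulrDr; ring.
have Sge n : ct (fun s => m s * ct b s) x <= ct (fun s => m s * S n.+2 (ct b s)) x.
  elim: n => [|n IH].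
    rewrite [leRHS](@eq_cos_transform _ (fun s => m s + m s * ct b s)); last first.
      move=> s _; rewrite /S !big_nat_recr//= big_geq// fact0 expr0 expr1 /=.
      by rewrite add0r divr1 divr1 mulrDr mulr1.
    by rewrite cos_transformD ?lerDr//; exact: mul_integrable.
  rewrite [leRHS](@eq_cos_transform _ (fun s => m s * S n.+2 (ct b s) + (n.+2`!%:R)^-1 * (m s * ct b s ^+ n.+2))); last first.
    move=> s _; rewrite /S [in LHS]big_nat_recr//= mulrDr.
    by ring.
  have i1 := pow_integrable n.+2 im.
  rewrite cos_transformD//; last exact: integrableZ_leb.
  rewrite cos_transformZ// (le_trans IH)// lerDl mulr_ge0 ?invr_ge0//.
  exact: pow_ge0.
have lim : ct (fun s => m s * S n.+2 (ct b s)) x @[n --> \oo] --> ct (fun s => m s * expR (ct b s)) x.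
  apply: (@cos_transform_dominated_cvg R _ _ (fun s => expR B * `|m s|)).
  - by move=> n; exact: measurable_int_leb (Sint n.+2).
  - move=> s _; apply: cvgM; first exact: cvg_cst.
    by have := @S_cvg (ct b s); rewrite -(cvg_shiftS (S ^~ (ct b s))) -(cvg_shiftS (fun n => S n.+1 (ct b s))); exact.
  - by apply: integrableZ_leb => //; exact: integrable_norm_leb.
  - move=> n s _; rewrite normrM mulrC ler_wpM2r//.
    by rewrite (le_trans (S_le _ _))// ler_expR.
have le1 : ct (fun s => m s * ct b s) x <= ct (fun s => m s * expR (ct b s)) x.
  rewrite -(cvg_lim _ lim)//; apply: limr_ge; first by apply/cvg_ex; eexists; exact: lim.
  exact: nearW.
by split => //; rewrite (le_trans _ le1)// cos_transform_mul_ge0.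
Qed.

End multiplier.

Section levy.
Variables (al : R) (al_gt0 : 0 < al) (al_lt2 : al < 2).

Let ell u := u `^ (- (1 + al)).

Let ell_ge0 u : 0 <= ell u. Proof. exact: powR_ge0. Qed.

Let ell_meas D : measurable_fun D ell.
Proof. by apply: measurable_funTS; exact: measurable_powR. Qed.

Let g s u := (1 - cos (u * s)) * ell u.

Let g_ge0 s u : 0 <= g s u.
Proof. by rewrite mulr_ge0// subr_ge0 cos_le1. Qed.

Let g_meas s D : measurable_fun D (g s).
Proof.
apply: measurable_funM => //; apply: measurable_funB => //; exact: cosM_measurable.
Qed.

Let g_integrable s : mu.-integrable Rp (EFin \o g s).
Proof.
pose p := Num.min al (2 - al).
have p0 : 0 < p by rewrite lt_min al_gt0 subr_gt0.
have pal : p <= al by rewrite ge_min lexx.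
have p2 : p <= 2 - al by rewrite ge_min lexx orbT.
apply: (@wfun_integrable_dom R p ((s ^+ 2 / 2 + 2) * 4)) => // u u0.
rewrite ger0_norm//.
have w0 := wfun_ge0 p u.
have s2 := sqr_ge0 s.
have [u1|u1] := leP u 1.
  have h1 : g s u <= s ^+ 2 / 2 * u `^ (- (al - 1)).
    have -> : u `^ (- (al - 1)) = u ^+ 2 * ell u.
      rewrite -powR_mulrn ?(ltW u0)// -powRD ?(gt_eqF u0) ?implybT//.
      by congr (_ `^ _); ring.
    rewrite mulrA ler_wpM2r//.
    have /andP[_ h] := oneBcos_le (u * s).
    by rewrite (le_trans h)// exprMn; lra.
  have h2 : u `^ (- (al - 1)) <= 4 * wfun p u.
    by apply: powR_le_wfun => //; [rewrite u0|lra].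
  apply: (le_trans h1); apply: (le_trans (ler_wpM2l _ h2)); first by rewrite divr_ge0.
  by rewrite mulrA ler_wpM2r//; lra.
have h1 : g s u <= 2 * ell u.
  by rewrite ler_wpM2r//; have := cos_geN1 (u * s); lra.
have h2 : ell u <= 4 * wfun p u by apply: powR_le_wfun_infty => //; [exact: ltW|lra].
apply: (le_trans h1); rewrite (le_trans (ler_wpM2l _ h2))//.
by rewrite mulrA ler_wpM2r//; lra.
Qed.

Let J s := \int[mu]_(u in Rp) g s u.

Let J_scale s : 0 < s -> J s = s `^ al * J 1.
Proof.
move=> s0; have s1 : 0 < s^-1 by rewrite invr_gt0.
rewrite /J (Rintegral_scale s1 (g_integrable s)).
rewrite (_ : \int[mu]_(x in Rp) g s (s^-1 * x) = \int[mu]_(x in Rp) (s `^ (1 + al) * g 1 x)).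
  rewrite RintegralZl// mulrA; congr (_ * _).
  rewrite -(powR_inv1 (ltW s0)) -powRD ?(gt_eqF s0) ?implybT//; congr (_ `^ _); ring.
apply: eq_Rintegral => u /set_mem/RpP u0.
rewrite /g /ell mulr1 (mulrAC _ u) mulVf ?gt_eqF// mul1r.
rewrite powRM ?(ltW s1) ?(ltW u0)//.
rewrite -[s^-1]powR_inv1 ?(ltW s0)// -powRrM (_ : -1 * - (1 + al) = 1 + al); last by ring.
by ring.
Qed.

Let J1_gt0 : 0 < J 1.
Proof.
apply: (@Rintegral_gt0 R Rp (g 1) 1) => //.
- by apply: open_nbhs_nbhs; split; [exact: interval_open|apply/RpP].
- apply: (@continuousM _ _ (fun u => 1 - cos (u * 1)) ell); last exact: powR_continuous_pt.
  by apply: continuousB; [exact: cvg_cst|exact: is_derive_continuous (is_derive_cosM 1 1)].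
- rewrite /g /ell powR1 mulr1 mulr1 subr_gt0.
  have := @ltr_cos R 0 1; rewrite !in_itv/= lexx pi_ge0 ler01.
  have -> : (1 : R) <= pi by rewrite (le_trans _ (pi_ge2 _))// ler1n.
  by move=> /(_ isT isT); rewrite cos0 ltr01.
Qed.

Let k := (J 1)^-1.
Let k_gt0 : 0 < k. Proof. by rewrite invr_gt0. Qed.

Let kJ s : 0 < s -> k * J s = s `^ al.
Proof. by move=> s0; rewrite J_scale// mulrCA mulVf ?mulr1// gt_eqF. Qed.

Let nu (A : set R) u := k * ell u * \1_A u.

Let nu_ge0 A u : 0 <= nu A u.
Proof. by rewrite !mulr_ge0// ?(ltW k_gt0)// indicE. Qed.

Let nu_meas A D : measurable A -> measurable_fun D (nu A).
Proof.
move=> mA; apply: measurable_funM; last exact: measurable_indic.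
by apply: measurable_funM.
Qed.

Let nu_compact (A : set R) p q : measurable A -> 0 < p -> A `<=` `[p, q] ->
  mu.-integrable Rp (EFin \o nu A) /\ mu.-integrable Rp (EFin \o (fun u => u * nu A u)).
Proof.
move=> mA p0 Apq.
have le u : `|nu A u| <= k * p `^ (- (1 + al)) * \1_A u.
  rewrite ger0_norm// /nu indicE; case: (boolP (u \in A)) => [/set_mem/Apq|_]; last by rewrite !mulr0.
  rewrite /= in_itv/= => /andP[pu _]; rewrite !mulr1 ler_pM2l// /ell !powRN.
  rewrite lef_pV2 ?posrE ?powR_gt0//; last exact: lt_le_trans pu.
  by rewrite ge0_ler_powR ?nnegrE ?addr_ge0 ?(ltW al_gt0) ?(ltW p0)// (le_trans (ltW p0)).
have fin : (mu `[p, q] < +oo)%E by rewrite lebesgue_measure_itv/=; case: ifP => _; rewrite ?ltry.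
have iA c : mu.-integrable Rp (EFin \o (fun u => c * \1_A u)).
  apply: integrableZ_leb => //.
  apply: (@integrable_dom_leb _ _ _ (\1_(`[p, q]))) => //.
  - apply: (@integrableS_leb _ setT) => //.
    apply/integrableP; split; first by apply/measurable_EFinP; exact: measurable_indic.
    under eq_integral do rewrite /= ger0_norm//.
    by rewrite integral_indic// setIT.
  - move=> u _; rewrite ger0_norm// !indicE ler_nat.
    by case: (boolP (u \in A)) => // /set_mem/Apq h; rewrite mem_set.
split; first by apply: (@integrable_dom_leb _ _ _ (fun u => k * p `^ (- (1 + al)) * \1_A u)) => //; exact: nu_meas.
apply: (@integrable_dom_leb _ _ _ (fun u => q * (k * p `^ (- (1 + al))) * \1_A u)) => //.
  by apply: measurable_funM => //; exact: nu_meas.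
move=> u _; rewrite normrM.
case: (boolP (u \in A)) => [uA|uA]; last by rewrite /nu indicE (negbTE uA) !mulr0 normr0 mulr0.
have := set_mem uA => /Apq; rewrite /= in_itv/= => /andP[pu uq].
rewrite -mulrA ler_pM// ger0_norm//; exact: le_trans (ltW p0) pu.
Qed.

Let nu_exponent (A : set R) p q s : measurable A -> 0 < p -> A `<=` `[p, q] ->
  ct (nu A) s - ct (nu A) 0 = - \int[mu]_(u in Rp) (k * g s u * \1_A u).
Proof.
move=> mA p0 Apq; have [i1 _] := nu_compact mA p0 Apq.
rewrite /ct -RintegralB//; [|exact: cos_transform_integrable..].
rewrite -[RHS]mulN1r -RintegralZl//; last first.
  apply: (@integrable_dom_leb _ _ _ (fun u => k * g s u)) => //.
  - by apply: measurable_funM; [exact: measurable_funM|exact: measurable_indic].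
  - exact: integrableZ_leb.
  - by move=> u _; rewrite ger0_norm ?mulr_ge0 ?(ltW k_gt0)// ler_piMr ?mulr_ge0 ?(ltW k_gt0)// indicE lern1 leq_b1.
apply: eq_Rintegral => u _; rewrite mulr0 cos0 /nu /g; ring.
Qed.

(* Removing the jumps of size about [x] from the Levy measure leaves a factor [m] whose transform
   is nonnegative; the first-order term of the exponential of the removed part is positive at [x]. *)
Lemma f_alpha_gt0_pos x : 0 < x -> 0 < f_alpha al x.
Proof.
move=> x0; rewrite f_alphaE// divr_gt0 ?pi_gt0//.
pose A : set R := `[x / 2, x * 2]%classic.
have mA : measurable A by exact: measurable_itv.
have A0 : 0 < x / 2 by rewrite divr_gt0.
have [iA iuA] := nu_compact mA A0 (@subset_refl _ A).
pose lam := ct (nu A) 0.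
have lamE : lam = \int[mu]_(u in Rp) `|nu A u|.
  by apply: eq_Rintegral => u _; rewrite mulr0 cos0 mulr1 ger0_norm.
pose m s := phi al s * expR (lam - ct (nu A) s).
have m_gt0 s : 0 < m s by apply: mulr_gt0; [exact: phi_gt0|exact: expR_gt0].
have m_le s : `|m s| <= expR (lam + lam) * phi al s.
  rewrite gtr0_norm// /m mulrC ler_pM2r ?phi_gt0// ler_expR lerD2l.
  have := cos_transform_le s iA; rewrite -lamE => h.
  by rewrite (le_trans _ h)// -normrN ler_norm.
have ctA_meas D : measurable_fun D (ct (nu A)).
  apply: measurable_funTS; apply: continuous_measurable_fun => s.
  exact: cos_transform_continuous.
have m_meas D : measurable_fun D m.
  apply: measurable_funM; first exact: phi_measurable.
  by apply: measurableT_comp => //; apply: measurable_funB.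
have im : mu.-integrable Rp (EFin \o m).
  apply: (@integrable_dom_leb _ _ _ (fun s => expR (lam + lam) * phi al s)) => //.
  by apply: integrableZ_leb => //; exact: phi_integrable.
have ism : mu.-integrable Rp (EFin \o (fun s => s * m s)).
  have [K K0 H] := phi_dom 1 al_gt0.
  apply: (@wfun_integrable_dom R 1 (expR (lam + lam) * K)) => //; first exact: measurable_funM.
  move=> s s0; rewrite normrM (gtr0_norm s0) (le_trans (ler_wpM2l (ltW s0) (m_le s)))//.
  rewrite mulrCA -mulrA ler_pM2l ?expR_gt0// (le_trans _ (H al s (lexx _) s0))// expr1.
  by rewrite ler_pM2r ?phi_gt0//; lra.
pose An n : set R := `[n.+1%:R^-1, n.+1%:R]%classic `\` A.
have mAn n : measurable (An n) by apply: measurableD.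
have An0 n : 0 < (n.+1%:R : R)^-1 by rewrite invr_gt0.
have Ansub n : An n `<=` `[n.+1%:R^-1, n.+1%:R] by move=> u [].
have ctm_ge0_d d y : 0 < d -> 0 <= ct (fun s => ed d s * m s) y.
  move=> d0.
  pose mn n s := ed d s * expR (ct (nu (An n)) s - ct (nu (An n)) 0).
  have mn_meas n : measurable_fun Rp (mn n).
    apply: measurable_funM; first exact: measurable_int_leb (exp_decay_integrable d0).
    apply: measurableT_comp => //; apply: measurable_funB => //.
    have [i1 i2] := nu_compact (mAn n) (An0 n) (@Ansub n).
    apply: measurable_funTS; apply: continuous_measurable_fun => s.
    exact: cos_transform_continuous.
  have mn_ge0 n : 0 <= ct (mn n) y.
    have [i1 i2] := nu_compact (mAn n) (An0 n) (@Ansub n).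
    have [_] := @cos_transform_exp_ge (nu (An n)) (nu_ge0 _) i1 i2 (ed d) y (exp_decay_integrable d0)
       (fun z => ltac:(rewrite cos_transform_exp_decay// divr_ge0 ?addr_ge0 ?sqr_ge0 ?(ltW d0)//)).
    move=> h.
    rewrite (@eq_cos_transform _ (fun s => expR (- ct (nu (An n)) 0) * (ed d s * expR (ct (nu (An n)) s)))); last first.
      by move=> s _; rewrite /mn expRD; ring.
    rewrite cos_transformZ ?mulr_ge0 ?expR_ge0//.
    apply: (@integrable_dom_leb _ _ _ (fun s => expR (\int[mu]_(u in Rp) `|nu (An n) u|) * ed d s)) => //.
    - apply: measurable_funM; first exact: measurable_int_leb (exp_decay_integrable d0).
      apply: measurableT_comp => //.
      apply: measurable_funTS; apply: continuous_measurable_fun => s.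
      exact: cos_transform_continuous.
    - by apply: integrableZ_leb => //; exact: exp_decay_integrable.
    - move=> s _; rewrite ger0_norm ?mulr_ge0 ?expR_ge0// mulrC ler_pM2r ?expR_gt0// ler_expR.
      by rewrite (le_trans (ler_norm _))// cos_transform_le.
  have lim : ct (mn n) y @[n --> \oo] --> ct (fun s => ed d s * m s) y.
    apply: (@cos_transform_dominated_cvg R _ _ (ed d)) => //.
    - move=> s s0; apply: cvgM; first exact: cvg_cst.
      rewrite /m /stable_cf -expRD.
      apply: cvgn_continuous; last exact: continuous_expR.
      have e1 : - (s `^ al) + (lam - ct (nu A) s) = - \int[mu]_(u in Rp) (k * g s u * \1_(~` A) u).
        have -> : lam - ct (nu A) s = \int[mu]_(u in Rp) (k * g s u * \1_A u).
          by rewrite -[LHS]opprB (nu_exponent s mA A0 (@subset_refl _ A)) opprK.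
        rewrite -kJ// /J -RintegralZl//.
        have iC (E : set R) : measurable E -> mu.-integrable Rp (EFin \o (fun u => k * g s u * \1_E u)).
          move=> mE; apply: (@integrable_dom_leb _ _ _ (fun u => k * g s u)) => //.
          - by apply: measurable_funM; [exact: measurable_funM|exact: measurable_indic].
          - exact: integrableZ_leb.
          - by move=> u _; rewrite ger0_norm ?mulr_ge0 ?(ltW k_gt0)// ler_piMr ?mulr_ge0 ?(ltW k_gt0)// indicE lern1 leq_b1.
        have -> : \int[mu]_(u in Rp) (k * g s u) =
           \int[mu]_(u in Rp) (k * g s u * \1_A u) + \int[mu]_(u in Rp) (k * g s u * \1_(~` A) u).
          rewrite -RintegralD//; [|exact: iC|by apply: iC; exact: measurableC].
          apply: eq_Rintegral => u _; rewrite -mulrDr !indicE in_setC.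
          by case: (u \in A); rewrite ?addr0 ?add0r mulr1.
        by ring.
      rewrite e1.
      under eq_cvg => n do rewrite (nu_exponent s (mAn n) (An0 n) (@Ansub n)).
      apply: cvgN.
      apply: (@dominated_cvg_leb _ _ _ _ (fun u => k * g s u)) => //.
      + by move=> n; apply: measurable_funM; [exact: measurable_funM|exact: measurable_indic].
      + move=> u /RpP u0; apply: cvgM; first exact: cvg_cst.
        pose N := maxn (Num.truncn u) (Num.truncn u^-1).
        apply: (@cvg_near_cst _ _ _ _ _ (@eventually_filter)); exists N => // n /= Nn.
        rewrite !indicE /An in_setD in_setC mem_set ?andTb//= in_itv/=; apply/andP; split.
          rewrite -[leRHS]invrK lef_pV2 ?posrE ?invr_gt0//.
          rewrite ltW// (lt_le_trans (truncnS_gt _))// ler_nat ltnS.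
          by rewrite (leq_trans _ Nn)// leq_maxr.
        rewrite ltW// (lt_le_trans (truncnS_gt _))// ler_nat ltnS.
        by rewrite (leq_trans _ Nn)// leq_maxl.
      + exact: integrableZ_leb.
      + by move=> n u _; rewrite ger0_norm ?mulr_ge0 ?(ltW k_gt0)// ler_piMr ?mulr_ge0 ?(ltW k_gt0)// indicE lern1 leq_b1.
    - exact: exp_decay_integrable.
    - move=> n s s0; rewrite ger0_norm ?mulr_ge0 ?expR_ge0// ler_piMr ?expR_ge0//.
      rewrite expR_le1 (nu_exponent s (mAn n) (An0 n) (@Ansub n)) oppr_le0.
      by apply: Rintegral_ge0 => u _; rewrite !mulr_ge0 ?(ltW k_gt0).
  rewrite -(cvg_lim _ lim)//; apply: limr_ge; first by apply/cvg_ex; eexists; exact: lim.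
  exact: nearW.
have ctm_ge0 y : 0 <= ct m y.
  have lim : ct (fun s => ed n.+1%:R^-1 s * m s) y @[n --> \oo] --> ct m y.
    apply: (@cos_transform_dominated_cvg R _ _ m) => //.
    - move=> n; apply: measurable_funM => //.
      exact: measurable_int_leb (exp_decay_integrable (An0 n)).
    - move=> s s0; rewrite -[X in _ --> X]mul1r; apply: cvgM; last exact: cvg_cst.
      have c0 : expR (- (n.+1%:R^-1 * s)) @[n --> \oo] --> expR (- (0 * s)).
        apply: cvgn_continuous; last exact: continuous_expR.
        apply: cvgN; apply: cvgM; last exact: cvg_cst.
        exact: cvg_harmonic.
      by rewrite mul0r oppr0 expR0 in c0.
    - move=> n s s0; rewrite ger0_norm ?mulr_ge0 ?expR_ge0 ?(ltW (m_gt0 _))//.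
      by rewrite ler_piMl ?(ltW (m_gt0 _))// expR_le1 oppr_le0 mulr_ge0 ?(ltW s0).
  rewrite -(cvg_lim _ lim)//; apply: limr_ge; first by apply/cvg_ex; eexists; exact: lim.
  by apply: nearW => n; exact: ctm_ge0_d.
have [ge _] := cos_transform_exp_ge (nu_ge0 A) iA iuA x im ctm_ge0.
have E : ct (phi al) x = expR (- lam) * ct (fun s => m s * expR (ct (nu A) s)) x.
  rewrite -cos_transformZ; last first.
    have := integrableZ_leb (expR lam) (measurable_itv _) (phi_integrable al_gt0).
    by apply: eq_integrable => // s _ /=; congr EFin; rewrite /m expRB; field; rewrite expR_eq0.
  apply: eq_cos_transform => s _; rewrite /m expRB expRN; field.
  by rewrite !expR_eq0.
rewrite E mulr_gt0 ?expR_gt0// (lt_le_trans _ ge)// cos_transform_mul//.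
have cm y : {for y, continuous (ct m)} by exact: cos_transform_continuous.
apply: (@Rintegral_gt0 R Rp _ x) => //.
- by apply: open_nbhs_nbhs; split; [exact: interval_open|apply/RpP].
- apply: (@integrable_dom_leb _ _ _ (fun u => (\int[mu]_(s in Rp) `|m s|) * nu A u)) => //.
  + apply: measurable_funM; first exact: nu_meas.
    apply: measurable_funM => //; apply: measurable_funD.
      apply: measurable_funTS; apply: continuous_measurable_fun => u.
      apply: (@continuous_comp _ _ _ (fun u => x + u) (ct m)); last exact: cm.
      by apply: cvgD; [exact: cvg_cst|exact: cvg_id].
    apply: measurable_funTS; apply: continuous_measurable_fun => u.
    apply: (@continuous_comp _ _ _ (fun u => x - u) (ct m)); last exact: cm.
    by apply: cvgB; [exact: cvg_cst|exact: cvg_id].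
  + exact: integrableZ_leb.
  + move=> u _; rewrite normrM (ger0_norm (nu_ge0 _ _)) mulrC ler_wpM2r//.
    have h1 := cos_transform_le (x + u) im; have h2 := cos_transform_le (x - u) im.
    rewrite normrM [X in _ * X]ger0_norm// ler_pdivrMr//.
    by rewrite (le_trans (ler_normD _ _))//; lra.
- by move=> u _; rewrite mulr_ge0// divr_ge0// addr_ge0.
- apply: continuousM.
    have -> : nu A = (fun u => k * ell u * \1_A u) by [].
    apply: continuousM.
      by apply: continuousM; [exact: cvg_cst|exact: powR_continuous_pt].
    apply: (@cvg_near_cst _ _ _ _ _ (nbhs_filter x)).
    near=> u; rewrite !indicE !mem_set// /A/= in_itv/=; apply/andP; split.
    + by lra.
    + by lra.
    + by rewrite ltW//; near: u; apply: open_nbhs_nbhs; split; [exact: open_gt|rewrite /=; lra].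
    + by rewrite ltW//; near: u; apply: open_nbhs_nbhs; split; [exact: open_lt|rewrite /=; lra].
  apply: continuousM; last exact: cvg_cst.
  apply: continuousD.
    apply: (@continuous_comp _ _ _ (fun u => x + u) (ct m)); last exact: cm.
    by apply: cvgD; [exact: cvg_cst|exact: cvg_id].
  apply: (@continuous_comp _ _ _ (fun u => x - u) (ct m)); last exact: cm.
  by apply: cvgB; [exact: cvg_cst|exact: cvg_id].
- rewrite mulr_gt0//.
    rewrite /nu indicE mem_set ?mulr1; last by rewrite /A/= in_itv/=; apply/andP; split; lra.
    by rewrite mulr_gt0// powR_gt0.
  rewrite divr_gt0// subrr ltr_wpDl//.
  rewrite /ct; under eq_Rintegral do rewrite mulr0 cos0 mulr1.
  apply: (@Rintegral_gt0 R Rp m 1) => //.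
  + by apply: open_nbhs_nbhs; split; [exact: interval_open|apply/RpP].
  + by move=> s _; exact: ltW.
  + apply: continuousM.
      apply: (@continuous_comp _ _ _ (fun s => - (s `^ al)) expR); last exact: continuous_expR.
      by apply: continuousN; exact: powR_continuous_pt.
    apply: (@continuous_comp _ _ _ (fun s => lam - ct (nu A) s) expR); last exact: continuous_expR.
    by apply: continuousB; [exact: cvg_cst|exact: cos_transform_continuous].
Unshelve. all: by end_near. Qed.

End levy.

Lemma f_alpha_gt0 al x : 0 < al < 2 -> 0 < f_alpha al x.
Proof.
move=> /andP[al0 al2]; have [x0|x0|->] := ltgtP x 0; last 2 first.
- exact: f_alpha_gt0_pos.
- rewrite f_alphaE// divr_gt0 ?pi_gt0// /ct; under eq_Rintegral do rewrite mulr0 cos0 mulr1.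
  apply: (@Rintegral_gt0 R Rp (phi al) 1) => //.
  + by apply: open_nbhs_nbhs; split; [exact: interval_open|apply/RpP].
  + exact: phi_integrable.
  + by move=> s _; exact: ltW (phi_gt0 _ _).
  + apply: (@continuous_comp _ _ _ (fun s => - (s `^ al)) expR); last exact: continuous_expR.
    by apply: continuousN; exact: powR_continuous_pt.
  + exact: phi_gt0.
by rewrite -f_alphaN; apply: f_alpha_gt0_pos => //; rewrite oppr_gt0.
Qed.

Lemma f_alpha_parseval al (b : R -> R) : 0 < al -> mu.-integrable Rp (EFin \o b) ->
  \int[mu]_(u in Rp) (b u * f_alpha al u) = (\int[mu]_(s in Rp) (phi al s * ct b s)) / pi.
Proof.
move=> al0 ib.
rewrite (cos_transform_parseval (phi_integrable al0) ib) -RintegralZr//; last first.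
  have [K K0 H] := f_alpha_bounded al0.
  apply: (@integrable_dom_leb _ _ _ (fun u => (\int[mu]_(s in Rp) `|phi al s|) * `|b u|)) => //.
  - apply: measurable_funM; first exact: measurable_int_leb.
    have -> : ct (phi al) = (fun x => pi * f_alpha al x).
      by apply/funext => x; rewrite f_alphaE// mulrCA divff ?mulr1// gt_eqF// pi_gt0.
    by apply: measurable_funM => //; exact: f_alpha_measurable.
  - by apply: integrableZ_leb => //; exact: integrable_norm_leb.
  - move=> u _; rewrite normrM mulrC ler_wpM2r//.
    by apply: cos_transform_le; exact: phi_integrable.
by apply: eq_Rintegral => u _; rewrite f_alphaE// mulrA.
Qed.

Lemma f_alpha_mass_le1 al : 0 < al < 2 -> (\int[mu]_x (f_alpha al x)%:E <= 1)%E.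
Proof.
move=> /[dup] alI /andP[al0 al2].
have fc := fun x => @f_alpha_continuous R al x al0.
have f0 x : 0 <= f_alpha al x by exact: ltW (f_alpha_gt0 x alI).
rewrite ge0_symfun_integralT//; last by move=> x /=; rewrite f_alphaN.
have -> : [set x | 0 <= x] = `[0%R, +oo[%classic.
  by move=> ?; apply/seteqP; split => x /=; rewrite in_itv/= andbT.
rewrite -integral_itv_obnd_cbnd; last by apply/measurable_EFinP; exact: f_alpha_measurable.
suff h : (\int[mu]_(x in Rp) (f_alpha al x)%:E <= (2^-1)%:E)%E.
  rewrite (le_trans (lee_wpmul2l _ h))// -EFinM lee_fin; lra.
have ip := phi_integrable al0.
have bound d : 0 < d -> (\int[mu]_(x in Rp) (ed d x * f_alpha al x)%:E <= (2^-1)%:E)%E.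
  move=> d0; have ie := exp_decay_integrable d0.
  have iec : mu.-integrable Rp (EFin \o (fun x => ed d x * f_alpha al x)).
    have [K K0 H] := f_alpha_bounded al0.
    apply: (@integrable_dom_leb _ _ _ (fun x => K * ed d x)) => //.
    - apply: measurable_funM; first exact: measurable_int_leb ie.
      exact: f_alpha_measurable.
    - exact: integrableZ_leb.
    - by move=> x _; rewrite normrM (gtr0_norm (expR_gt0 _)) mulrC ler_pM2r ?expR_gt0// H.
  have P := f_alpha_parseval al0 ie.
  rewrite -[leLHS]fineK; last exact: integrable_fin_num.
  rewrite lee_fin -[leLHS]/(\int[mu]_(x in Rp) (ed d x * f_alpha al x)) P.
  rewrite (ler_pdivrMr _ _ (pi_gt0 R)) (mulrC 2^-1).
  have dG s : 0 < s -> is_derive s 1 (fun s => atan (s / d)) (d / (d ^+ 2 + s ^+ 2)).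
    move=> s0.
    have D := @is_derive_compR R atan (fun s => s / d) s _ _ (is_derive1_atan (s / d))
      (is_deriveMR (is_derive_idR s) (is_derive_cstR d^-1 s)).
    apply: (is_derive_val_eq D); rewrite mulr0 add0r mulr1; field.
    by rewrite !gt_eqF// ltr_pwDl ?exprn_gt0 ?sqr_ge0.
  have q0 s : 0 <= d / (d ^+ 2 + s ^+ 2) by rewrite divr_ge0 ?(ltW d0)// addr_ge0 ?sqr_ge0.
  have cq s : 0 < s -> {for s, continuous (fun s => d / (d ^+ 2 + s ^+ 2))}.
    move=> s0; apply: continuousM; first exact: cvg_cst.
    apply: continuousV; first by rewrite gt_eqF// ltr_pwDl ?exprn_gt0 ?sqr_ge0.
    apply: continuousD; first exact: cvg_cst.
    exact: exprn_continuous.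
  have Gb s : 0 < s -> 0 <= atan (s / d) <= pi / 2.
    move=> s0; rewrite (ltW (atan_ltpi2 _)) andbT -atan0 le_atan// divr_ge0 ?ltW//.
  have I1 := @integrable_FTC2_ge0_halfline R 0 0 (pi / 2) _ _ (fun s _ => q0 s) cq dG Gb.
  have B1 := @FTC2_ge0_halfline R 0 0 (pi / 2) _ _ (fun s _ => q0 s) cq dG Gb.
  apply: (@le_trans _ _ (\int[mu]_(s in Rp) (d / (d ^+ 2 + s ^+ 2)))); last first.
    rewrite -lee_fin /Rintegral fineK; last exact: integrable_fin_num.
    by rewrite (le_trans B1)// lee_fin subr0.
  have i3 : mu.-integrable Rp (EFin \o (fun s => phi al s * ct (ed d) s)).
    apply: (@integrable_dom_leb _ _ _ (fun s => d / (d ^+ 2 + s ^+ 2))) => //.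
    + apply: measurable_funM; first exact: phi_measurable.
      have -> : ct (ed d) = (fun s => d / (d ^+ 2 + s ^+ 2)).
        by apply/funext => s; rewrite cos_transform_exp_decay.
      exact: measurable_int_leb I1.
    + move=> s _; rewrite cos_transform_exp_decay// ger0_norm; last exact: (mulr_ge0 (ltW (phi_gt0 _ _)) (q0 s)).
      by rewrite ler_piMl ?phi_le1.
  apply: le_Rintegral_leb => // s _; rewrite cos_transform_exp_decay//.
  by rewrite ler_piMl ?phi_le1.
pose gn n x := (ed n.+1%:R^-1 x * f_alpha al x)%:E.
have lim : (\int[mu]_(x in Rp) gn n x @[n --> \oo] --> \int[mu]_(x in Rp) (f_alpha al x)%:E)%E.
  have -> : (\int[mu]_(x in Rp) (f_alpha al x)%:E = \int[mu]_(x in Rp) limn (gn ^~ x))%E.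
    apply: eq_integral => x _; apply/esym/cvg_lim => //.
    apply: cvg_EFin; first exact: nearW.
    rewrite -[X in _ --> X]mul1r; apply: cvgM; last exact: cvg_cst.
    have c0 : expR (- (n.+1%:R^-1 * x)) @[n --> \oo] --> expR (- (0 * x)).
      apply: cvgn_continuous; last exact: continuous_expR.
      apply: cvgN; apply: cvgM; last exact: cvg_cst.
      exact: cvg_harmonic.
    by rewrite mul0r oppr0 expR0 in c0.
  apply: (@cvg_monotone_convergence _ (measurableTypeR R) R mu Rp (measurable_itv _) gn).
  - move=> n; apply/measurable_EFinP; apply: measurable_funM; last exact: f_alpha_measurable.
    by apply: measurable_int_leb; apply: exp_decay_integrable; rewrite invr_gt0.
  - by move=> n x _; rewrite lee_fin mulr_ge0 ?expR_ge0.
  - move=> x /RpP x0 n1 n2 n12; rewrite lee_fin ler_wpM2r// ler_expR lerN2 ler_pM2r//.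
    by rewrite lef_pV2 ?posrE// ler_nat.
rewrite -(cvg_lim _ lim)//; apply: lime_le; first by apply/cvg_ex; eexists; exact: lim.
by apply: nearW => n; apply: bound; rewrite invr_gt0.
Qed.

(* The difference of the two characteristic functions changes sign at most once, while it is
   orthogonal both to the constant [1] and to the strictly monotone function [1/(1+s^2)]. *)
Lemma f_alpha_scale_inj al be c : 0 < al -> 0 < be -> 0 < c ->
  (forall x, f_alpha al x = c * f_alpha be (c * x)) -> al = be /\ c = 1.
Proof.
move=> al0 be0 c0 E.
have c1 : 0 < c^-1 by rewrite invr_gt0.
have i1 := phi_integrable al0; have i2' := phi_integrable be0.
have i2 := integrable_scale c1 i2'.
pose m s := phi al s - phi be (c^-1 * s).
have im : mu.-integrable Rp (EFin \o m) by exact: integrableB_leb i1 i2.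
have ct0 x : ct m x = 0.
  have -> : ct m x = ct (phi al) x - ct (fun s => phi be (c^-1 * s)) x.
    rewrite /ct -RintegralB//; [|exact: cos_transform_integrable..].
    by apply: eq_Rintegral => s _; rewrite mulrBl.
  rewrite cos_transform_scale// invrK; have := E x; rewrite !f_alphaE//.
  move=> /(congr1 ( *%R^~ pi)); rewrite mulrA !divfK ?gt_eqF ?pi_gt0// => ->.
  by rewrite (mulrC x) subrr.
have cm s : 0 < s -> {for s, continuous m}.
  move=> s0; apply: continuousB.
    apply: (@continuous_comp _ _ _ (fun s => - (s `^ al)) expR); last exact: continuous_expR.
    by apply: continuousN; exact: powR_continuous_pt.
  apply: (@continuous_comp _ _ _ (fun s => - ((c^-1 * s) `^ be)) expR); last exact: continuous_expR.
  apply: continuousN; apply: (@continuous_comp _ _ _ (fun s => c^-1 * s) (fun s => s `^ be)).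
    by apply: cvgM; [exact: cvg_cst|exact: cvg_id].
  by apply: powR_continuous_pt; rewrite mulr_gt0.
have int0 : \int[mu]_(s in Rp) m s = 0.
  by have := ct0 0; rewrite /ct; under eq_Rintegral do rewrite mulr0 cos0 mulr1.
pose h s : R := (1 + s ^+ 2)^-1.
have h01 s : 0 < h s <= 1.
  rewrite /h invr_gt0 invf_le1; last by rewrite ltr_pwDl ?sqr_ge0.
  by rewrite ltr_pwDl ?sqr_ge0//= lerDl sqr_ge0.
have hct s : h s = ct (ed 1) s by rewrite cos_transform_exp_decay// expr1n mul1r.
have inth : \int[mu]_(s in Rp) (m s * h s) = 0.
  under eq_Rintegral do rewrite hct.
  rewrite (cos_transform_parseval im (exp_decay_integrable ltr01)).
  by under eq_Rintegral do rewrite ct0 mulr0; rewrite Rintegral_cst// mul0r.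
have ch s : {for s, continuous h}.
  apply: continuousV; first by rewrite gt_eqF// ltr_pwDl ?sqr_ge0.
  by apply: continuousD; [exact: cvg_cst|exact: exprn_continuous].
have imh : mu.-integrable Rp (EFin \o (fun s => m s * h s)).
  apply: (@integrable_dom_leb _ _ _ (fun s => `|m s|)) => //.
  - by apply: continuous_itvoy_measurable => s s0; apply: continuousM; [exact: cm|exact: ch].
  - exact: integrable_norm_leb.
  - by move=> s _; have /andP[? ?] := h01 s; rewrite normrM ler_piMr// gtr0_norm.
have key (q : R -> R) : (forall s, 0 < s -> {for s, continuous q}) ->
    mu.-integrable Rp (EFin \o (fun s => m s * q s)) ->
    \int[mu]_(s in Rp) (m s * q s) = 0 ->
    (forall s, 0 < s -> 0 <= m s * q s) -> forall s, 0 < s -> m s * q s = 0.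
  move=> cq iq z ge s s0; apply: contra_eq z => nz; rewrite gt_eqF//.
  apply: (@Rintegral_gt0 R Rp _ s) => //.
  - by apply: open_nbhs_nbhs; split; [exact: interval_open|apply/RpP].
  - by move=> t /RpP; exact: ge.
  - by apply: continuousM; [exact: cm|exact: cq].
  - by rewrite lt_neqAle eq_sym nz ge.
have mlt s : 0 < s -> ((c^-1 * s) `^ be < s `^ al) = (m s < 0).
  by move=> s0; rewrite /m subr_lt0 ltr_expR ltrN2.
have mgt s : 0 < s -> (s `^ al < (c^-1 * s) `^ be) = (0 < m s).
  by move=> s0; rewrite /m subr_gt0 ltr_expR ltrN2.
have cmpE s : 0 < s -> (c^-1 * s) `^ be = (c^-1) `^ be * s `^ (be - al) * s `^ al.
  move=> s0; rewrite powRM ?(ltW s0) ?(ltW c1)// -mulrA -powRD ?(gt_eqF s0) ?implybT//.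
  by rewrite subrK.
have [albe|albe] := eqVneq al be.
  subst be; split => //.
  have im1 : mu.-integrable Rp (EFin \o (fun s => m s * 1)).
    by apply: eq_integrable im => // s _ /=; rewrite mulr1.
  have imN : mu.-integrable Rp (EFin \o (fun s => m s * - 1)).
    have := integrableZ_leb (- 1) (measurable_itv _) im.
    by apply: eq_integrable => // s _ /=; rewrite mulrC.
  have cc : c^-1 `^ al = 1.
    apply/eqP; rewrite eq_le !leNgt; apply/andP; split; apply/negP => h'.
      have mp s : 0 < s -> 0 < m s.
        by move=> s0; rewrite -mgt// cmpE// subrr powRr0 mulr1 ltr_pMl ?powR_gt0.
      have : m 1 * 1 = 0.
        apply: (key (fun=> 1)) => //; first by move=> s _; exact: cvg_cst.
        - by under eq_Rintegral do rewrite mulr1.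
        - by move=> s s0; rewrite mulr1 ltW// mp.
      by move=> /eqP; rewrite mulr1 gt_eqF// mp.
    have mp s : 0 < s -> m s < 0.
      by move=> s0; rewrite -mlt// cmpE// subrr powRr0 mulr1 gtr_pMl ?powR_gt0.
    have : m 1 * - 1 = 0.
      apply: (key (fun=> - 1)) => //; first by move=> s _; exact: cvg_cst.
      - by rewrite RintegralZr// int0 mul0r.
      - by move=> s s0; rewrite mulrN1 oppr_ge0 ltW// mp.
    by move=> /eqP; rewrite mulrN1 oppr_eq0 lt_eqF// mp.
  have ci : c^-1 = 1.
    by apply: (powR_injective al0); rewrite ?nnegrE ?(ltW c1)// cc powR1.
  by rewrite -[c]invrK ci invr1.
exfalso.
pose D := be - al.
have D0 : D != 0 by rewrite subr_eq0 eq_sym.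
pose s1 := expR (be * ln c / D).
have s10 : 0 < s1 by exact: expR_gt0.
have lns1 : D * ln s1 = be * ln c by rewrite expRK mulrC divfK.
have Lm s : 0 < s -> (c^-1 * s) `^ be = expR (D * (ln s - ln s1)) * s `^ al.
  move=> s0; rewrite cmpE// mulrBr lns1; congr (_ * _).
  rewrite /powR !gt_eqF// -expRD lnV ?posrE//; congr expR; rewrite /D; ring.
have msgn s : 0 < s -> (m s < 0) = (D * (ln s - ln s1) < 0).
  by move=> s0; rewrite -mlt// Lm// gtr_pMl ?powR_gt0// expR_lt1.
have msgp s : 0 < s -> (0 < m s) = (0 < D * (ln s - ln s1)).
  by move=> s0; rewrite -mgt// Lm// ltr_pMl ?powR_gt0// expR_gt1.
have hlt s t : 0 < s -> s < t -> h t < h s.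
  move=> s0 st; have e1 (z : R) : 0 < 1 + z ^+ 2 by rewrite ltr_pwDl ?sqr_ge0.
  rewrite /h ltf_pV2 ?posrE// ltrD2l.
  by rewrite ltr_pXn2r ?nnegrE ?(ltW s0)// ltW// (lt_trans s0).
have ln_lt s t : 0 < s -> s < t -> ln s < ln t.
  by move=> s0 st; rewrite ltr_ln ?posrE// (lt_trans s0).
pose q s := D * (h s1 - h s).
have imq : mu.-integrable Rp (EFin \o (fun s => m s * q s)).
  have := integrableB_leb (measurable_itv _) (integrableZ_leb (D * h s1) (measurable_itv _) im)
    (integrableZ_leb D (measurable_itv _) imh).
  by apply: eq_integrable => // s _ /=; congr EFin; rewrite /q; ring.
have zq : \int[mu]_(s in Rp) (m s * q s) = 0.
  have -> : \int[mu]_(s in Rp) (m s * q s) =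
      \int[mu]_(s in Rp) (D * h s1 * m s - D * (m s * h s)).
    by apply: eq_Rintegral => s _; rewrite /q; ring.
  rewrite RintegralB//; [|exact: integrableZ_leb..].
  by rewrite !RintegralZl// int0 inth !mulr0 subrr.
have ge s : 0 < s -> 0 <= m s * q s.
  move=> s0; have [ss|ss|->] := ltgtP s s1; last by rewrite /q subrr mulr0 mulr0.
  - have v : ln s - ln s1 < 0 by rewrite subr_lt0 ln_lt.
    have w : h s1 - h s < 0 by rewrite subr_lt0 hlt.
    have [Dp|Dn] := ltP 0 D.
      by rewrite mulr_le0// ?ltW// ?msgn// /q pmulr_rlt0.
    have Dl : D < 0 by rewrite lt_neqAle D0.
    by rewrite mulr_ge0// ?ltW// ?msgp// /q nmulr_rgt0.
  - have v : 0 < ln s - ln s1 by rewrite subr_gt0 ln_lt.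
    have w : 0 < h s1 - h s by rewrite subr_gt0 hlt.
    have [Dp|Dn] := ltP 0 D.
      by rewrite mulr_ge0// ?ltW// ?msgp// /q pmulr_rgt0.
    have Dl : D < 0 by rewrite lt_neqAle D0.
    by rewrite mulr_le0// ?ltW// ?msgn// /q nmulr_rlt0.
have cq s : 0 < s -> {for s, continuous q}.
  move=> _; apply: continuousM; first exact: cvg_cst.
  by apply: continuousB; [exact: cvg_cst|exact: ch].
have s20 : 0 < s1 + 1 by rewrite addr_gt0.
have s12 : s1 < s1 + 1 by rewrite ltrDl.
have := key q cq imq zq ge (s1 + 1) s20.
move=> /eqP; rewrite mulf_eq0 => /orP[/eqP m0|].
  have v : 0 < ln (s1 + 1) - ln s1 by rewrite subr_gt0 ln_lt.
  have := msgn _ s20; have := msgp _ s20; rewrite m0 ltxx pmulr_lgt0// pmulr_llt0//.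
  by move=> /esym/negbT; rewrite -leNgt => Dle; rewrite lt_neqAle D0 Dle.
by rewrite mulf_eq0 (negbTE D0)/= gt_eqF// subr_gt0 hlt.
Qed.

End stable_positive.

Section stable_density.
Variable R : realType.
Local Notation mu := (@lebesgue_measure R).
Implicit Types a b al be x y c e : R.

(* Locked, since the unfolding of [f_alpha] as a quotient interferes with unification. *)
Definition sden : R -> R -> R := locked (@f_alpha R).

Lemma sdenE : sden = @f_alpha R. Proof. by rewrite /sden -lock. Qed.

Lemma sden_bounded a : 0 < a ->
  exists2 K : R, 0 < K & forall al x, a <= al -> `|sden al x| <= K.
Proof. by rewrite sdenE; exact: f_alpha_bounded. Qed.

Lemma sden_tail a : 0 < a <= 2^-1 ->
  exists2 K : R, 0 < K & forall al x, a <= al <= 2 -> 0 < x ->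
    `|sden al x| <= K * x `^ (- 1 - a).
Proof. by rewrite sdenE; exact: f_alpha_tail. Qed.

Lemma sden_gt0 al x : 0 < al < 2 -> 0 < sden al x.
Proof. by rewrite sdenE; exact: f_alpha_gt0. Qed.

Lemma sdenN al x : sden al (- x) = sden al x.
Proof. by rewrite sdenE; exact: f_alphaN. Qed.

Lemma sden_lipschitz a : 0 < a ->
  exists2 L : R, 0 < L & forall al x y, a <= al ->
    `|sden al x - sden al y| <= L * `|x - y|.
Proof. by rewrite sdenE; exact: f_alpha_lipschitz. Qed.

Lemma sden_index_continuous al e : 0 < al -> 0 < e ->
  exists2 d : R, 0 < d & forall be x, `|be - al| < d -> `|sden be x - sden al x| <= e.
Proof. by rewrite sdenE; exact: f_alpha_index_continuous. Qed.

Lemma sden_continuous al x : 0 < al -> {for x, continuous (sden al)}.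
Proof. by rewrite sdenE; exact: f_alpha_continuous. Qed.

Lemma sden_measurable al (D : set R) : 0 < al -> measurable_fun D (sden al).
Proof. by rewrite sdenE; exact: f_alpha_measurable. Qed.

Lemma sden_mass_le1 al : 0 < al < 2 -> (\int[mu]_x (sden al x)%:E <= 1)%E.
Proof. by rewrite sdenE; exact: f_alpha_mass_le1. Qed.

Lemma sden_scale_inj al be c : 0 < al -> 0 < be -> 0 < c ->
  (forall x, sden al x = c * sden be (c * x)) -> al = be /\ c = 1.
Proof. by rewrite sdenE; exact: f_alpha_scale_inj. Qed.

Lemma sden_integrable be : 0 < be < 2 -> mu.-integrable [set: R] (EFin \o sden be).
Proof.
move=> beI; apply/integrableP; split.
  by apply/measurable_EFinP; apply: sden_measurable; case/andP: beI.
apply: (@le_lt_trans _ _ 1%:E); last by rewrite ltry.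
rewrite (le_trans _ (sden_mass_le1 beI))//.
rewrite le_eqVlt; apply/orP; left; apply/eqP; apply: eq_integral => x _ /=.
by rewrite gtr0_norm// sden_gt0.
Qed.

Lemma sden_Rmass_le1 be : 0 < be < 2 -> \int[mu]_x sden be x <= 1.
Proof.
move=> beI; rewrite -lee_fin /Rintegral fineK; last exact: integrable_fin_num (sden_integrable beI).
exact: sden_mass_le1.
Qed.

End stable_density.

Section affinity.
Variable R : realType.
Local Notation mu := (@lebesgue_measure R).
Local Notation Rp := (`]0%R, +oo[%classic : set R).
Implicit Types a b al be s u x y c d e p q r K L : R.

Lemma integrable_line (g : R -> R) : measurable_fun [set: R] g ->
  mu.-integrable Rp (EFin \o g) -> mu.-integrable Rp (EFin \o (fun x => g (- x))) ->
  mu.-integrable [set: R] (EFin \o g).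
Proof.
move=> mg i1 i2; apply/integrableP; split; first exact/measurable_EFinP.
have mgN : measurable_fun [set: R] (fun x => g (- x)).
  by apply: measurableT_comp => //; exact: oppr_measurable.
have mng : measurable_fun [set: R] (fun x => `|(g x)%:E|%E).
  by apply: measurableT_comp => //; exact/measurable_EFinP.
have mngN : measurable_fun [set: R] (fun x => `|(g (- x))%:E|%E).
  by apply: measurableT_comp => //; exact/measurable_EFinP.
have -> : [set: R] = `]-oo, 0%R]%classic `|` Rp.
  apply/seteqP; split => // x _ /=; rewrite !in_itv/= andbT.
  by have [x0|x0] := leP x 0; [left|right].
rewrite ge0_integral_setU//=; last 2 first.
- by apply: measurable_funS mng.
- apply/disj_setPS => x [/=]; rewrite !in_itv/= andbT => h1 h2.
  by have := le_lt_trans h1 h2; rewrite ltxx.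
have E := @ge0_integration_by_substitution0 R (fun x => `|(g (- x))%:E|%E) mngN (fun x => abse_ge0 _).
have -> : (\int[mu]_(x in `]-oo, 0%R]) `|g x|%:E = \int[mu]_(x in `[0%R, +oo[) `|(g (- x))%:E|)%E.
  by rewrite E; apply: eq_integral => x _; rewrite opprK.
rewrite -integral_itv_obnd_cbnd; last by apply: measurable_funS mngN.
by have /integrableP[_ h1] := i1; have /integrableP[_ h2] := i2; rewrite lte_add_pinfty.
Qed.

Lemma integrable_line_dom p K (g : R -> R) : 0 < p -> measurable_fun [set: R] g ->
  (forall x, x != 0 -> `|g x| <= K * wfun p `|x|) -> mu.-integrable [set: R] (EFin \o g).
Proof.
move=> p0 mg H; apply: integrable_line => //.
- apply: (@wfun_integrable_dom R p K) => // [|x x0]; first exact: measurable_funTS.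
  by have := H x (lt0r_neq0 x0); rewrite (gtr0_norm x0).
- apply: (@wfun_integrable_dom R p K) => // [|x x0].
    by apply: measurable_funTS; apply: measurableT_comp => //; exact: oppr_measurable.
  by have := H (- x); rewrite oppr_eq0 normrN (gtr0_norm x0) (gt_eqF x0) => /(_ isT).
Qed.

Lemma sden_bounds a : 0 < a <= 2^-1 ->
  exists2 K : R, 0 < K & forall al u, a <= al < 2 ->
    [/\ sden al u <= K, `|u| * sden al u <= K &
        u != 0 -> sden al u <= K * `|u| `^ (- (1 + a))].
Proof.
move=> /[dup] aI /andP[a0 a12].
have [K1 K10 H1] := sden_bounded a0; have [K2 K20 H2] := sden_tail aI.
have K12 : 0 < K1 + K2 by rewrite addr_gt0.
exists (K1 + K2) => // al u /[dup] alI /andP[aal al2].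
have al0 : 0 < al < 2 by rewrite (lt_le_trans a0 aal) al2.
have f0 z : 0 < sden al z by exact: sden_gt0.
have h1 : sden al u <= K1 by rewrite (le_trans (ler_norm _))// H1.
have h2 : u != 0 -> sden al u <= K2 * `|u| `^ (- (1 + a)).
  move=> u0; have au0 : 0 < `|u| by rewrite normr_gt0.
  have -> : sden al u = sden al `|u|.
    by have [?|?] := leP 0 u; [rewrite ger0_norm|rewrite ltr0_norm// sdenN].
  have := H2 al `|u|; rewrite aal (ltW al2) => /(_ isT au0) /(le_trans (ler_norm _)).
  by rewrite opprD.
have n0 := normr_ge0 u.
split.
- by rewrite (le_trans h1)// lerDl ltW.
- have [u1|u1] := leP `|u| 1.
    by rewrite (@le_trans _ _ (1 * K1))// ?ler_pM// ?(ltW (f0 _))// mul1r lerDl ltW.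
  have un : u != 0 by rewrite -normr_gt0 (lt_trans _ u1).
  rewrite (le_trans (ler_wpM2l n0 (h2 un)))// mulrCA (@le_trans _ _ (K2 * 1))//.
    rewrite ler_pM2l// -{1}(powRr1 n0) -powRD; last by rewrite normr_eq0 (negbTE un) implybT.
    by rewrite -(powRr0 `|u|) ler_powR ?(ltW u1)//; lra.
  by rewrite mulr1 lerDr ltW.
- move=> un; rewrite (le_trans (h2 un))// ler_wpM2r ?powR_ge0// lerDr ltW//.
Qed.

Lemma sden_index_scale_continuous al e : 0 < al < 2 -> 0 < e ->
  exists2 d, 0 < d < 2^-1 & forall be s u, `|be - al| <= d -> `|s - 1| <= d ->
    [/\ al / 2 <= be < 2 & u != 0 -> s * sden be (s * u) <= sden al u + e / `|u|].
Proof.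
move=> /andP[al0 al2] e0.
pose a := Num.min (al / 2) 2^-1.
have a0 : 0 < a by rewrite lt_min divr_gt0//=; lra.
have aal : a <= al / 2 by rewrite ge_min lexx.
have a12 : a <= 2^-1 by rewrite ge_min lexx orbT.
have aI : 0 < a <= 2^-1 by rewrite a0.
have [K K0 HK] := sden_bounds aI.
have [L L0 HL] := sden_lipschitz a0.
pose U := 1 + (4 * K / e) `^ a^-1.
have U0 : 0 < U by rewrite /U ltr_pwDl ?powR_ge0.
have q0 : 0 < 4 * K / e by rewrite divr_gt0 ?mulr_gt0.
have Ule u : U <= `|u| -> K * (2 * `|u| `^ (- a)) <= e.
  move=> Uu; have u0 : 0 < `|u| by exact: lt_le_trans Uu.
  have h : 4 * K / e <= `|u| `^ a.
    have -> : 4 * K / e = ((4 * K / e) `^ a^-1) `^ a.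
      by rewrite -powRrM mulVf ?gt_eqF// powRr1// ltW.
    rewrite ge0_ler_powR ?nnegrE ?(ltW a0) ?powR_ge0//.
    by rewrite (le_trans _ Uu)// lerDr.
  have h2 : 0 < `|u| `^ a by rewrite powR_gt0.
  rewrite powRN mulrA ler_pdivrMr//.
  have : 4 * K <= e * `|u| `^ a by rewrite -ler_pdivrMl// mulrC.
  by nra.
pose eta := e / (8 * U).
have eta0 : 0 < eta by rewrite divr_gt0 ?mulr_gt0.
have [d1 d10 Hd1] := sden_index_continuous al0 eta0.
pose d2 := e / (8 * U * (K + L * U)).
have KLU : 0 < K + L * U by rewrite addr_gt0 ?mulr_gt0.
have d20 : 0 < d2 by rewrite divr_gt0 ?mulr_gt0.
pose d := Num.min (Num.min (d1 / 2) d2) (Num.min 4^-1 (Num.min (al / 2) ((2 - al) / 2))).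
have dd1 : d <= d1 / 2 by rewrite !ge_min lexx.
have dd2 : d <= d2 by rewrite !ge_min lexx orbT.
have dd3 : d <= 4^-1 by rewrite !ge_min lexx !orbT.
have dd4 : d <= al / 2 by rewrite !ge_min lexx !orbT.
have dd5 : d <= (2 - al) / 2 by rewrite !ge_min lexx !orbT.
have d0 : 0 < d.
  rewrite !lt_min d20; move: d10 al0 al2; clear_after R.
  by do 3![apply/andP; split; first lra]; lra.
exists d; first by rewrite d0/=; lra.
move=> be s u hbe; rewrite ler_norml => /andP[s1 s2].
have bed1 : `|be - al| < d1 by rewrite (le_lt_trans hbe)//; lra.
move: hbe; rewrite ler_norml => /andP[be1 be2].
have beI : al / 2 <= be < 2.
  by move: be1 be2 dd4 dd5 al2; clear_after R; apply/andP; split; lra.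
split => // un.
have u0 : 0 < `|u| by rewrite normr_gt0.
have be0 : a <= be < 2 by case/andP: beI => h1 ->; rewrite andbT (le_trans aal).
have alI : a <= al < 2 by rewrite al2 andbT; lra.
have f0 z : 0 < sden al z by apply: sden_gt0; rewrite al0.
have s0 : 0 < s by move: s1 dd3; clear_after R; lra.
rewrite -lerBlDl ler_pdivlMr//.
have [uU|uU] := leP U `|u|.
  apply: (@le_trans _ _ (s * sden be (s * u) * `|u|)).
    by rewrite ler_wpM2r ?(ltW u0)// lerBlDr lerDl ltW.
  have sun : s * u != 0 by rewrite mulf_neq0// gt_eqF.
  have [_ _ /(_ sun) h] := HK be (s * u) be0.
  have suE : `|s * u| = s * `|u| by rewrite normrM gtr0_norm.
  rewrite mulrAC -suE.
  have su0 : 0 < `|s * u| by rewrite normr_gt0.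
  rewrite (le_trans (ler_wpM2l (ltW su0) h))// mulrCA -[X in X * _ `^ _](powRr1 (ltW su0)).
  rewrite -powRD; last by rewrite (gt_eqF su0) implybT.
  rewrite (_ : 1 + - (1 + a) = - a); last by ring.
  rewrite (le_trans _ (Ule u uU))// ler_pM2l// suE powRM ?(ltW s0) ?(ltW u0)//.
  rewrite ler_wpM2r ?powR_ge0//.
  rewrite powRN -[leRHS]invrK lef_pV2 ?posrE ?powR_gt0 ?invr_gt0//.
  rewrite (@le_trans _ _ (2^-1 `^ a))//.
    rewrite -{1}[2^-1]powRr1 ?invr_ge0// ger_powR//; last by move: a12; clear_after R; lra.
    by clear_after R; apply/andP; split; lra.
  by rewrite ge0_ler_powR ?nnegrE ?(ltW a0) ?invr_ge0 ?(ltW s0)//; move: s1 dd3; clear_after R; lra.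
have t1 : s * sden be (s * u) - sden al u <= d * K + 2 * eta + L * (d * U).
  have e1 := Hd1 be (s * u) bed1.
  have e2 : `|sden al (s * u) - sden al u| <= L * `|s * u - u|.
    by apply: HL; case/andP: alI.
  have [e3 _ _] := HK al (s * u) alI.
  have e4 : `|s * u - u| <= d * U.
    rewrite -[X in _ - X]mul1r -mulrBl normrM; apply: ler_pM => //; last exact: ltW.
    by rewrite ler_norml s1 s2.
  have e5 : L * `|s * u - u| <= L * (d * U) by rewrite ler_pM2l.
  have e6 : s * (sden be (s * u) - sden al (s * u)) <= 2 * eta.
    rewrite (@le_trans _ _ (s * eta))//.
      by rewrite ler_pM2l// (le_trans (ler_norm _)).
    by rewrite ler_pM2r//; move: s2 dd3; clear_after R; lra.
  have e7 : (s - 1) * sden al (s * u) <= d * K.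
    apply: (@le_trans _ _ (d * sden al (s * u))); last by rewrite ler_pM2l.
    by rewrite ler_wpM2r// ltW.
  have e8 : sden al (s * u) - sden al u <= L * (d * U).
    by rewrite (le_trans (ler_norm _))// (le_trans e2).
  have := lerD (lerD e7 e6) e8; apply: le_trans; rewrite le_eqVlt; apply/orP; left; apply/eqP.
  by ring.
have t2 : (d * K + 2 * eta + L * (d * U)) * U <= e.
  have g1 : d * (K + L * U) * (8 * U) <= e.
    apply: (@le_trans _ _ (d2 * (K + L * U) * (8 * U))).
      by rewrite !ler_pM2r ?mulr_gt0.
    by rewrite /d2 -mulrA (mulrC (K + _)) divfK// gt_eqF ?mulr_gt0.
  have g2 : eta * (8 * U) = e by rewrite /eta divfK// gt_eqF ?mulr_gt0.
  by move: g1 g2 e0; clear_after R; lra.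
have [n|n] := leP 0 (s * sden be (s * u) - sden al u); last first.
  by rewrite (le_trans _ (ltW e0))// mulr_le0_ge0 ?(ltW n) ?(ltW u0).
by rewrite (le_trans _ t2)// ler_pM// ltW.
Qed.

Lemma powR_le_base k x y : 0 <= k -> 0 <= x -> x <= y -> x `^ k <= y `^ k.
Proof. by move=> k0 x0 xy; rewrite ge0_ler_powR ?nnegrE// (le_trans x0). Qed.

Lemma powR_interp (K r x t q : R) : 0 < K -> 0 < r -> 0 < x -> 0 < t -> 0 <= q <= 1 ->
  t <= K * r -> t <= K * x `^ (-1) -> t <= K * (r `^ q * x `^ (- (1 - q))).
Proof.
move=> K0 r0 x0 t0 /andP[q0 q1] l1 l2.
have -> : K * (r `^ q * x `^ (- (1 - q))) = (K * r) `^ q * (K * x `^ (-1)) `^ (1 - q).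
  rewrite !powRM ?powR_ge0 ?(ltW K0) ?(ltW r0)// -powRrM mulN1r.
  rewrite mulrACA -powRD; last by rewrite (gt_eqF K0) implybT.
  by rewrite (_ : q + (1 - q) = 1) ?powRr1 ?(ltW K0)//; ring.
have {1}-> : t = t `^ q * t `^ (1 - q).
  by rewrite -powRD ?(gt_eqF t0) ?implybT// (_ : q + (1 - q) = 1) ?powRr1 ?(ltW t0)//; ring.
have q2 : 0 <= 1 - q by rewrite subr_ge0.
by rewrite ler_pM ?powR_ge0//; apply: powR_le_base => //; exact: ltW.
Qed.

Lemma measurable_powRT (d : measure_display) (T : measurableType d) (g : T -> R) (k : R) :
  measurable_fun setT g -> measurable_fun setT (fun x : T => g x `^ k).
Proof. by move=> mg; apply: (measurableT_comp (measurable_powR k) mg). Qed.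

Lemma sden_power_integrable al a k b : 0 < al < 2 -> 0 < a <= 2^-1 -> a <= al ->
  0 < k -> b < 1 -> 1 < k * (1 + a) + b ->
  mu.-integrable [set: R] (EFin \o (fun x => sden al x `^ k * `|x| `^ (- b))).
Proof.
move=> alI aI aal k0 b1 kb.
have [K K0 HK] := sden_bounds aI.
have a0 : 0 < a by case/andP: aI.
have al0 : 0 < al by case/andP: alI.
have alI' : a <= al < 2 by rewrite aal; case/andP: alI.
pose p := Num.min (1 - b) (k * (1 + a) + b - 1).
have p0 : 0 < p by rewrite lt_min; apply/andP; split; lra.
have p1 : p <= 1 - b by rewrite ge_min lexx.
have p2 : p <= k * (1 + a) + b - 1 by rewrite ge_min lexx orbT.
apply: (@integrable_line_dom p (K `^ k * 4)) => //.
  apply: measurable_funM.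
    by apply: measurable_powRT; exact: sden_measurable.
  by apply: measurable_powRT; exact: normr_measurable.
move=> x xn; have x0 : 0 < `|x| by rewrite normr_gt0.
rewrite ger0_norm ?mulr_ge0 ?powR_ge0//.
have f0 := ltW (sden_gt0 x alI).
have [h1 _ /(_ xn) h2] := HK al x alI'.
have [x1|x1] := leP `|x| 1.
  rewrite -mulrA ler_pM ?powR_ge0//.
    by rewrite ge0_ler_powR ?nnegrE ?(ltW k0) ?(ltW K0).
  by apply: powR_le_wfun => //; [rewrite x0|lra].
have h3 : sden al x `^ k <= K `^ k * `|x| `^ (- (k * (1 + a))).
  rewrite (_ : - (k * (1 + a)) = - (1 + a) * k); last by ring.
  rewrite powRrM -powRM ?powR_ge0 ?(ltW K0)//.
  by apply: powR_le_base => //; exact: ltW.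
rewrite (le_trans (ler_wpM2r (powR_ge0 _ _) h3))// -!mulrA ler_pM2l ?powR_gt0//.
rewrite -powRD; last by rewrite (gt_eqF x0) implybT.
rewrite -opprD; apply: powR_le_wfun_infty => //; [exact: ltW|lra].
Qed.

Lemma sqrt_powR x : 0 <= x -> (x `^ 2^-1) ^+ 2 = x.
Proof. by move=> x0; rewrite -powR_mulrn ?powR_ge0// -powRrM mulVf ?powRr1. Qed.

Lemma powR_half_le x y : 0 <= x -> x <= y -> x `^ 2^-1 <= y `^ 2^-1.
Proof. by move=> x0 xy; rewrite ge0_ler_powR ?nnegrE// (le_trans x0). Qed.

Lemma powR_half_subadd x y : 0 <= x -> 0 <= y ->
  (x + y) `^ 2^-1 <= x `^ 2^-1 + y `^ 2^-1.
Proof.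
move=> x0 y0.
have h1 := sqrt_powR x0; have h2 := sqrt_powR y0; have h3 := sqrt_powR (addr_ge0 x0 y0).
have := powR_ge0 x 2^-1; have := powR_ge0 y 2^-1; have := powR_ge0 (x + y) 2^-1.
nra.
Qed.

Definition affinity al0 al r : R :=
  \int[mu]_x (sden al0 x * (r * sden al (r * x))) `^ 2^-1.

Section affinity_gap.
Variables (al0 al : R).
Hypotheses (al0I : 0 < al0 < 2) (alI : 0 < al < 2).

Let f0_gt0 x : 0 < sden al0 x. Proof. exact: sden_gt0. Qed.
Let f_gt0 x : 0 < sden al x. Proof. exact: sden_gt0. Qed.
Let al0_gt0 : 0 < al0. Proof. by case/andP: al0I. Qed.
Let al_gt0 : 0 < al. Proof. by case/andP: alI. Qed.

Let a := Num.min 2^-1 (Num.min al0 al).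
Let aI : 0 < a <= 2^-1.
Proof. by rewrite /a !lt_min al0_gt0 al_gt0 ge_min lexx/= invr_gt0 ltr0n. Qed.
Let a_gt0 : 0 < a. Proof. by case/andP: aI. Qed.
Let aal0 : a <= al0. Proof. by rewrite !ge_min lexx !orbT. Qed.
Let aal : a <= al. Proof. by rewrite !ge_min lexx !orbT. Qed.

Let hel r x := (sden al0 x * (r * sden al (r * x))) `^ 2^-1.

Let fr_cont r x : {for x, continuous (fun x => r * sden al (r * x))}.
Proof.
apply: continuousM; first exact: cvg_cst.
apply: (@continuous_comp _ _ _ (fun x => r * x) (sden al)).
  by apply: cvgM; [exact: cvg_cst|exact: cvg_id].
exact: sden_continuous.
Qed.

Let fr_meas r : measurable_fun [set: R] (fun x => r * sden al (r * x)).
Proof. by apply: continuous_measurable_fun => x; exact: fr_cont. Qed.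

Let hel_meas r : measurable_fun [set: R] (hel r).
Proof.
apply: measurable_powRT.
by apply: measurable_funM => //; exact: sden_measurable.
Qed.

Let h_ge0 r x : 0 <= hel r x. Proof. exact: powR_ge0. Qed.

Let fr_mass r : 0 < r -> mu.-integrable [set: R] (EFin \o (fun x => r * sden al (r * x))) /\
  \int[mu]_x (r * sden al (r * x)) <= 1.
Proof.
move=> r0.
have E := @ge0_integral_affine R r 0 setT (fun x => (sden al x)%:E) r0 measurableT.
have {E} E : (\int[mu]_x (r * sden al (r * x))%:E = \int[mu]_x (sden al x)%:E)%E.
  rewrite E//; last 2 first.
  - by apply/measurable_EFinP; exact: sden_measurable.
  - by move=> x _; rewrite lee_fin ltW.
  rewrite preimage_setT -[RHS](@ge0_integralZl_EFin _ _ _ mu setT measurableT); last 3 first.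
  - by move=> x _; rewrite lee_fin ltW.
  - apply/measurable_EFinP; under eq_fun do rewrite addr0.
    apply: continuous_measurable_fun => x.
    apply: (@continuous_comp _ _ _ (fun x => r * x) (sden al)); last exact: sden_continuous.
    by apply: cvgM; [exact: cvg_cst|exact: cvg_id].
  - exact: ltW.
  by apply: eq_integral => x _; rewrite addr0 EFinM.
have I : mu.-integrable [set: R] (EFin \o (fun x => r * sden al (r * x))).
  apply/integrableP; split; first by apply/measurable_EFinP; exact: fr_meas.
  apply: (@le_lt_trans _ _ 1%:E); last by rewrite ltry.
  rewrite (le_trans _ (sden_mass_le1 alI))// -E.
  rewrite le_eqVlt; apply/orP; left; apply/eqP; apply: eq_integral => x _ /=.
  by rewrite gtr0_norm// mulr_gt0.
split => //; rewrite -lee_fin /Rintegral fineK; last exact: integrable_fin_num I.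
by rewrite E; exact: sden_mass_le1.
Qed.

Let h_amgm r x : 0 < r -> hel r x <= (sden al0 x + r * sden al (r * x)) / 2.
Proof.
move=> r0; have p0 := f0_gt0 x; have q0 : 0 < r * sden al (r * x) by rewrite mulr_gt0.
rewrite /hel; move: (sden al0 x) (r * sden al (r * x)) p0 q0 => p q p0 q0.
have := sqrt_powR (mulr_ge0 (ltW p0) (ltW q0)).
move=> s2; have z0 := powR_ge0 (p * q) 2^-1; have pq2 := sqr_ge0 (p - q).
nra.
Qed.

Let h_integrable r : 0 < r -> mu.-integrable [set: R] (EFin \o hel r).
Proof.
move=> r0; have [i1 _] := fr_mass r0; have i2 := sden_integrable al0I.
apply: (@integrable_dom_leb _ _ _ (fun x => 2^-1 * (sden al0 x + r * sden al (r * x)))) => //.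
  by apply: integrableZ_leb => //; exact: integrableD_leb.
by move=> x _; rewrite ger0_norm// mulrC h_amgm.
Qed.

Lemma affinity_integrable r : 0 < r -> mu.-integrable [set: R]
  (EFin \o (fun x => (sden al0 x * (r * sden al (r * x))) `^ 2^-1)).
Proof. exact: h_integrable. Qed.

Lemma affinity_le1 r : 0 < r -> affinity al0 al r <= 1.
Proof.
move=> r0; have [i1 m1] := fr_mass r0; have i2 := sden_integrable al0I; have m2 := sden_Rmass_le1 al0I.
have i3 := integrableD_leb measurableT i2 i1.
apply: (@le_trans _ _ (\int[mu]_x (2^-1 * (sden al0 x + r * sden al (r * x))))).
  apply: le_Rintegral_leb => //; [exact: h_integrable|exact: integrableZ_leb|].
  by move=> x _; rewrite [leRHS]mulrC; exact: h_amgm.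
rewrite RintegralZl// RintegralD//; lra.
Qed.

Let affinity_lt1 r : 0 < r -> ~ (al0 = al /\ r = 1) -> affinity al0 al r < 1.
Proof.
move=> r0 ne; have [i1 m1] := fr_mass r0; have i2 := sden_integrable al0I; have m2 := sden_Rmass_le1 al0I.
have i3 := integrableD_leb measurableT i2 i1.
have i4 := integrableZ_leb 2 measurableT (h_integrable r0).
have [x0 nx0] : exists x0, sden al0 x0 <> r * sden al (r * x0).
  apply: contrapT => /forallNP H; apply: ne.
  by apply: (@sden_scale_inj R al0 al r) => // x; apply: contrapT => /H.
pose g x := sden al0 x + r * sden al (r * x) - 2 * hel r x.
have g0 x : 0 <= g x by have := h_amgm x r0; rewrite /g; lra.
have : 0 < \int[mu]_x g x.
  apply: (@Rintegral_gt0 R setT g x0) => //.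
  - exact: filterT.
  - exact: integrableB_leb.
  - apply: continuousB.
      by apply: continuousD; [exact: sden_continuous|exact: fr_cont].
    apply: continuousM; first exact: cvg_cst.
    apply: (@continuous_comp _ _ _ (fun x => sden al0 x * (r * sden al (r * x))) (fun z => z `^ 2^-1)).
      by apply: continuousM; [exact: sden_continuous|exact: fr_cont].
    by apply: powR_continuous_pt; rewrite !mulr_gt0 ?f0_gt0 ?f_gt0.
  - rewrite /g /hel.
    have p0 := f0_gt0 x0; have q0 : 0 < r * sden al (r * x0) by rewrite mulr_gt0.
    move: (sden al0 x0) (r * sden al (r * x0)) p0 q0 nx0 => p q p0 q0 /eqP pq.
    have s := sqrt_powR (mulr_ge0 (ltW p0) (ltW q0)).
    have s0 := powR_ge0 (p * q) 2^-1.
    have d0 : 0 < (p - q) ^+ 2 by rewrite lt_neqAle sqr_ge0 andbT eq_sym sqrf_eq0 subr_eq0.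
    nra.
have E1 : \int[mu]_x (2 * hel r x) = 2 * affinity al0 al r.
  by rewrite RintegralZl//; exact: h_integrable.
rewrite /g RintegralB// RintegralD// E1; lra.
Qed.

Let K := sval (cid2 (sden_bounds aI)).
Let K_gt0 : 0 < K. Proof. by rewrite /K; case: cid2. Qed.
Let HK be u : a <= be < 2 -> [/\ sden be u <= K, `|u| * sden be u <= K &
        u != 0 -> sden be u <= K * `|u| `^ (- (1 + a))].
Proof. by rewrite /K; case: (cid2 _) => K' ? H; exact: H. Qed.
Let alI' : a <= al < 2. Proof. by rewrite aal; case/andP: alI. Qed.

(* [r f(rx) <= K min(r, 1/|x|)], interpolated with weight [a/2] on the first bound. *)
Let fr_small r x : 0 < r -> x != 0 ->
  r * sden al (r * x) <= K * (r `^ (a / 2) * `|x| `^ (- (1 - a / 2))).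
Proof.
move=> r0 xn; have x0 : 0 < `|x| by rewrite normr_gt0.
have [h1 h2 _] := HK (r * x) alI'.
set t := r * sden al (r * x).
have t0 : 0 < t by rewrite mulr_gt0.
have l1 : t <= K * r by rewrite /t mulrC ler_pM2r.
have l2 : t <= K * `|x| `^ (-1).
  rewrite powR_inv1 ?(ltW x0)// ler_pdivlMr// /t mulrAC; move: h2.
  by rewrite normrM (gtr0_norm r0).
by apply: powR_interp => //; have := aI; lra.
Qed.

Let fr_large r x : 0 < r -> x != 0 ->
  r * sden al (r * x) <= K * (r `^ (- a) * `|x| `^ (- (1 + a))).
Proof.
move=> r0 xn; have x0 : 0 < `|x| by rewrite normr_gt0.
have rx : r * x != 0 by rewrite mulf_neq0// gt_eqF.
have [_ _ /(_ rx) h] := HK (r * x) alI'.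
rewrite (le_trans (ler_wpM2l (ltW r0) h))// normrM (gtr0_norm r0).
rewrite powRM ?(ltW r0) ?(ltW x0)// mulrCA ler_pM2l// mulrA ler_wpM2r ?powR_ge0//.
rewrite -{1}[r]powRr1 ?(ltW r0)// -powRD ?(gt_eqF r0) ?implybT//.
by rewrite (_ : 1 + - (1 + a) = - a)//; ring.
Qed.

Let aff_bound c q r : 0 < r -> q < 2 -> 1 < (1 + a) / 2 + q / 2 -> 0 <= c ->
  (forall x, x != 0 -> r * sden al (r * x) <= K * (c * `|x| `^ (- q))) ->
  affinity al0 al r <= (K * c) `^ 2^-1 * \int[mu]_x (sden al0 x `^ 2^-1 * `|x| `^ (- (q / 2))).
Proof.
move=> r0 q2 qa c0 H.
have iJ : mu.-integrable [set: R] (EFin \o (fun x => sden al0 x `^ 2^-1 * `|x| `^ (- (q / 2)))).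
  by apply: (@sden_power_integrable al0 a) => //; lra.
have pw (x : R) : x != 0 -> hel r x <= (K * c) `^ 2^-1 * (sden al0 x `^ 2^-1 * `|x| `^ (- (q / 2))).
  move=> xn; rewrite (_ : `|x| `^ (- (q / 2)) = (`|x| `^ (- q)) `^ 2^-1); last by rewrite -powRrM mulNr.
  have f0 := f0_gt0 x; have Kc : 0 <= K * c by rewrite mulr_ge0// ltW.
  rewrite [leRHS]mulrCA -!powRM ?mulr_ge0 ?powR_ge0 ?(ltW f0) ?(ltW K_gt0)//.
  apply: powR_half_le; first by rewrite ltW// !mulr_gt0.
  by rewrite ler_pM2l// -mulrA; exact: H.
rewrite -RintegralZl//.
rewrite /affinity /Rintegral fine_le//.
- exact: integrable_fin_num (h_integrable r0).
- exact: integrable_fin_num (integrableZ_leb _ measurableT iJ).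
apply: ae_ge0_le_integral => //.
- by move=> x _; rewrite lee_fin powR_ge0.
- by apply/measurable_EFinP; exact: hel_meas.
- by move=> x _; rewrite lee_fin !mulr_ge0 ?powR_ge0.
- by apply/measurable_EFinP; exact: measurable_int_leb (integrableZ_leb _ measurableT iJ).
exists [set 0]; split; [exact: measurable_set1|exact: lebesgue_measure_set1|].
move=> x /= /not_implyP[_ /negP]; rewrite lee_fin -ltNge => lt.
by apply: contraPP lt => /eqP xn; apply/negP; rewrite -leNgt; exact: pw.
Qed.

Let aff_ends : exists r1 r2, [/\ 0 < r1, r1 < 1, 1 < r2 &
  forall r, 0 < r -> r < r1 \/ r2 < r -> affinity al0 al r <= 2^-1].
Proof.
have a12 : a <= 2^-1 by case/andP: aI.
have g1 : 1 - a / 2 < 2 by have := a_gt0; lra.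
have g2 : 1 < (1 + a) / 2 + (1 - a / 2) / 2 by have := a_gt0; lra.
have g3 : 1 + a < 2 by lra.
have g4 : 1 < (1 + a) / 2 + (1 + a) / 2 by have := a_gt0; lra.
have [J1 J1E] : exists J : R, J = \int[mu]_x (sden al0 x `^ 2^-1 * `|x| `^ (- ((1 - a / 2) / 2))) by eexists; reflexivity.
have [J2 J2E] : exists J : R, J = \int[mu]_x (sden al0 x `^ 2^-1 * `|x| `^ (- ((1 + a) / 2))) by eexists; reflexivity.
have J10 : 0 <= J1 by rewrite J1E; apply: Rintegral_ge0 => x _; rewrite mulr_ge0 ?powR_ge0.
have J20 : 0 <= J2 by rewrite J2E; apply: Rintegral_ge0 => x _; rewrite mulr_ge0 ?powR_ge0.
pose M := 2 * K `^ 2^-1 * (J1 + J2) + 2.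
have KH : 0 < K `^ 2^-1 by rewrite powR_gt0.
have M2 : 2 <= M by rewrite /M lerDr !mulr_ge0 ?addr_ge0// ltW.
have M0 : 0 < M by exact: lt_le_trans M2.
pose r1 := M `^ (- (4 / a)); pose r2 := M `^ (2 / a).
have q1 : 0 < 4 / a by rewrite divr_gt0.
have q2 : 0 < 2 / a by rewrite divr_gt0.
have r10 : 0 < r1 by rewrite powR_gt0.
have r20 : 0 < r2 by rewrite powR_gt0.
have Mp z : 0 < z -> 1 < M `^ z.
  by move=> z0; rewrite -(powRr0 M) /powR !gt_eqF// ltr_expR ltr_pM2r// ln_gt0//; apply: lt_le_trans M2; rewrite ltr1n.
exists r1, r2; split => //.
- by rewrite /r1 powRN invf_lt1 ?powR_gt0// Mp.
- exact: Mp.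
have fin (c z : R) : 0 <= c -> c <= M^-1 -> 0 <= z -> 2 * K `^ 2^-1 * z + 2 <= M ->
    (K * c ^+ 2) `^ 2^-1 * z <= 2^-1.
  move=> c0 cM z0 zM.
  rewrite powRM ?sqr_ge0 ?(ltW K_gt0)// -powR_mulrn// -powRrM divff// powRr1//.
  have cM' : c * M <= 1 by rewrite -ler_pdivlMr// div1r.
  by have := ler_wpM2l c0 zM; move: cM' c0; clear_after aff_bound; lra.
move=> r r0 [rr|rr].
- have h1 := @aff_bound (r `^ (a / 2)) (1 - a / 2) r r0.
  apply: (le_trans (h1 g1 g2 (powR_ge0 _ _) _)).
    by move=> x xn; exact: fr_small.
  rewrite -J1E; have -> : r `^ (a / 2) = (r `^ (a / 4)) ^+ 2.
    by rewrite -powR_mulrn ?powR_ge0// -powRrM; congr (_ `^ _); field.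
  apply: fin => //; first exact: powR_ge0.
    have : r `^ (a / 4) <= r1 `^ (a / 4).
      by rewrite ge0_ler_powR ?nnegrE ?(ltW r0) ?(ltW r10) ?(ltW rr)// divr_ge0 ?(ltW a_gt0).
    rewrite /r1 -powRrM (_ : - (4 / a) * (a / 4) = -1) ?powR_inv1 ?(ltW M0)//.
    by field; rewrite gt_eqF.
  by rewrite /M lerD2r ler_wpM2l ?mulr_ge0 ?(ltW KH)// lerDl.
- have h1 := @aff_bound (r `^ (- a)) (1 + a) r r0.
  apply: (le_trans (h1 g3 g4 (powR_ge0 _ _) _)).
    by move=> x xn; exact: fr_large.
  rewrite -J2E; have -> : r `^ (- a) = (r `^ (- (a / 2))) ^+ 2.
    by rewrite -powR_mulrn ?powR_ge0// -powRrM; congr (_ `^ _); field.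
  apply: fin => //; first exact: powR_ge0.
    have : r `^ (- (a / 2)) <= r2 `^ (- (a / 2)).
      rewrite !powRN lef_pV2 ?posrE ?powR_gt0//.
      by rewrite ge0_ler_powR ?nnegrE ?(ltW r0) ?(ltW r20) ?(ltW rr)// divr_ge0 ?(ltW a_gt0).
    rewrite /r2 -powRrM (_ : 2 / a * - (a / 2) = -1) ?powR_inv1 ?(ltW M0)//.
    by field; rewrite gt_eqF.
  by rewrite /M lerD2r ler_wpM2l ?mulr_ge0 ?(ltW KH)// lerDr.
Qed.

Let aff_continuous r : 0 < r -> {for r, continuous (affinity al0 al)}.
Proof.
move=> r0.
pose g x := if x == 0 then (sden al0 0 * ((r + 1) * K)) `^ 2^-1
  else (K `^ 2^-1) * (sden al0 x `^ 2^-1 * `|x| `^ (- 2^-1)).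
have a12 : a <= 2^-1 by case/andP: aI.
have mg : measurable_fun [set: R] g.
  apply: measurable_fun_ifT => //=; first exact: measurable_fun_eqr.
  apply: measurable_funM => //; apply: measurable_funM.
    by apply: measurable_powRT; exact: sden_measurable.
  by apply: measurable_powRT; exact: normr_measurable.
have ig : mu.-integrable [set: R] (EFin \o g).
  have iJ : mu.-integrable [set: R] (EFin \o (fun x => sden al0 x `^ 2^-1 * `|x| `^ (- 2^-1))).
    by apply: (@sden_power_integrable al0 a) => //; have := a_gt0; lra.
  have iJ2 := integrableZ_leb (K `^ 2^-1) measurableT iJ.
  have sub := @subsetT R Rp.
  apply: integrable_line => //.
    have := integrableS_leb measurableT (measurable_itv `]0%R, +oo[) (@subsetT R _) iJ2.
    by apply: eq_integrable => // x /set_mem/RpP x0 /=; rewrite /g gt_eqF.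
  have := integrableS_leb measurableT (measurable_itv `]0%R, +oo[) (@subsetT R _) iJ2.
  by apply: eq_integrable => // x /set_mem/RpP x0 /=; rewrite /g oppr_eq0 gt_eqF// sdenN normrN.
have hg r' x : 0 < r' < r + 1 -> `|hel r' x| <= g x.
  move=> /andP[r'0 r'1]; rewrite ger0_norm// /g /hel.
  have [_ l2 _] := HK (r' * x) alI'; have [l1 _ _] := HK (r' * x) alI'.
  case: eqP => [->|/eqP xn].
    apply: powR_half_le; first by rewrite ltW// !mulr_gt0.
    rewrite ler_pM2l// mulr0 ler_pM ?(ltW r'0) ?(ltW (f_gt0 _)) ?(ltW r'1)//.
    by have [] := HK 0 alI'.
  have x0 : 0 < `|x| by rewrite normr_gt0.
  rewrite (_ : `|x| `^ (- 2^-1) = (`|x| `^ (-1)) `^ 2^-1); last by rewrite -powRrM mulN1r.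
  rewrite [leRHS]mulrCA -!powRM ?mulr_ge0 ?powR_ge0 ?(ltW K_gt0) ?(ltW (f0_gt0 _))//.
  apply: powR_half_le; first by rewrite ltW// !mulr_gt0.
  rewrite ler_pM2l// powR_inv1 ?(ltW x0)// ler_pdivlMr// mulrAC; move: l2.
  by rewrite normrM (gtr0_norm r'0).
have c : {in `]0%R, (r + 1)[%classic, continuous (affinity al0 al)}.
  apply: (@continuity_under_integral R _ (measurableTypeR R) mu hel setT measurableT 0 (r + 1) _ _ g) => //.
  - by move=> r'; rewrite /= in_itv/= => /andP[r'0 _]; exact: h_integrable.
  - apply: aeW => x _ r'; rewrite inE/= in_itv/= => /andP[r'0 _].
    apply: (@continuous_comp _ _ _ (fun r' => sden al0 x * (r' * sden al (r' * x))) (fun z => z `^ 2^-1)); last first.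
      by apply: powR_continuous_pt; rewrite !mulr_gt0 ?f0_gt0 ?f_gt0.
    apply: continuousM; first exact: cvg_cst.
    apply: continuousM; first exact: cvg_id.
    apply: (@continuous_comp _ _ _ (fun r' => r' * x) (sden al)); last exact: sden_continuous.
    by apply: cvgM; [exact: cvg_id|exact: cvg_cst].
  - by move=> r'; rewrite /= in_itv/= => r'I; apply: aeW => x _; exact: hg.
by apply: c; rewrite inE/= in_itv/= r0 ltrDl ltr01.
Qed.

Let aff_gap_itv r1 r2 : 0 < r1 -> r1 <= r2 ->
  (forall r, r1 <= r <= r2 -> ~ (al0 = al /\ r = 1)) ->
  exists2 c, 0 < c & forall r, r1 <= r <= r2 -> affinity al0 al r <= 1 - c.
Proof.
move=> r10 r12 ne.
have [|c cI H] := @EVT_max R (affinity al0 al) r1 r2 r12.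
  apply: continuous_in_subspaceT => r; rewrite inE/= in_itv/= => /andP[h1 _].
  by apply: aff_continuous; exact: lt_le_trans h1.
move: cI; rewrite in_itv/= => cI.
have lt : affinity al0 al c < 1.
  by apply: affinity_lt1 => //; [case/andP: cI => h _; exact: lt_le_trans h|exact: ne].
exists (1 - affinity al0 al c); first by rewrite subr_gt0.
by move=> r rI; rewrite subKr H// in_itv.
Qed.

Lemma affinity_gap (S : R -> Prop) d : 0 < d < 1 ->
  (forall r, 0 < r -> S r -> al0 <> al \/ (r <= 1 - d \/ 1 + d <= r)) ->
  exists2 c, 0 < c & forall r, 0 < r -> S r -> affinity al0 al r <= 1 - c.
Proof.
move=> /andP[d0 d1] HS.
have [r1 [r2 [r10 r11 r21 ends]]] := aff_ends.
have [E|E] := pselect (al0 = al); last first.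
  have [|c c0 H] := @aff_gap_itv r1 r2 r10 _ (fun r _ h => E (proj1 h)).
    by rewrite ltW// (lt_trans r11).
  exists (Num.min c 2^-1); first by rewrite lt_min c0/=; lra.
  move=> r r0 _; have m1 : Num.min c 2^-1 <= c by rewrite ge_min lexx.
  have m2 : Num.min c 2^-1 <= 2^-1 by rewrite ge_min lexx orbT.
  have [rr1|rr1] := ltP r r1; first by have := ends r r0 (or_introl rr1); lra.
  have [rr2|rr2] := ltP r2 r; first by have := ends r r0 (or_intror rr2); lra.
  by have := H r; rewrite rr1 rr2 => /(_ isT); lra.
pose r1' := Num.min r1 (1 - d); pose r2' := Num.max r2 (1 + d).
have r1'0 : 0 < r1' by rewrite lt_min r10/=; lra.
have r1'd : r1' <= 1 - d by rewrite ge_min lexx orbT.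
have r2'd : 1 + d <= r2' by rewrite le_max lexx orbT.
have [c1 c10 H1] := @aff_gap_itv r1' (1 - d) r1'0 r1'd (fun r h k => ltac:(case: k h => _ -> /andP[]; lra)).
have [|c2 c20 H2] := @aff_gap_itv (1 + d) r2' _ r2'd (fun r h k => ltac:(case: k h => _ -> /andP[]; lra)).
  by lra.
exists (Num.min (Num.min c1 c2) 2^-1); first by rewrite !lt_min c10 c20/=; lra.
move=> r r0 Sr; set c := Num.min _ _.
have m1 : c <= c1 by rewrite /c !ge_min lexx.
have m2 : c <= c2 by rewrite /c !ge_min lexx orbT.
have m3 : c <= 2^-1 by rewrite /c !ge_min lexx orbT.
have [rr1|rr1] := ltP r r1; first by have := ends r r0 (or_introl rr1); lra.
have [rr2|rr2] := ltP r2 r; first by have := ends r r0 (or_intror rr2); lra.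
have g1 : r1' <= r by rewrite ge_min rr1.
have g2 : r <= r2' by rewrite le_max rr2.
have [//|[h|h]] := HS r r0 Sr.
- by have := H1 r; rewrite g1 h => /(_ isT); lra.
- by have := H2 r; rewrite g2 h => /(_ isT); lra.
Qed.

End affinity_gap.
End affinity.

(** * Chains driven by independent innovations *)

Section product_law.
Context (R : realType) (d d1 d2 : measure_display) (T : measurableType d)
  (S1 : measurableType d1) (S2 : measurableType d2) (P : probability T R).
Variables (X : {mfun T >-> S1}) (Y : {mfun T >-> S2}).
Hypothesis indepXY : forall A B, measurable A -> measurable B ->
  P (X @^-1` A `&` Y @^-1` B) = (P (X @^-1` A) * P (Y @^-1` B))%E.

Lemma indep_integral (g : S1 * S2 -> \bar R) : measurable_fun setT g -> (forall z, 0 <= g z)%E ->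
  (\int[P]_w g (X w, Y w) = \int[P]_w \int[distribution P Y]_y g (X w, y))%E.
Proof.
move=> mg g0.
have mXY : measurable_fun setT (fun w => (X w, Y w)) by exact: measurable_fun_pair.
pose XY := mfun_Sub (mem_set mXY).
have E1 := @ge0_integral_pushforward _ _ _ _ R XY (measurable_funP XY) P setT g measurableT mg (fun y _ => g0 y).
have E2 := @ge0_integral_pushforward _ _ _ _ R X (measurable_funP X) P setT
  (fun x => \int[distribution P Y]_y g (x, y))%E measurableT.
rewrite preimage_setT in E1 E2.
transitivity (\int[distribution P XY]_z g z)%E; first by rewrite E1.
rewrite -[RHS]E2; last 2 first.
- exact: measurable_fun_fubini_tonelli_F.
- by move=> x _; apply: integral_ge0.
rewrite -(@fubini_tonelli1 _ _ _ _ R (distribution P X) (distribution P Y) g)//.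
apply: eq_measure_integral => A mA _; apply/esym.
apply: (@product_measure_unique _ _ _ _ R (distribution P X) (distribution P Y) (distribution P XY)) => //.
Qed.

End product_law.

Section density_law.
Context (R : realType) (d : measure_display) (T : measurableType d) (P : probability T R).
Local Notation mu := (@lebesgue_measure R).
Variables (X : T -> R) (f : R -> R).
Hypotheses (mX : measurable_fun setT X) (mf : measurable_fun setT f) (f0 : forall x, 0 <= f x).
Hypothesis Xf : forall A : set R, measurable A ->
  P (X @^-1` A) = (\int[mu]_(x in A) (f x)%:E)%E.

Let indic A : measurable A ->
  (\int[P]_w (\1_A (X w))%:E = \int[mu]_x ((\1_A x)%:E * (f x)%:E))%E.
Proof.
move=> mA.
have -> : (\int[P]_w (\1_A (X w))%:E = \int[P]_w (\1_(X @^-1` A) w)%:E)%E by [].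
rewrite integral_indic// ?setIT; last by rewrite -[X in measurable X]setTI; exact: mX.
transitivity (\int[mu]_(x in A) (f x)%:E)%E; first exact: Xf.
rewrite integral_mkcond; apply: eq_integral => x _.
by rewrite /patch/= indicE; case: (x \in A); rewrite ?mul1e ?mul0e.
Qed.

Import HBNNSimple.

Let nnsfunE (h : {nnsfun R >-> R}) :
  (\int[P]_w (h (X w))%:E = \int[mu]_x ((h x)%:E * (f x)%:E))%E.
Proof.
have mh r : measurable_fun [set: R] (fun x => ((f x)%:E * (r * \1_(h @^-1` [set r]) x)%:E)%E).
  by apply: emeasurable_funM; apply/measurable_EFinP => //; apply: measurable_funM.
have mh' r : measurable_fun [set: R] (fun x => ((\1_(h @^-1` [set r]) x)%:E * (f x)%:E)%E).
  by apply: emeasurable_funM; apply/measurable_EFinP.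
under [LHS]eq_integral do rewrite fimfunE -fsumEFin//.
rewrite [LHS]ge0_integral_fsum//; last 2 first.
- move=> r; apply/measurable_EFinP; apply: measurable_funM => //.
  by apply: (measurableT_comp _ mX).
- by move=> n x _; rewrite EFinM nnfun_muleindic_ge0.
under [RHS]eq_integral.
  move=> x _; rewrite fimfunE -fsumEFin// muleC ge0_mule_fsumr; last first.
    by move=> r; rewrite EFinM nnfun_muleindic_ge0.
  over.
rewrite [RHS]ge0_integral_fsum//; last first.
  by move=> n x _; apply: mule_ge0; [rewrite lee_fin|rewrite EFinM nnfun_muleindic_ge0].
apply: eq_fsbigr => r rr.
have r0 : (0 <= r)%R.
  by move: rr; rewrite inE/= => -[x _ <-].
have mi : measurable (h @^-1` [set r]) by exact: measurable_funPTI.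
transitivity (r%:E * \int[P]_w (\1_(h @^-1` [set r]) (X w))%:E)%E.
  rewrite -ge0_integralZl//; last first.
    by apply/measurable_EFinP; apply: (measurableT_comp _ mX).
rewrite indic// -ge0_integralZl//; last 2 first.
- exact: mh'.
- by move=> x _; rewrite mule_ge0 ?lee_fin.
by apply: eq_integral => x _; rewrite EFinM [RHS]muleC muleA.
Qed.

Lemma density_integral (g : R -> \bar R) : measurable_fun setT g -> (forall x, 0 <= g x)%E ->
  (\int[P]_w g (X w) = \int[mu]_x (g x * (f x)%:E))%E.
Proof.
move=> mg g0; pose g_ := nnsfun_approx measurableT mg.
have cg x : (g_ n x)%:E @[n --> \oo] --> g x by exact: cvg_nnsfun_approx.
have nd (x : R) a b : (a <= b)%N -> g_ a x <= g_ b x by move=> ab; exact/lefP/nd_nnsfun_approx.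
have mgf n : measurable_fun [set: R] (fun x => ((g_ n x)%:E * (f x)%:E)%E).
  by apply: emeasurable_funM; apply/measurable_EFinP.
transitivity (limn (fun n => \int[P]_w (g_ n (X w))%:E))%E.
  rewrite -monotone_convergence//=.
  - by apply: eq_integral => x _; apply/esym/cvg_lim => //=.
  - by move=> n; apply/measurable_EFinP; apply: measurableT_comp.
  - by move=> n x _; rewrite lee_fin.
  - by move=> x _ a b ab; rewrite lee_fin nd.
transitivity (limn (fun n => \int[mu]_x ((g_ n x)%:E * (f x)%:E)))%E.
  by congr (limn _); apply/funext => n; exact: nnsfunE.
rewrite -monotone_convergence//=.
- apply: eq_integral => x _; apply/cvg_lim => //=.
  under eq_fun do rewrite muleC.
  by rewrite muleC; apply: cvgeZl.
- by move=> n x _; rewrite mule_ge0 ?lee_fin.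
- by move=> x _ a b ab; rewrite lee_wpmul2r ?lee_fin ?nd.
Qed.

End density_law.

Section past.
Context (R : realType) (d : measure_display) (T : measurableType d) (P : probability T R).
Variables (e : nat -> T -> R).
Hypotheses (me : forall i, measurable_fun setT (e i)) (ind : mutually_indep P e).

Definition past_cylinder (N : nat) : set (set T) :=
  [set A | exists B : nat -> set R, (forall i, measurable (B i)) /\
    A = \big[setI/setT]_(i <- iota 0 N) (e i @^-1` B i)].

Let mpre i B : measurable B -> measurable (e i @^-1` B).
Proof. by move=> mB; rewrite -[X in measurable X]setTI; exact: me. Qed.

Let past_setI N : setI_closed (past_cylinder N).
Proof.
move=> _ _ [B [mB ->]] [C [mC ->]]; exists (fun i => B i `&` C i); split.
  by move=> i; exact: measurableI.
by rewrite -big_split.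
Qed.

Lemma past_measurable N A : <<s past_cylinder N >> A -> measurable A.
Proof.
apply: smallest_sub; first exact: sigma_algebra_measurable.
by move=> _ [B [mB ->]]; apply: bigsetI_measurable => i _; exact: mpre.
Qed.

Lemma past_indep N C A : measurable C -> <<s past_cylinder N >> A ->
  P (A `&` e N @^-1` C) = (P A * P (e N @^-1` C))%E.
Proof.
move=> mC; set E := e N @^-1` C; have mE : measurable E by exact: mpre.
apply: (@dynkin_induction _ (g_sigma_algebraType (past_cylinder N)) (past_cylinder N)
  (fun A : set T => P (A `&` E) = (P A * P E)%E)) => //.
- by rewrite setTI probability_setT mul1e.
- move=> _ [B [mB ->]].
  pose B' i := if i == N then C else B i.
  have mB' i : measurable (B' i) by rewrite /B'; case: ifP.
  have BN : B' N = C by rewrite /B' eqxx.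
  have H1 : \big[setI/setT]_(i <- iota 0 N) (e i @^-1` B' i) =
            \big[setI/setT]_(i <- iota 0 N) (e i @^-1` B i).
    by apply: eq_big_seq => i; rewrite mem_iota /= add0n /B' => iN; rewrite ltn_eqF.
  have H2 : (\prod_(i <- iota 0 N) P (e i @^-1` B' i) = \prod_(i <- iota 0 N) P (e i @^-1` B i))%E.
    by apply: eq_big_seq => i; rewrite mem_iota /= add0n /B' => iN; rewrite ltn_eqF.
  have := ind (s := iota 0 (N + 1)) (A := B') (iota_uniq _ _) mB'.
  rewrite iotaD !big_cat/= !big_seq1 add0n BN H1 H2 -/E => ->.
  by rewrite (ind (s := iota 0 N) (A := B) (iota_uniq _ _) mB).
- move=> S sS HS; have mS := past_measurable sS.
  have -> : ~` S `&` E = E `\` S by rewrite setDE setIC.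
  rewrite measureD//; last by rewrite ltey_eq fin_num_measure.
  transitivity (P E - P S * P E)%E; first by congr (_ - _)%E; rewrite setIC; exact: HS.
  rewrite probability_setC//.
  rewrite -(@fineK _ (P S)) ?fin_num_measure// -(@fineK _ (P E)) ?fin_num_measure//.
  by rewrite -EFinM -!EFinB -EFinM mulrBl mul1r.
- move=> F sF tF HF; have mF n := past_measurable (sF n).
  rewrite setI_bigcupl !measure_bigcup//; last 2 first.
  + by move=> i _; exact: measurableI.
  + by apply: trivIset_setIr.
  rewrite -(@fineK _ (P E)) ?fin_num_measure// muleC -nneseriesZl//.
  apply: eq_eseriesr => n _; transitivity (P (F n) * P E)%E; first exact: HF.
  by rewrite muleC fineK// fin_num_measure.
Qed.

Context (ds : measure_display) (S : measurableType ds) (F : S * R -> S) (z0 : S) (Z : nat -> T -> S).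
Hypotheses (mF : measurable_fun setT F) (Z0 : forall w, Z 0 w = z0)
  (ZS : forall n w, Z n.+1 w = F (Z n w, e n w)).

Lemma past_sub N : <<s past_cylinder N >> `<=` <<s past_cylinder N.+1 >>.
Proof.
apply: smallest_sub; first exact: smallest_sigma_algebra.
move=> _ [B [mB ->]]; apply: sub_sigma_algebra.
exists (fun i => if i == N then setT else B i); split; first by move=> i; case: ifP.
rewrite -addn1 iotaD big_cat/= big_seq1 add0n eqxx preimage_setT setIT.
by apply: eq_big_seq => i; rewrite mem_iota /= add0n => iN; rewrite ltn_eqF.
Qed.

Lemma past_last N B : measurable B -> <<s past_cylinder N.+1 >> (e N @^-1` B).
Proof.
move=> mB; apply: sub_sigma_algebra.
exists (fun i => if i == N then B else setT); split; first by move=> i; case: ifP.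
rewrite -addn1 iotaD big_cat/= big_seq1 add0n eqxx big1_seq ?setTI//.
by move=> i /andP[_]; rewrite mem_iota /= add0n => iN; rewrite ltn_eqF.
Qed.

Lemma chain_past N A : measurable A -> <<s past_cylinder N >> (Z N @^-1` A).
Proof.
elim: N A => [|N IH] A mA.
  rewrite (_ : Z 0 = cst z0); last exact/funext.
  rewrite preimage_cst; case: ifP => _; [|exact: sigma_algebra0].
  exact: (@measurableT _ (g_sigma_algebraType (past_cylinder 0))).
have mZ : measurable_fun setT (Z N : g_sigma_algebraType (past_cylinder N.+1) -> S).
  by move=> _ B mB; rewrite setTI; apply: past_sub; exact: IH.
have meN : measurable_fun setT (e N : g_sigma_algebraType (past_cylinder N.+1) -> R).
  by move=> _ B mB; rewrite setTI; exact: past_last.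
have m2 := measurableT_comp mF (measurable_fun_pair mZ meN).
have := m2 measurableT A mA; rewrite setTI.
by congr (<<s _ >> _); apply/funext => w /=; rewrite ZS.
Qed.

Lemma chain_measurable N : measurable_fun setT (Z N).
Proof. by move=> _ B mB; rewrite setTI; apply: (@past_measurable N); exact: chain_past. Qed.

Variable f : R -> R.
Hypotheses (mf : measurable_fun setT f) (f0 : forall x, 0 <= f x).
Local Notation mu := (@lebesgue_measure R).
Hypothesis ef : forall i (A : set R), measurable A ->
  P (e i @^-1` A) = (\int[mu]_(x in A) (f x)%:E)%E.

Lemma chain_integral N (g : S * R -> \bar R) : measurable_fun setT g -> (forall z, 0 <= g z)%E ->
  (\int[P]_w g (Z N w, e N w) = \int[P]_w \int[mu]_x (g (Z N w, x) * (f x)%:E))%E.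
Proof.
move=> mg g0.
pose X := mfun_Sub (mem_set (chain_measurable N)); pose Y := mfun_Sub (mem_set (me N)).
have := @indep_integral R _ _ _ T S R P X Y _ g mg g0 => -> /=; last first.
  by move=> A B mA mB; rewrite past_indep//; exact: chain_past.
apply: eq_integral => w _.
rewrite (@ge0_integral_pushforward _ _ _ _ R Y (measurable_funP Y) P setT (fun y => g (Z N w, y)))//.
- by rewrite preimage_setT/=; apply: (density_integral (me N) mf f0 (ef N) (g := fun y => g (Z N w, y))) => //; exact: measurable_fun_pair2.
- exact: measurable_fun_pair2.
Qed.

End past.

Section borel_cantelli.
Context (R : realType) (d : measure_display) (T : measurableType d) (P : probability T R).

Lemma sum_inv_pronic_le1 n : \sum_(0 <= k < n) ((k.+1 * k.+2)%:R^-1 : R) <= 1.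
Proof.
suff -> : \sum_(0 <= k < n) ((k.+1 * k.+2)%:R^-1 : R) = 1 - n.+1%:R^-1.
  by rewrite gerBl invr_ge0.
elim: n => [|n IH]; first by rewrite big_geq// invr1 subrr.
rewrite big_nat_recr//= IH natrM -[n.+2]addn1 natrD.
have n1 : (n.+1%:R : R) != 0 by rewrite pnatr_eq0.
have n2 : (n.+1%:R + 1 : R) != 0 by rewrite natr1 pnatr_eq0.
by move: (n.+1%:R : R) n1 n2 => m n1 n2; field; rewrite n1 n2.
Qed.

Lemma ae_eventually_le_pronic (X : nat -> T -> R) (K : R) :
  (forall n, measurable_fun setT (X n)) -> (forall n w, 0 <= X n w) -> 0 <= K ->
  (forall n, \int[P]_w (X n w)%:E <= K%:E)%E ->
  {ae P, forall w, \forall n \near \oo, X n w <= (n.+1 * n.+2)%:R}.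
Proof.
move=> mX X0 K0 HK.
pose c n : R := (n.+1 * n.+2)%:R.
have c0 n : 0 < c n by rewrite ltr0n.
pose F n := [set w | c n < X n w].
have mF n : measurable (F n).
  have -> : F n = X n @^-1` `]c n, +oo[%classic by apply/seteqP; split => w /=; rewrite in_itv/= andbT.
  by rewrite -[X in measurable X]setTI; apply: mX.
have PF n : (P (F n) <= (K * (c n)^-1)%:E)%E.
  have : ((c n)%:E * P (F n) <= K%:E)%E.
    rewrite -integral_cst//; apply: (le_trans _ (HK n)).
    apply: (@le_trans _ _ (\int[P]_(w in F n) (X n w)%:E)%E).
      apply: ge0_le_integral => //.
      - by move=> w _; rewrite lee_fin ltW.
      - by apply/measurable_EFinP; exact: measurable_funTS.
      - by move=> w; rewrite /F/= lee_fin => /ltW.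
    apply: ge0_subset_integral => //.
    - exact/measurable_EFinP.
    - by move=> w _; rewrite lee_fin.
  rewrite -[P (F n)]fineK ?fin_num_measure// -EFinM !lee_fin => h.
  by rewrite ler_pdivlMr// mulrC.
have S0 : P (lim_sup_set F) = 0%E.
  apply: lim_sup_set_cvg0 => //.
  apply: (@le_lt_trans _ _ K%:E); last by rewrite ltry.
  apply: lime_le; first by apply: is_cvg_nneseries.
  apply: nearW => n; apply: (@le_trans _ _ (\sum_(0 <= k < n) (K * (c k)^-1)%:E)%E).
    by apply: lee_sum => i _; exact: PF.
  rewrite sumEFin lee_fin -mulr_sumr -[leRHS]mulr1 ler_wpM2l//.
  exact: sum_inv_pronic_le1.
exists (lim_sup_set F); split => //.
  by apply: bigcapT_measurable => k; apply: bigcup_measurable.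
move=> w /= H n _ /=; apply: contrapT => H2; apply: H.
exists n => // k /= nk; rewrite leNgt; apply/negP => lt; apply: H2.
by exists k.
Qed.

End borel_cantelli.

Section growth.
Variable R : realType.

Lemma pronic_le_exp (eps : R) : 0 < eps ->
  \forall n \near \oo, ((n.+1 * n.+2)%:R : R) <= expR (eps * n%:R).
Proof.
move=> e0; pose t : R := eps / 3; have t0 : 0 < t by rewrite divr_gt0.
have [N HN] : exists N : nat, 6 / t ^+ 3 <= N%:R.
  by exists (Num.bound (6 / t ^+ 3)); apply/ltW/archi_boundP; rewrite divr_ge0// exprn_ge0// ltW.
exists N.+1 => // n /= Nn.
have n1 : (1 : R) <= n%:R by rewrite (ler_nat R 1) (leq_trans _ Nn).
have nN : 6 / t ^+ 3 <= n%:R by rewrite (le_trans HN)// ler_nat ltnW.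
apply: (@le_trans _ _ ((t * n%:R) ^+ 3)).
  have h : 6 <= n%:R * t ^+ 3 by rewrite -ler_pdivrMr// exprn_gt0.
  have -> : ((n.+1 * n.+2)%:R : R) = (n%:R + 1) * (n%:R + 2) by rewrite natrM -!natr1; ring.
  have h2 : 6 * n%:R ^+ 2 <= n%:R * t ^+ 3 * n%:R ^+ 2 :> R by rewrite ler_wpM2r// exprn_ge0.
  have -> : (t * n%:R) ^+ 3 = n%:R * t ^+ 3 * n%:R ^+ 2 by ring.
  apply: le_trans h2; nra.
have -> : expR (eps * n%:R) = expR (t * n%:R) ^+ 3.
  by rewrite -expRM_natl; congr expR; rewrite /t; field.
have tn : 0 <= t * n%:R by rewrite mulr_ge0// ltW.
rewrite lerXn2r// ?nnegrE ?expR_ge0//.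
by have := expR_ge1Dx (t * n%:R); lra.
Qed.

End growth.

Section chain_exponential.
Context (R : realType) (d : measure_display) (T : measurableType d) (P : probability T R).
Local Notation mu := (@lebesgue_measure R).
Variables (e : nat -> T -> R) (f : R -> R).
Hypotheses (iid : iid_density P e f) (mf : measurable_fun setT f) (f0 : forall x, 0 <= f x).

Lemma innovation_le_pronic (g : R -> R) (K : R) : measurable_fun setT g ->
  (forall x, 0 <= g x) -> 0 <= K -> (\int[mu]_x (g x * f x)%:E <= K%:E)%E ->
  {ae P, forall w, \forall n \near \oo, g (e n w) <= (n.+1 * n.+2)%:R}.
Proof.
move=> mg g0 K0 gK; have [me [_ ef]] := iid.
apply: (@ae_eventually_le_pronic _ _ _ P (fun n w => g (e n w)) K) => //.
  by move=> n; apply: measurableT_comp.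
move=> n; rewrite (density_integral (me n) mf f0 (ef n) (g := EFin \o g))//.
exact/measurable_EFinP.
Qed.

Context (ds : measure_display) (S : measurableType ds) (F : S * R -> S) (z0 : S) (Z : nat -> T -> S).
Hypotheses (mF : measurable_fun setT F) (Z0 : forall w, Z 0 w = z0)
  (ZS : forall n w, Z n.+1 w = F (Z n w, e n w)).

(* The exponential of the sum has mean at most [1], so Markov's inequality and Borel-Cantelli
   apply; this replaces every law of large numbers. *)
Lemma chain_exp_sum (xi : S * R -> R) : measurable_fun setT xi ->
  (forall n w, \int[mu]_x (expR (xi (Z n w, x)) * f x)%:E <= 1)%E ->
  {ae P, forall w, forall eps : R, 0 < eps ->
    \forall n \near \oo, \sum_(0 <= k < n) xi (Z k w, e k w) <= eps * n%:R}.
Proof.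
move=> mxi H; have [me [ind ef]] := iid.
pose Y n w := expR (\sum_(0 <= k < n) xi (Z k w, e k w)).
pose F' (u : (S * R) * R) := (F (u.1.1, u.2), u.1.2 * expR (xi (u.1.1, u.2))).
have m11 : measurable_fun setT (fun u : (S * R) * R => (u.1.1, u.2)).
  by apply: measurable_fun_pair => //; apply: measurableT_comp.
have mex : measurable_fun setT (fun u : (S * R) * R => expR (xi (u.1.1, u.2))).
  by apply: (measurableT_comp (@measurable_expR R)); apply: (measurableT_comp mxi m11).
have mF' : measurable_fun setT F'.
  apply: measurable_fun_pair; first exact: (measurableT_comp mF m11).
  by apply: measurable_funM => //; apply: measurableT_comp.
have W0 w : (Z 0 w, Y 0 w) = (z0, 1) by rewrite Z0 /Y big_geq// expR0.
have WS n w : (Z n.+1 w, Y n.+1 w) = F' ((Z n w, Y n w), e n w).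
  by rewrite ZS /F' /Y/= big_nat_recr//= expRD.
have mW n : measurable_fun setT (fun w => (Z n w, Y n w)).
  exact: (chain_measurable me mF' (Z := fun n w => (Z n w, Y n w)) W0 WS).
have mY n : measurable_fun setT (Y n).
  by apply: (measurableT_comp measurable_snd (mW n)).
have EY n : (\int[P]_w (Y n w)%:E <= 1%:E)%E.
  elim: n => [|n IH].
    rewrite (_ : (fun w => (Y 0 w)%:E) = cst 1%E); last by apply/funext => w; rewrite /Y big_geq// expR0.
    by rewrite integral_cst// mul1e probability_le1.
  pose g (u : (S * R) * R) := (`|u.1.2| * expR (xi (u.1.1, u.2)))%:E.
  have mg : measurable_fun setT g.
    apply/measurable_EFinP; apply: measurable_funM => //.
    by apply: measurableT_comp => //; apply: measurableT_comp.
  have g0 u : (0 <= g u)%E by rewrite lee_fin mulr_ge0// expR_ge0.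
  have := chain_integral me ind mF' (Z := fun n w => (Z n w, Y n w)) W0 WS mf f0 ef n mg g0.
  have -> : (\int[P]_w g ((Z n w, Y n w), e n w) = \int[P]_w (Y n.+1 w)%:E)%E.
    apply: eq_integral => w _; rewrite /g/= ger0_norm ?expR_ge0// /Y big_nat_recr//= expRD//.
  move=> ->; apply: le_trans IH; apply: ge0_le_integral => //.
  - by move=> w _; apply: integral_ge0 => x _; rewrite mule_ge0 ?lee_fin.
  - have mh : measurable_fun setT (fun u : (S * R) * measurableTypeR R => (g u * (f u.2)%:E)%E).
      apply: emeasurable_funM => //; apply/measurable_EFinP.
      by apply: (measurableT_comp mf); exact: measurable_snd.
    have mG := @measurable_fun_fubini_tonelli_F _ _ _ _ R mu _ mh.
    by apply: (measurableT_comp (mG _) (mW n)) => u; rewrite mule_ge0 ?lee_fin.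
  - exact/measurable_EFinP.
  - move=> w _.
    rewrite (_ : (fun x => (g (Z n w, Y n w, x) * (f x)%:E)%E) =
       (fun x => (Y n w)%:E * (expR (xi (Z n w, x)) * f x)%:E)%E); last first.
      by apply/funext => x; rewrite /g/= ger0_norm ?expR_ge0// -!EFinM mulrA.
    rewrite ge0_integralZl_EFin ?expR_ge0//.
    + by rewrite -[leRHS]mule1 lee_wpmul2l// lee_fin expR_ge0.
    + by move=> x _; rewrite lee_fin mulr_ge0// expR_ge0.
    + apply/measurable_EFinP; apply: measurable_funM => //.
      apply: (measurableT_comp (@measurable_expR R)).
      exact: (measurable_fun_pair2 (Z n w) mxi).
have := @ae_eventually_le_pronic _ _ _ P Y 1 mY (fun n w => expR_ge0 _) ler01 EY.
apply: filterS => w Hw eps e0; near=> n.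
rewrite -ler_expR; apply: (@le_trans _ _ (n.+1 * n.+2)%:R); last by near: n; exact: pronic_le_exp.
by near: n.
Unshelve. all: end_near. Qed.

End chain_exponential.

(** * True and filtered volatility *)

Section volatility.
Variable R : realType.
Implicit Types (th : param R) (x z c : R) (e : nat -> R).

Definition arch th x : R := p_php th * posp x ^+ 2 + p_phm th * negp x ^+ 2.

Definition param_pos th := [/\ 0 < p_om th, 0 < p_php th, 0 < p_phm th, 0 < p_psi th
      & 0 < p_alpha th < 2].

Lemma a_funE th x : a_fun th x = arch th x + p_psi th. Proof. by []. Qed.

Lemma pospM c x : 0 <= c -> posp (c * x) = c * posp x.
Proof. by move=> c0; rewrite /posp maxr_pMr// mulr0. Qed.

Lemma negpM c x : 0 <= c -> negp (c * x) = c * negp x.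
Proof. by move=> c0; rewrite /negp mulrN minr_pMr// mulr0. Qed.

Lemma posp0 : posp (0 : R) = 0. Proof. by rewrite /posp maxxx. Qed.
Lemma negp0 : negp (0 : R) = 0. Proof. by rewrite /negp minxx oppr0. Qed.

Lemma posp_ge0E x : 0 <= x -> posp x = x /\ negp x = 0.
Proof. by move=> x0; rewrite /posp /negp (max_idPl x0) (min_idPr x0) oppr0. Qed.

Lemma posp_le0E x : x <= 0 -> posp x = 0 /\ negp x = - x.
Proof. by move=> x0; rewrite /posp /negp (max_idPr x0) (min_idPl x0). Qed.

Lemma arch_ge0 th x : param_pos th -> 0 <= arch th x.
Proof. by case=> _ h1 h2 _ _; rewrite addr_ge0// mulr_ge0 ?sqr_ge0// ltW. Qed.

Lemma arch_sqrtM th c x : 0 <= c -> arch th (Num.sqrt c * x) = c * arch th x.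
Proof.
move=> c0; rewrite /arch pospM ?sqrtr_ge0// negpM ?sqrtr_ge0// !exprMn sqr_sqrtr//.
ring.
Qed.

Fixpoint svol (th0 : param R) z e n : R :=
  if n is n'.+1 then p_om th0 + svol th0 z e n' * a_fun th0 (e n') else z.

Fixpoint fvol (th0 : param R) z e th n : R :=
  if n is n'.+1 then
    p_om th + svol th0 z e n' * arch th (e n') + p_psi th * fvol th0 z e th n'
  else p_om th.

Section bounds.
Variables (th0 : param R) (z : R) (e : nat -> R).
Hypotheses (th0P : param_pos th0) (z0 : p_om th0 <= z).

Lemma svol_ge_om n : p_om th0 <= svol th0 z e n.
Proof.
case: (th0P) => om0 _ _ ps0 _; elim: n => //= n IH.
rewrite lerDl mulr_ge0//; first by rewrite (le_trans (ltW om0)).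
by rewrite a_funE addr_ge0// ?arch_ge0// ltW.
Qed.

Lemma svol_gt0 n : 0 < svol th0 z e n.
Proof. by case: (th0P) => om0 *; rewrite (lt_le_trans om0)// svol_ge_om. Qed.

Lemma fvol_ge_om th n : param_pos th -> p_om th <= fvol th0 z e th n.
Proof.
move=> thP; case: (thP) => om0 _ _ ps0 _; elim: n => //= n IH.
rewrite -addrA lerDl addr_ge0// mulr_ge0//.
- exact/ltW/svol_gt0.
- exact: arch_ge0.
- exact: ltW.
- exact: le_trans (ltW om0) IH.
Qed.

Lemma fvol_gt0 th n : param_pos th -> 0 < fvol th0 z e th n.
Proof. by move=> thP; case: (thP) => om0 *; rewrite (lt_le_trans om0)// fvol_ge_om. Qed.

Lemma fvol_mono th th' n : param_pos th ->
  p_om th <= p_om th' -> p_php th <= p_php th' -> p_phm th <= p_phm th' ->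
  p_psi th <= p_psi th' -> fvol th0 z e th n <= fvol th0 z e th' n.
Proof.
move=> thP h1 h2 h3 h4; elim: n => //= n IH.
apply: lerD; first apply: lerD => //.
- rewrite ler_wpM2l//; first exact/ltW/svol_gt0.
  by apply: lerD; rewrite ler_wpM2r ?sqr_ge0.
- apply: ler_pM => //; first by case: thP => _ _ _ /ltW.
  exact/ltW/fvol_gt0.
Qed.

(* With the true parameter the filtered volatility differs from the true one only through
   the initial value, which is damped by [p_psi th0] at each step. *)
Lemma fvol_true_gap n :
  svol th0 z e n = fvol th0 z e th0 n + p_psi th0 ^+ n * (z - p_om th0).
Proof.
elim: n => [|n IH]; first by rewrite expr0 mul1r subrKC.
rewrite /= a_funE exprS mulrDr (mulrC (svol _ _ _ _) (p_psi _)) [X in _ + (_ + _ * X)]IH.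
ring.
Qed.

End bounds.

Section link.
Variables (th0 : param R) (y0 s0 : R) (eta : nat -> R).
Hypotheses (th0P : param_pos th0) (s00 : 0 <= s0).
Let y t := (sagarch th0 y0 s0 eta t).1.
Let e n := eta n.+1.

Definition vol1 : R := p_om th0 + p_php th0 * posp y0 ^+ 2 + p_phm th0 * negp y0 ^+ 2
                + p_psi th0 * s0 ^+ 2.

Lemma vol1_ge_om : p_om th0 <= vol1.
Proof.
case: th0P => _ h1 h2 h3 _.
by rewrite /vol1 -!addrA lerDl !addr_ge0// mulr_ge0 ?sqr_ge0// ltW.
Qed.

Lemma sagarch_svol n :
  sagarch th0 y0 s0 eta n.+1 = (Num.sqrt (svol th0 vol1 e n) * e n, svol th0 vol1 e n).
Proof.
elim: n => [//|n IH].
have -> t : sagarch th0 y0 s0 eta t.+1 = let p := sagarch th0 y0 s0 eta t in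
   let s2 := p_om th0 + p_php th0 * posp p.1 ^+ 2 + p_phm th0 * negp p.1 ^+ 2
                + p_psi th0 * p.2 in (Num.sqrt s2 * eta t.+1, s2) by [].
rewrite IH /=; set v := svol th0 vol1 e n.
have v0 : 0 <= v by exact/ltW/svol_gt0/vol1_ge_om.
have E : p_om th0 + p_php th0 * posp (Num.sqrt v * e n) ^+ 2 +
   p_phm th0 * negp (Num.sqrt v * e n) ^+ 2 + p_psi th0 * v = p_om th0 + v * a_fun th0 (e n).
  have := arch_sqrtM th0 (e n) v0; rewrite /arch a_funE => A.
  by rewrite -[X in X + p_psi _ * _]addrA A /arch; ring.
by rewrite E.
Qed.

Lemma sig2t_fvol th n : sig2t th y n.+1 = fvol th0 vol1 e th n.
Proof.
elim: n => [|n IH].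
  by rewrite /= posp0 negp0 expr0n/= !mulr0 !addr0.
rewrite [LHS]/= -/(sig2t th y n.+1) IH /=.
set v := svol th0 vol1 e n.
have v0 : 0 <= v by exact/ltW/svol_gt0/vol1_ge_om.
have -> : y n.+1 = Num.sqrt v * e n by rewrite /y sagarch_svol.
by have := arch_sqrtM th (e n) v0; rewrite /arch => A; rewrite -[X in X + p_psi _ * _]addrA A.
Qed.

(* [lterm] is the log-density of [e n] predicted by the parameter; in [loglik] it appears
   shifted by the parameter-free quantity [ln (sigma_n)]. *)
Definition lterm zz ee th n : R :=
  let r := Num.sqrt (svol th0 zz ee n / fvol th0 zz ee th n) in
  ln (r * sden (p_alpha th) (r * ee n)).

Lemma loglikE th n : param_pos th -> loglik n th y =
  \sum_(0 <= k < n) (lterm vol1 e th k - ln (Num.sqrt (svol th0 vol1 e k))).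
Proof.
move=> thP; rewrite /loglik -sdenE big_add1 (_ : n.+1.-1 = n)//; apply: eq_bigr => k _.
rewrite sig2t_fvol {1}/y sagarch_svol /lterm /=.
set v := svol th0 vol1 e k; set u := fvol th0 vol1 e th k.
have v0 : 0 < v by exact/svol_gt0/vol1_ge_om.
have u0 : 0 < u by apply: fvol_gt0 => //; exact: vol1_ge_om.
have sv : 0 < Num.sqrt v by rewrite sqrtr_gt0.
have su : 0 < Num.sqrt u by rewrite sqrtr_gt0.
have E : Num.sqrt (v / u) = Num.sqrt v / Num.sqrt u.
  by rewrite sqrtrM ?(ltW v0)// sqrtrV ?(ltW u0).
rewrite E mulrAC lnM ?posrE ?divr_gt0//; last first.
  by apply: sden_gt0; case: thP.
by rewrite ln_div ?posrE//; ring.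
Qed.

End link.
End volatility.

Section measurability.
Context (R : realType) (d : measure_display) (T : measurableType d).

Lemma measurable_bool_natr (b : T -> bool) : measurable_fun setT b ->
  measurable_fun setT (fun x => (b x)%:R : R).
Proof.
move=> mb; rewrite (_ : (fun _ => _) = (fun x => if b x then 1 else 0)).
  exact: measurable_fun_ifT.
by apply/funext => x; case: (b x).
Qed.

End measurability.

Lemma deficit (R : realType) (I J : R) : 0 < I - J -> I <= 1 -> 0 <= J ->
  exists2 c : R, 0 < c < 1 & J <= 1 - c.
Proof. by move=> ? ? ?; exists ((I - J) / 2); [apply/andP; split|]; lra. Qed.

Section innovations.
Context (R : realType) (d : measure_display) (T : measurableType d) (P : probability T R).
Local Notation mu := (@lebesgue_measure R).
Variables (e : nat -> T -> R) (al : R).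
Hypotheses (alI : 0 < al < 2) (iid : iid_density P e (sden al)).

Let al_gt0 : 0 < al. Proof. by case/andP: alI. Qed.
Let f := sden al.
Let f_gt0 x : 0 < f x. Proof. exact: sden_gt0. Qed.
Let mf : measurable_fun [set: R] f. Proof. exact: sden_measurable. Qed.

Lemma innovation_neq0 : {ae P, forall w, forall n, e n w != 0}.
Proof.
have [me [_ ef]] := iid.
apply/ae_foralln => n; exists (e n @^-1` [set 0]); split.
- by rewrite -[X in measurable X]setTI; apply: me => //; exact: measurable_set1.
- exact: (etrans (ef n [set 0] (measurable_set1 0)) (integral_set1 _ _)).
- by move=> w /= /negP; rewrite negbK => /eqP.
Qed.

Lemma sden_mean_lt1 (g : R -> R) (x0 : R) : measurable_fun [set: R] g ->
  (forall x, 0 <= g x <= 1) -> {for x0, continuous g} -> g x0 < 1 ->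
  exists2 c : R, 0 < c < 1 & (\int[mu]_x (g x * f x)%:E <= (1 - c)%:E)%E.
Proof.
move=> mg g01 cg gx0.
have i1 := sden_integrable alI; have m1 := sden_Rmass_le1 alI.
have i2 : mu.-integrable [set: R] (EFin \o (fun x => g x * f x)).
  apply: (@integrable_dom_leb _ _ _ f) => //.
    by apply: measurable_funM.
  move=> x _; have /andP[h1 h2] := g01 x.
  by rewrite ger0_norm ?mulr_ge0 ?(ltW (f_gt0 x))// ler_piMl// ltW.
have i3 : mu.-integrable [set: R] (EFin \o (fun x => f x - g x * f x)).
  exact: integrableB_leb.
have c0 : 0 < \int[mu]_x (f x - g x * f x).
  apply: (@Rintegral_gt0 R setT _ x0) => //.
  - exact: filterT.
  - move=> x _; have /andP[h1 h2] := g01 x.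
    by rewrite subr_ge0 ler_piMl// ltW.
  - have cf : {for x0, continuous f} by exact: sden_continuous.
    by apply: continuousB => //; apply: continuousM.
  - by rewrite subr_gt0 gtr_pMl.
rewrite RintegralB// in c0.
have g0 : 0 <= \int[mu]_x (g x * f x).
  by apply: Rintegral_ge0 => x _; have /andP[h1 h2] := g01 x; rewrite mulr_ge0// ltW.
have E : (\int[mu]_x (g x * f x)%:E = (\int[mu]_x (g x * f x))%:E)%E.
  by rewrite /Rintegral fineK//; exact: integrable_fin_num i2.
rewrite E {E}; move: c0 m1 g0; rewrite -/f.
move: (\int[mu]_x f x) (\int[mu]_x (g x * f x)) => I J.
by move=> c0 m1 g0; have [c cI Jc] := deficit c0 m1 g0; exists c; rewrite ?lee_fin.
Qed.

Lemma sden_itv_mean (a b : R) : a < b ->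
  exists2 c : R, 0 < c < 1 &
    (\int[mu]_x (expR (- (a <= x <= b)%R%:R) * f x)%:E <= (1 - c)%:E)%E.
Proof.
move=> ab.
have mb : measurable_fun [set: R] (fun x : R => a <= x <= b).
  by apply: measurable_and; apply: measurable_fun_ler.
apply: (@sden_mean_lt1 (fun x => expR (- (a <= x <= b)%R%:R)) ((a + b) / 2)).
- apply: (measurableT_comp (@measurable_expR R)); apply: measurable_funN.
  exact: measurable_bool_natr.
- move=> x; rewrite expR_ge0/= -[leRHS]expR0 ler_expR oppr_le0; exact: ler0n.
- have H : \forall x \near (a + b) / 2, expR (- 1) = expR (- (a <= x <= b)%R%:R) :> R.
    have : \forall x \near (a + b) / 2, x \in `]a, b[.
      by apply: near_in_itvoo; rewrite in_itv/=; apply/andP; split; lra.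
    by apply: filterS => x; rewrite in_itv/= => /andP[h1 h2]; rewrite (ltW h1) (ltW h2).
  apply: cvg_near_cst; apply: filterS H => x <-.
  have -> : a <= (a + b) / 2 <= b by apply/andP; split; lra.
  by [].
- have -> : a <= (a + b) / 2 <= b by apply/andP; split; lra.
  by rewrite -[ltRHS]expR0 ltr_expR oppr_lt0.
Qed.

Context (ds : measure_display) (S : measurableType ds) (F : S * R -> S) (z0 : S) (Z : nat -> T -> S).
Hypotheses (mF : measurable_fun setT F) (Z0 : forall w, Z 0 w = z0)
  (ZS : forall n w, Z n.+1 w = F (Z n w, e n w)).

Lemma chain_count (Sb : S -> bool) (b : R -> bool) (c : R) : measurable_fun setT Sb ->
  measurable_fun setT b -> 0 < c < 1 ->
  (\int[mu]_x (expR (- (b x)%:R) * f x)%:E <= (1 - c)%:E)%E ->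
  {ae P, forall w, forall eps : R, 0 < eps -> \forall n \near \oo,
    c * (\sum_(0 <= k < n) (Sb (Z k w))%:R) <=
    \sum_(0 <= k < n) (Sb (Z k w) && b (e k w))%:R + eps * n%:R}.
Proof.
move=> mS mb /andP[c0 c1] Hc.
pose xi (u : S * R) : R := (Sb u.1)%:R * (- (b u.2)%:R - ln (1 - c)).
have mxi : measurable_fun setT xi.
  apply: measurable_funM.
    by apply: measurable_bool_natr; apply: measurableT_comp.
  apply: measurable_funD => //; apply: measurable_funN.
  by apply: measurable_bool_natr; apply: measurableT_comp.
have c1' : 0 < 1 - c by rewrite subr_gt0.
have := @chain_exp_sum R d T P e f iid mf (fun x => ltW (f_gt0 x)) ds S F z0 Z mF Z0 ZS xi mxi.
have H : forall n w, (\int[mu]_x (expR (xi (Z n w, x)) * f x)%:E <= 1)%E.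
  move=> n w; rewrite /xi/=; case: (Sb (Z n w)); last first.
    under eq_integral do rewrite mul0r expR0 mul1r.
    exact: sden_mass_le1.
  have -> : (\int[mu]_x (expR (1%:R * (- (b x)%:R - ln (1 - c))) * f x)%:E =
     \int[mu]_x ((1 - c)^-1%:E * (expR (- (b x)%:R) * f x)%:E))%E.
    apply: eq_integral => x _; rewrite mul1r expRD expRN lnK ?posrE// -EFinM; congr _%:E.
    by ring.
  rewrite ge0_integralZl_EFin ?invr_ge0 ?(ltW c1')//.
  - apply: (@le_trans _ _ ((1 - c)^-1%:E * (1 - c)%:E)%E).
      by rewrite lee_wpmul2l// lee_fin invr_ge0 ltW.
    by rewrite -EFinM mulVf ?gt_eqF.
  - by move=> x _; rewrite lee_fin mulr_ge0 ?expR_ge0// ltW.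
  - apply/measurable_EFinP; apply: measurable_funM => //.
    apply: (measurableT_comp (@measurable_expR R)); apply: measurable_funN.
    exact: measurable_bool_natr.
move=> /(_ H); apply: filterS => w Hw eps e0.
have := Hw eps e0; apply: filterS => n Hn.
rewrite -lerBlDl; apply: le_trans Hn; rewrite mulr_sumr -sumrB; apply: ler_sum => k _.
rewrite /xi/=; case: (Sb (Z k w)); last by rewrite mulr0 mul0r subr0.
rewrite /= mulr1 mul1r addrC lerD2l.
have := ln_sublinear c1'.
by have := le_ln1Dx (x := - c); rewrite ltrN2 => /(_ c1); lra.
Qed.

End innovations.

(** * Bracketing the filtered volatility *)

Section measurable_recursion.
Context (R : realType) (d : measure_display) (T : measurableType d).
Implicit Types g : T -> R.

Lemma measurable_lnT g : measurable_fun setT g -> measurable_fun setT (fun x => ln (g x)).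
Proof. by move=> mg; apply: (measurableT_comp (@measurable_ln R) mg). Qed.

Lemma measurable_archT g (th : param R) : measurable_fun setT g ->
  measurable_fun setT (fun x => arch th (g x)).
Proof.
move=> mg.
have m0 : measurable_fun setT (fun x : R => x < 0) by apply: measurable_fun_ltr.
have mp : measurable_fun setT (@posp R).
  rewrite (_ : @posp R = fun x => if x < 0 then 0 else x); first exact: measurable_fun_ifT.
  by apply/funext => x; rewrite /posp /Num.max; case: ifP.
have mn : measurable_fun setT (@negp R).
  rewrite (_ : @negp R = fun x => - (if x < 0 then x else 0)).
    by apply: measurable_funN; exact: measurable_fun_ifT.
  by apply/funext => x; rewrite /negp /Num.min; case: ifP.
by apply: measurable_funD; apply: measurable_funM => //; apply: measurable_funX;
  apply: measurableT_comp.
Qed.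

End measurable_recursion.

Definition pscale (R : realType) (c : R) (th : param R) : param R :=
  (c * p_om th, (c * p_php th, c * p_phm th, c * p_psi th, p_alpha th)).

Lemma arch_pscale (R : realType) (c : R) (th : param R) (x : R) :
  arch (pscale c th) x = c * arch th x.
Proof. by rewrite /arch /pscale /p_php /p_phm /=; ring. Qed.

Lemma pscale_pos (R : realType) (c : R) (th : param R) :
  0 < c -> param_pos th -> param_pos (pscale c th).
Proof. by move=> c0 [h1 h2 h3 h4 h5]; split; rewrite //= mulr_gt0. Qed.

Section mean.
Context (R : realType) (al : R).
Local Notation mu := (@lebesgue_measure R).
Hypothesis alI : 0 < al < 2.

(* The value at [0] is irrelevant: this is where the envelopes used later are infinite. *)
Lemma sden_le_mean (g1 g2 : R -> R) : measurable_fun [set: R] g1 -> measurable_fun [set: R] g2 ->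
  (forall x, 0 <= g1 x) -> (forall x, 0 <= g2 x) -> (forall x, x != 0 -> g1 x <= g2 x) ->
  (\int[mu]_x (g1 x * sden al x)%:E <= \int[mu]_x (g2 x * sden al x)%:E)%E.
Proof.
move=> m1 m2 g10 g20 g12.
have f0 x : 0 <= sden al x by rewrite ltW// sden_gt0.
have mf : measurable_fun [set: R] (sden al) by apply: sden_measurable; case/andP: alI.
have mg1 : measurable_fun [set: R] (fun x => g1 x * sden al x) by exact: measurable_funM.
have mg2 : measurable_fun [set: R] (fun x => g2 x * sden al x) by exact: measurable_funM.
apply: ae_ge0_le_integral => //.
- by move=> x _; rewrite lee_fin mulr_ge0.
- exact/measurable_EFinP.
- by move=> x _; rewrite lee_fin mulr_ge0.
- exact/measurable_EFinP.
exists [set 0]; split; [exact: measurable_set1|exact: lebesgue_measure_set1|].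
move=> x /= /not_implyP[_ /negP]; rewrite lee_fin -ltNge => lt.
by apply: contraPP lt => /eqP xn; apply/negP; rewrite -leNgt ler_wpM2r// g12.
Qed.

Lemma sden_mean_le1 (g : R -> R) : measurable_fun [set: R] g ->
  (forall x, 0 <= g x <= 1) -> (\int[mu]_x (g x * sden al x)%:E <= 1)%E.
Proof.
move=> mg g01; apply: le_trans (sden_mass_le1 alI).
have -> : (\int[mu]_x (sden al x)%:E = \int[mu]_x (1 * sden al x)%:E)%E.
  by apply: eq_integral => x _; rewrite mul1r.
by apply: sden_le_mean => // x; have /andP[] := g01 x.
Qed.

Lemma sden_affine_mean (A B K : R) (W : R -> R) : 0 <= A -> 0 <= B ->
  measurable_fun [set: R] W -> (forall x, 0 <= W x) ->
  (\int[mu]_x (W x * sden al x)%:E <= K%:E)%E ->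
  (\int[mu]_x ((A + B * W x) * sden al x)%:E <= (A + B * K)%:E)%E.
Proof.
move=> A0 B0 mW W0 HW.
have f0 x : 0 <= sden al x by rewrite ltW// sden_gt0.
have mf : measurable_fun [set: R] (sden al) by apply: sden_measurable; case/andP: alI.
have mWf : measurable_fun [set: R] (fun x => W x * sden al x) by exact: measurable_funM.
have -> : (\int[mu]_x ((A + B * W x) * sden al x)%:E =
   \int[mu]_x (A%:E * (sden al x)%:E + B%:E * (W x * sden al x)%:E))%E.
  by apply: eq_integral => x _; rewrite -!EFinM -EFinD mulrDl mulrA.
rewrite ge0_integralD//; last 4 first.
- by move=> x _; rewrite mule_ge0 ?lee_fin.
- by apply/measurable_EFinP; exact: measurable_funM.
- by move=> x _; rewrite mule_ge0 ?lee_fin ?mulr_ge0.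
- by apply/measurable_EFinP; exact: measurable_funM.
rewrite ge0_integralZl_EFin//; last 2 first.
- by move=> x _; rewrite lee_fin.
- exact/measurable_EFinP.
rewrite ge0_integralZl_EFin//; last 2 first.
- by move=> x _; rewrite lee_fin mulr_ge0.
- exact/measurable_EFinP.
rewrite EFinD; apply: leeD.
  by rewrite -[leRHS]mule1 lee_wpmul2l ?lee_fin//; exact: sden_mass_le1.
by rewrite EFinM lee_wpmul2l ?lee_fin.
Qed.

End mean.

Section bracket.
Context (R : realType) (d : measure_display) (T : measurableType d) (P : probability T R).
Local Notation mu := (@lebesgue_measure R).
Variables (e : nat -> T -> R) (th0 : param R) (z : R).
Hypotheses (th0P : param_pos th0) (z0 : p_om th0 <= z)
  (iid : iid_density P e (sden (p_alpha th0))).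
Let f := sden (p_alpha th0).
Let alI : 0 < p_alpha th0 < 2. Proof. by case: th0P. Qed.
Let sv n w := svol th0 z (fun k => e k w) n.
Let fv th n w := fvol th0 z (fun k => e k w) th n.

Variable th : param R.
Hypothesis thP : param_pos th.
Let om_gt0 : 0 < p_om th. Proof. by case: thP. Qed.
Let psi_gt0 : 0 < p_psi th. Proof. by case: thP. Qed.

Let damping_measurable V0 : 0 < V0 ->
  measurable_fun [set: R] (fun x => (p_psi th * V0) / (arch th x + p_psi th * V0)).
Proof.
move=> V00; have pV : 0 < p_psi th * V0 by rewrite mulr_gt0.
rewrite (_ : (fun _ => _) = fun x => p_psi th * V0 * (arch th x + p_psi th * V0) `^ (-1)).
  apply: measurable_funM => //; apply: measurable_powRT; apply: measurable_funD => //.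
  by apply: measurable_archT.
by apply/funext => x; rewrite powR_inv1// addr_ge0 ?arch_ge0// ltW.
Qed.

(* The expected damping of a relative perturbation while [l < V0 * s]. *)
Let damping V0 : 0 < V0 -> exists2 c : R, 0 < c < 1 &
  (\int[mu]_x ((p_psi th * V0) / (arch th x + p_psi th * V0) * f x)%:E <= (1 - c)%:E)%E.
Proof.
move=> V00; have pV : 0 < p_psi th * V0 by rewrite mulr_gt0.
have den x : 0 < arch th x + p_psi th * V0 by rewrite ltr_wpDl// arch_ge0.
have ca (x : R) : {for x, continuous (arch th)}.
  apply: continuousD; apply: continuousM; try exact: cvg_cst.
  - apply: (@continuous_comp _ _ _ (@posp R) (fun x => x ^+ 2)); last exact: exprn_continuous.
    by apply: continuous_max; [exact: cvg_id|exact: cvg_cst].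
  - apply: (@continuous_comp _ _ _ (@negp R) (fun x => x ^+ 2)); last exact: exprn_continuous.
    by apply: continuousN; apply: continuous_min; [exact: cvg_id|exact: cvg_cst].
apply: (@sden_mean_lt1 _ _ alI (fun x => (p_psi th * V0) / (arch th x + p_psi th * V0)) 1).
- exact: damping_measurable.
- move=> x; rewrite divr_ge0 ?(ltW pV) ?(ltW (den x))//= ler_pdivrMr// mul1r lerDr.
  exact: arch_ge0.
- apply: continuousM; first exact: cvg_cst.
  apply: continuousV; first by rewrite gt_eqF.
  by apply: continuousD; [exact: ca|exact: cvg_cst].
- rewrite ltr_pdivrMr// mul1r ltrDr /arch; have [-> ->] := posp_ge0E (@ler01 R).
  by case: thP => _ h *; rewrite expr0n/= mulr0 addr0 expr1n mulr1.
Qed.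

(* [1 + M (h / l - 1)] is a Lyapunov function for the ratio of the two filtered volatilities: it
   contracts on average whenever the ratio is large while [l] is not much larger than [s]. *)
Lemma bracket_rare (C0 V0 kap dmax : R) : 0 < C0 -> 0 < V0 -> 0 < kap -> 0 < dmax ->
  exists dl : R, [/\ 0 < dl, dl <= dmax, dl < 1 &
   {ae P, forall w, \forall n \near \oo,
    \sum_(0 <= k < n) (((1 + C0) * fv (pscale (1 - dl) th) k w <= fv (pscale (1 + dl) th) k w)
       && (fv (pscale (1 - dl) th) k w < V0 * sv k w))%:R <= kap * n%:R}].
Proof.
move=> C00 V00 kap0 dmax0.
have [c /andP[c0 c1] Wc] := damping V00.
pose M := 4 / (c * C0).
have M0 : 0 < M by rewrite divr_gt0// mulr_gt0.
have MC : M * C0 = 4 / c by rewrite /M; field; rewrite !gt_eqF.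
pose t := Num.min (c / 64) (kap * c / 64).
have t0 : 0 < t by rewrite lt_min !divr_gt0// mulr_gt0.
have tc : t <= c / 64 by rewrite ge_min lexx.
have tk : t <= kap * c / 64 by rewrite ge_min lexx orbT.
pose dl := Num.min (Num.min dmax 2^-1) (t / (1 + M)).
have dl0 : 0 < dl by rewrite !lt_min dmax0 divr_gt0 ?addr_gt0//= andbT invr_gt0.
have dl1 : dl <= dmax by rewrite !ge_min lexx.
have dl2 : dl <= 2^-1 by rewrite !ge_min lexx orbT.
have dl3 : dl * (1 + M) <= t.
  by rewrite -ler_pdivlMr ?addr_gt0// !ge_min lexx orbT.
clearbody t dl M.
pose D := (1 + dl) / (1 - dl).
have dlt1 : dl < 1 by lra.
have dm : 0 < 1 - dl by lra.
have D1 : D - 1 = 2 * dl / (1 - dl) by rewrite /D; field; rewrite gt_eqF.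
have Dd : D - 1 <= 4 * dl.
  by rewrite D1 ler_pdivrMr//; nra.
have Dge : 0 < D - 1 by rewrite D1 !divr_gt0// mulr_gt0.
have DM : (D - 1) * (1 + M) <= 4 * t by nra.
have DM1 : (D - 1) <= 4 * t by nra.
have DM2 : M * (D - 1) <= 4 * t by nra.
clearbody D.
exists dl; split => //.
pose lo := pscale (1 - dl) th; pose hi := pscale (1 + dl) th.
have loP : param_pos lo by exact: pscale_pos.
have hiP : param_pos hi by apply: pscale_pos => //; lra.
pose S := (R * R * R)%type.
pose F (u : S * R) : S :=
  (p_om th0 + u.1.1.1 * (arch th0 u.2 + p_psi th0),
   (1 - dl) * (p_om th + u.1.1.1 * arch th u.2 + p_psi th * u.1.1.2),
   (1 + dl) * (p_om th + u.1.1.1 * arch th u.2 + p_psi th * u.1.2)).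
pose Z n w : S := (sv n w, fv lo n w, fv hi n w).
have Z0 w : Z 0 w = (z, p_om lo, p_om hi) by [].
have ZS n w : Z n.+1 w = F (Z n w, e n w).
  rewrite /Z /F /sv /fv /=; congr (_, _, _).
  - by rewrite /lo arch_pscale (_ : p_psi (pscale _ _) = (1 - dl) * p_psi th)//; ring.
  - by rewrite /hi arch_pscale (_ : p_psi (pscale _ _) = (1 + dl) * p_psi th)//; ring.
have m1 : measurable_fun setT (fun u : S * R => u.1.1.1).
  by apply: (measurableT_comp measurable_fst); apply: (measurableT_comp measurable_fst).
have m2 : measurable_fun setT (fun u : S * R => u.1.1.2).
  by apply: (measurableT_comp measurable_snd); apply: (measurableT_comp measurable_fst).
have m3 : measurable_fun setT (fun u : S * R => u.1.2).
  by apply: (measurableT_comp measurable_snd).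
have ma tt : measurable_fun setT (fun u : S * R => arch tt u.2).
  by apply: measurable_archT.
have mF : measurable_fun setT F.
  apply: measurable_fun_pair; first apply: measurable_fun_pair.
  - by apply: measurable_funD => //; apply: measurable_funM => //; apply: measurable_funD.
  - apply: measurable_funM => //; apply: measurable_funD; last exact: measurable_funM.
    by apply: measurable_funD => //; apply: measurable_funM.
  - apply: measurable_funM => //; apply: measurable_funD; last exact: measurable_funM.
    by apply: measurable_funD => //; apply: measurable_funM.
pose H (u : S) : R := 1 + M * (u.2 * u.1.2 `^ (-1) - 1).
pose rare (u : S) := ((1 + C0) * u.1.2 <= u.2) && (u.1.2 < V0 * u.1.1).
pose lam (u : S) : R := if rare u then 1 - c / 4 else D + M * (D - 1).
pose xi (u : S * R) := ln (H (F u)) - ln (H u.1) - ln (lam u.1).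
have mc1 : measurable_fun setT (fun u : S => u.1.1) by apply: (measurableT_comp measurable_fst).
have mc2 : measurable_fun setT (fun u : S => u.1.2) by apply: (measurableT_comp measurable_snd).
have mc3 : measurable_fun setT (fun u : S => u.2) by exact: measurable_snd.
have mH : measurable_fun setT H.
  apply: measurable_funD => //; apply: measurable_funM => //; apply: measurable_funD => //.
  by apply: measurable_funM => //; apply: measurable_powRT.
have mrare : measurable_fun setT rare.
  apply: measurable_and; first by apply: measurable_fun_ler => //; apply: measurable_funM.
  by apply: measurable_fun_ltr => //; apply: measurable_funM.
have mlam : measurable_fun setT lam by apply: measurable_fun_ifT.
have mxi : measurable_fun setT xi.
  apply: measurable_funB; first apply: measurable_funB.
  - by apply: measurable_lnT; apply: (measurableT_comp mH mF).
  - by apply: measurable_lnT; apply: (measurableT_comp mH measurable_fst).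
  - by apply: measurable_lnT; apply: (measurableT_comp mlam measurable_fst).
have lam1 : 0 < 1 - c / 4 by lra.
have lam2 : 1 <= D + M * (D - 1).
  by have := mulr_ge0 (ltW M0) (ltW Dge); move: Dge; clear_after damping; lra.
have lamP u : 0 < lam u by rewrite /lam; case: ifP => // _; exact: lt_le_trans lam2.
have fx0 x : 0 < f x by exact: sden_gt0.
have mf : measurable_fun [set: R] f by apply: sden_measurable; case/andP: alI.
have state n w : [/\ 0 < sv n w, 0 < fv lo n w & fv lo n w <= fv hi n w].
  split; [exact: svol_gt0|exact: fvol_gt0|].
  have Q a : 0 < a -> (1 - dl) * a <= (1 + dl) * a.
    by move=> a0; rewrite ler_pM2r//; move: dl0; clear_after damping; lra.
  by case: (thP) => q1 q2 q3 q4 _; apply: fvol_mono => //; exact: Q.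
have HE s l h : 0 < l -> H (s, l, h) = 1 + M * (h / l - 1).
  by move=> l0; rewrite /H/= powR_inv1// ltW.
have stepH s l h x : 0 < s -> 0 < l -> l <= h ->
    H (F ((s, l, h), x)) = 1 + M * (D - 1) +
      M * D * (h / l - 1) * (p_psi th * l / (p_om th + s * arch th x + p_psi th * l)).
  move=> s0 l0 lh.
  have C1 : 0 < p_om th + s * arch th x by rewrite ltr_wpDr// mulr_ge0 ?(ltW s0)// arch_ge0.
  have pl : 0 < p_psi th * l by rewrite mulr_gt0.
  rewrite /F/= HE; last by rewrite mulr_gt0// addr_gt0.
  have DE : D = (1 + dl) / (1 - dl) by apply/eqP; rewrite -subr_eq0; apply/eqP; rewrite -[D](subrK 1) D1; field; rewrite gt_eqF.
  rewrite DE; field.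
  by rewrite !gt_eqF// addr_gt0.
have Hge1 s l h : 0 < l -> l <= h -> 1 <= H (s, l, h).
  by move=> l0 lh; rewrite HE// lerDl mulr_ge0 ?(ltW M0)// subr_ge0 ler_pdivlMr// mul1r.
have Hxi : forall n w, (\int[mu]_x (expR (xi (Z n w, x)) * f x)%:E <= 1)%E.
  move=> n w; have [s0 l0 lh] := state n w; rewrite /Z.
  move: (sv n w) (fv lo n w) (fv hi n w) s0 l0 lh => s l h s0 l0 lh.
  have X0 : 0 <= h / l - 1 by rewrite subr_ge0 ler_pdivlMr// mul1r.
  have wx x : 0 <= p_psi th * l / (p_om th + s * arch th x + p_psi th * l) <= 1.
    have C1 : 0 < p_om th + s * arch th x by rewrite ltr_wpDr// mulr_ge0 ?(ltW s0)// arch_ge0.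
    have pl : 0 < p_psi th * l by rewrite mulr_gt0.
    apply/andP; split; first by apply: divr_ge0; [exact: ltW|exact/ltW/addr_gt0].
    have den := addr_gt0 C1 pl.
    by rewrite (ler_pdivrMr _ _ den) mul1r lerDr ltW.
  have MDX : 0 <= M * D * (h / l - 1).
    by apply: mulr_ge0 => //; apply: mulr_ge0; [exact: ltW|move: Dge; clear_after damping; lra].
  have H1 := Hge1 s l h l0 lh; have H0 : 0 < H (s, l, h) by exact: lt_le_trans H1.
  have H'0 x : 0 < H (F ((s, l, h), x)).
    rewrite stepH//; have /andP[w0 _] := wx x.
    rewrite ltr_wpDr//; first exact: mulr_ge0.
    by rewrite addr_gt0// mulr_gt0.
  have exiE x : expR (xi ((s, l, h), x)) = H (F ((s, l, h), x)) / (H (s, l, h) * lam (s, l, h)).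
    rewrite /xi /= -ln_div ?posrE// -ln_div ?posrE ?divr_gt0// lnK ?posrE ?divr_gt0 ?divr_gt0//.
    by rewrite invfM mulrA.
  have HL : 0 < H (s, l, h) * lam (s, l, h) by rewrite mulr_gt0.
  have [rr|rr] := boolP (rare (s, l, h)); last first.
    apply: (sden_mean_le1 alI).
      by apply: (measurableT_comp (@measurable_expR R)); exact: (measurable_fun_pair2 (s, l, h) mxi).
    - move=> x; rewrite expR_ge0/= exiE ler_pdivrMr// mul1r.
      rewrite stepH// /lam (negbTE rr) HE//.
      have /andP[w0 w1] := wx x; move: X0 w0 w1 Dge M0.
      move: (h / l - 1) (p_psi th * l / (p_om th + s * arch th x + p_psi th * l)) => X w' X0 w0 w1 Dge' M0'.
      have g1 : 0 <= M * D * X * (1 - w').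
        by apply: mulr_ge0; [apply: mulr_ge0 => //; apply: mulr_ge0; [exact: ltW|move: Dge'; clear_after damping; lra]|rewrite subr_ge0].
      have g2 : 0 <= M * X by rewrite mulr_ge0// ltW.
      have g3 : 0 <= M * (D - 1) * (M * X).
        by apply: mulr_ge0 => //; apply: mulr_ge0; exact: ltW.
      by move: Dge' g1 g3; clear_after damping; lra.
  pose A := (1 + M * (D - 1)) / (H (s, l, h) * lam (s, l, h)).
  pose B := M * D * (h / l - 1) / (H (s, l, h) * lam (s, l, h)).
  pose W x := p_psi th * V0 / (arch th x + p_psi th * V0).
  have pV : 0 < p_psi th * V0 by rewrite mulr_gt0.
  have A0 : 0 <= A.
    by apply: divr_ge0; [apply: addr_ge0 => //; apply: mulr_ge0; exact: ltW|exact: ltW].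
  have B0 : 0 <= B by rewrite divr_ge0 ?(ltW HL).
  have W0 x : 0 <= W x by rewrite divr_ge0 ?(ltW pV)// addr_ge0 ?arch_ge0// ltW.
  have mW : measurable_fun [set: R] W by exact: damping_measurable.
  have := @sden_affine_mean R _ alI A B (1 - c) W A0 B0 mW W0 Wc.
  move=> AB; apply: (@le_trans _ _ (A + B * (1 - c))%:E).
    apply: le_trans AB; apply: (sden_le_mean alI).
    - by apply: (measurableT_comp (@measurable_expR R)); exact: (measurable_fun_pair2 (s, l, h) mxi).
    - by apply: measurable_funD => //; apply: measurable_funM.
    - by move=> x; rewrite expR_ge0.
    - by move=> x; rewrite addr_ge0// mulr_ge0.
    - move=> x _; rewrite exiE stepH//.
      have -> : A + B * W x = (1 + M * (D - 1) + M * D * (h / l - 1) * W x) /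
          (H (s, l, h) * lam (s, l, h)) by rewrite /A /B; ring.
      rewrite ler_pM2r ?invr_gt0//.
      rewrite lerD2l ler_wpM2l//.
      have lV : l < V0 * s by case/andP: rr.
      have C1 : 0 < p_om th + s * arch th x by rewrite ltr_wpDr// mulr_ge0 ?(ltW s0)// arch_ge0.
      have pl : 0 < p_psi th * l by rewrite mulr_gt0.
      have ax := arch_ge0 x thP.
      have den : 0 < arch th x + p_psi th * V0 by rewrite ltr_wpDl.
      have dn := addr_gt0 C1 pl; rewrite /W (ler_pdivrMr _ _ dn) mulrAC ler_pdivlMr//.
      rewrite -!mulrA ler_pM2l//.
      have k1 : l * arch th x <= V0 * s * arch th x by rewrite ler_wpM2r// ltW.
      have k2 : 0 < V0 * p_om th by rewrite mulr_gt0.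
      by move: k1 k2; clear_after damping; lra.
  rewrite lee_fin /A /B mulrAC -mulrDl ler_pdivrMr// mul1r /lam rr HE//.
  have Y4 : 4 <= c * (M * (h / l - 1)).
    have : 1 + C0 <= h / l by rewrite ler_pdivlMr//; case/andP: rr.
    move=> hl; have : M * C0 <= M * (h / l - 1) by rewrite ler_pM2l// lerBrDl.
    by rewrite MC ler_pdivrMr// mulrC.
  have Y0 : 0 <= M * (h / l - 1) by rewrite mulr_ge0// ltW.
  have -> : M * D * (h / l - 1) * (1 - c) = D * (M * (h / l - 1) * (1 - c)) by ring.
  move: (M * (h / l - 1)) Y4 Y0 => Y Y4 Y0.
  have k1 : (D - 1) * Y * (1 - c) <= c / 16 * Y.
    have : (D - 1) * (1 - c) <= c / 16.
      by have := mulr_ge0 (ltW Dge) (ltW c0); move: DM1 tc; clear_after damping; lra.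
    by move=> kk; rewrite mulrAC ler_wpM2r.
  have : D * (Y * (1 - c)) = (D - 1) * Y * (1 - c) + Y - c * Y by ring.
  move=> ->.
  have k3 : (1 - c / 4) * (1 + Y) = 1 + Y - c / 4 - (c * Y) / 4 by field.
  rewrite [leRHS]mulrC k3.
  have k4 : c / 16 * Y = (c * Y) / 16 by field.
  by move: k1; rewrite k4; move: Y4 DM2 tc c1; clear_after damping; lra.
have := @chain_exp_sum R d T P e f iid mf (fun x => ltW (fx0 x)) _ S F _ Z mF Z0 ZS xi mxi Hxi.
apply: filterS => w Hw.
have kc : 0 < kap * c / 16 by rewrite divr_gt0// mulr_gt0.
have {}Hw := Hw _ kc.
have big : \forall n \near \oo, 1 <= kap * c / 16 * n%:R.
  near=> n; rewrite -ler_pdivrMl// mulr1; near: n; exact: nbhs_infty_ger.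
near=> n.
have : \sum_(0 <= k < n) xi (Z k w, e k w) <= kap * c / 16 * n%:R by near: n.
have : 1 <= kap * c / 16 * n%:R by near: n.
have -> : \sum_(0 <= k < n) xi (Z k w, e k w) =
    ln (H (Z n w)) - ln (H (Z 0 w)) - \sum_(0 <= k < n) ln (lam (Z k w)).
  elim: (n) => [|m IHm]; first by rewrite !big_geq// !subrr.
  by rewrite !big_nat_recr//= IHm {1}/xi -ZS/=; ring.
have Hn : 0 <= ln (H (Z n w)) by apply: ln_ge0; have [? ? ?] := state n w; exact: Hge1.
have Hz : ln (H (Z 0 w)) <= 1.
  have l0 : 0 < (1 - dl) * p_om th by rewrite mulr_gt0.
  rewrite Z0 /= HE//.
  have E : (1 + dl) * p_om th / ((1 - dl) * p_om th) - 1 = D - 1.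
    by rewrite D1; field; rewrite !gt_eqF.
  have MD0 : 0 < M * (D - 1) by rewrite mulr_gt0.
  rewrite E; have h1 : -1 < M * (D - 1) by apply: lt_trans MD0; rewrite ltrN10.
  by have := le_ln1Dx h1; move: DM2 tc c1; clear_after damping; lra.
have lamS : \sum_(0 <= k < n) ln (lam (Z k w)) <=
    - (c / 4) * \sum_(0 <= k < n) (rare (Z k w))%:R + 4 * t * n%:R.
  have -> : 4 * t * n%:R = \sum_(0 <= k < n) (4 * t).
    by rewrite big_const_nat subn0 iter_addr addr0 mulr_natr.
  rewrite mulr_sumr -big_split/=; apply: ler_sum => k _; rewrite /lam; case: ifP => _.
    have h : -1 < - (c / 4) by move: lam1; clear_after damping; lra.
    by rewrite mulr1; have := le_ln1Dx h; move: t0; clear_after damping; lra.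
  rewrite mulr0 add0r.
  have l0 : 0 < D + M * (D - 1) by exact: lt_le_trans lam2.
  have h : -1 < D + M * (D - 1) - 1 by move: l0; clear_after damping; lra.
  by have := le_ln1Dx h; rewrite subrKC; move: DM; clear_after damping; lra.
rewrite -/(rare (Z _ w)) in lamS *.
set N := \sum_(0 <= k < n) _ in lamS *.
move: lamS Hz Hn; set a1 := ln _; set a2 := ln _; set a3 := \sum_(0 <= k < n) _ => lamS Hz Hn b1 b2.
have : c / 4 * N <= kap * c / 4 * n%:R.
  have tn : t * n%:R <= kap * c / 64 * n%:R by rewrite ler_wpM2r.
  by move: tn lamS Hz Hn b1 b2; clear_after damping; lra.
have -> : kap * c / 4 * n%:R = c / 4 * (kap * n%:R) by ring.
by rewrite ler_pM2l// divr_gt0.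
Unshelve. all: end_near. Qed.

End bracket.

(** * Likelihood gap *)

Section elementary.
Variable R : realType.
Local Notation mu := (@lebesgue_measure R).
Implicit Types l h u v s d tau t K r x q : R.

Lemma sqrt_ratio_close l h u v d : 0 < d < 1 -> 0 < l -> l <= u <= h -> l <= v <= h ->
  h < (1 + d) * l -> `|Num.sqrt (v / u) - 1| <= d.
Proof.
move=> /andP[d0 d1] l0 /andP[lu uh] /andP[lv vh] hl.
have u0 : 0 < u by exact: lt_le_trans lu.
have v0 : 0 < v by exact: lt_le_trans lv.
have k1 : v / u <= 1 + d by rewrite ler_pdivrMr//; nra.
have k2 : 1 <= (1 + d) * (v / u) by rewrite mulrA ler_pdivlMr//; nra.
have t2 := sqr_sqrtr (ltW (divr_gt0 v0 u0)); have t0 := sqrtr_ge0 (v / u).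
move: (Num.sqrt (v / u)) (v / u) k1 k2 t2 t0 => t y k1 k2 t2 t0.
rewrite ler_norml; apply/andP; split; first by nra.
by nra.
Qed.

Lemma sqrt_ratio_far s v tau : 0 < s -> 0 < v -> 0 < tau < 1 -> tau <= `|v / s - 1| ->
  Num.sqrt (s / v) <= 1 - tau / 4 \/ 1 + tau / 4 <= Num.sqrt (s / v).
Proof.
move=> s0 v0 /andP[ta0 ta1].
have p1 := mulfV (lt0r_neq0 s0); have p2 := mulfV (lt0r_neq0 v0).
have t2 := sqr_sqrtr (ltW (divr_gt0 s0 v0)); have t0 := sqrtr_ge0 (s / v).
have y1 : s / v * (v / s) = 1 by rewrite mulrA divfK ?gt_eqF// p1.
have y0 := divr_gt0 s0 v0.
move: (Num.sqrt (s / v)) (s / v) (v / s) t2 t0 y1 y0 => t y w t2 t0 y1 y0.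
have [w1|w1] := leP 0 (w - 1).
  rewrite ger0_norm// => tw; left; have : y * (1 + tau) <= 1 by nra.
  move=> ky; rewrite leNgt; apply/negP => lt.
  have : (1 - tau / 4) ^+ 2 < y by nra.
  nra.
rewrite ltr0_norm// => tw; right; have : 1 <= y * (1 - tau) \/ False by left; nra.
case=> // ky; rewrite leNgt; apply/negP => lt.
have : y < (1 + tau / 4) ^+ 2 by nra.
nra.
Qed.

Lemma int_le_of_bound (h B : R -> R) (G : R) : measurable_fun [set: R] h -> (forall x, 0 <= h x) ->
  mu.-integrable [set: R] (EFin \o B) -> (forall x, 0 <= B x) ->
  (forall x, x != 0 -> h x <= B x) -> \int[mu]_x B x <= G ->
  (\int[mu]_x (h x)%:E <= G%:E)%E.
Proof.
move=> mh h0 iB B0 hB BG.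
apply: (@le_trans _ _ (\int[mu]_x (B x)%:E)%E); last first.
  have -> : (\int[mu]_x (B x)%:E = (\int[mu]_x B x)%:E)%E.
    by rewrite /Rintegral fineK//; exact: integrable_fin_num iB.
  by rewrite lee_fin.
have mB : measurable_fun [set: R] B by exact: measurable_int_leb iB.
apply: ae_ge0_le_integral => //.
- by move=> x _; rewrite lee_fin.
- exact/measurable_EFinP.
- by move=> x _; rewrite lee_fin.
- exact/measurable_EFinP.
exists [set 0]; split; [exact: measurable_set1|exact: lebesgue_measure_set1|].
move=> x /= /not_implyP[_ /negP]; rewrite lee_fin -ltNge => lt.
by apply: contraPP lt => /eqP xn; apply/negP; rewrite -leNgt hB.
Qed.

End elementary.

Section envelope.
Variable R : realType.
Local Notation mu := (@lebesgue_measure R).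
Variables (al0 al a K eh d1 V0 K0 c tau J J1 : R).
Hypotheses (al0I : 0 < al0 < 2) (alI : 0 < al < 2) (aI : 0 < a <= 2^-1)
  (aal0 : a <= al0) (aal : a <= al / 2) (K_gt0 : 0 < K).
Hypothesis HK : forall be u, a <= be < 2 ->
  [/\ sden be u <= K, `|u| * sden be u <= K & u != 0 -> sden be u <= K * `|u| `^ (- (1 + a))].
Hypotheses (eh_gt0 : 0 < eh) (d1I : 0 < d1 < 2^-1).
Hypothesis Hd1 : forall be s u, `|be - al| <= d1 -> `|s - 1| <= d1 ->
  [/\ al / 2 <= be < 2 & u != 0 -> s * sden be (s * u) <= sden al u + eh ^+ 2 / `|u|].
Hypothesis JE : J = \int[mu]_x (sden al0 x `^ 2^-1 * `|x| `^ (- 2^-1)).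
Hypothesis J1E : J1 = \int[mu]_x (sden al0 x `^ 2^-1 * `|x| `^ (- ((1 - a / 2) / 2))).
Hypotheses (V0_gt0 : 0 < V0) (HV0 : (K * V0 `^ (- (a / 4))) `^ 2^-1 * J1 <= 2^-1).
Hypotheses (HK0 : K `^ 2^-1 * J <= K0).
Hypotheses (tauI : 0 < tau < 1) (cI : 0 < c <= 2^-1).
Hypothesis Hc : forall r, 0 < r -> al0 <> al \/ (r <= 1 - tau / 4 \/ 1 + tau / 4 <= r) ->
  affinity al0 al r <= 1 - c.

Definition gstate := (R * R * R * R)%type.
Implicit Types (u : gstate) (x s v l h : R).

Definition tight u := u.2 < (1 + d1) * u.1.2.
Definition lbig u := V0 * u.1.1.1 <= u.1.2.
Definition ident u := (al != al0) || (tau <= `|u.1.1.2 * u.1.1.1 `^ (-1) - 1|).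
Let rr u := (u.1.1.1 * u.1.1.2 `^ (-1)) `^ 2^-1.

Definition env (ux : gstate * R) : R :=
  if tight ux.1 then rr ux.1 * sden al (rr ux.1 * ux.2) + eh ^+ 2 * `|ux.2| `^ (-1)
  else if lbig ux.1 then K * V0 `^ (- (a / 4)) * `|ux.2| `^ (- (1 - a / 2))
  else K * `|ux.2| `^ (-1).

Definition gain u : R :=
  if tight u then (if ident u then 1 - c + eh * J else 1 + eh * J)
  else if lbig u then 2^-1 else K0 + 1.

Definition score (ux : gstate * R) : R :=
  ln ((env ux * sden al0 ux.2 `^ (-1)) `^ 2^-1 * (gain ux.1) `^ (-1)).

Let a_gt0 : 0 < a. Proof. by case/andP: aI. Qed.
Let al0_gt0 : 0 < al0. Proof. by case/andP: al0I. Qed.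
Let al_gt0 : 0 < al. Proof. by case/andP: alI. Qed.
Let f0_gt0 x : 0 < sden al0 x. Proof. exact: sden_gt0. Qed.
Let f_gt0 x : 0 < sden al x. Proof. exact: sden_gt0. Qed.
Let c_gt0 : 0 < c. Proof. by case/andP: cI. Qed.
Let c_le : c <= 2^-1. Proof. by case/andP: cI. Qed.
Let J_ge0 : 0 <= J.
Proof. by rewrite JE; apply: Rintegral_ge0 => x _; rewrite mulr_ge0 ?powR_ge0. Qed.
Let K0_ge0 : 0 <= K0.
Proof. by apply: le_trans HK0; rewrite mulr_ge0 ?powR_ge0. Qed.

Lemma gain_gt0 u : 0 < gain u.
Proof.
have h : 0 <= eh * J by rewrite mulr_ge0// ltW.
rewrite /gain; case: ifP => _; last by case: ifP => _; [rewrite invr_gt0|rewrite ltr_wpDl].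
by case: ifP => _; have := c_le; lra.
Qed.

Lemma env_gt0 s v l h x : 0 < s -> 0 < v -> x != 0 -> 0 < env ((s, v, l, h), x).
Proof.
move=> s0 v0 xn; have x0 : 0 < `|x| by rewrite normr_gt0.
rewrite /env /=; case: ifP => _; last by case: ifP => _; rewrite !mulr_gt0 ?powR_gt0.
have r0 : 0 < rr (s, v, l, h) by rewrite /rr/= powR_gt0// mulr_gt0// powR_gt0.
apply: addr_gt0; first by rewrite mulr_gt0.
by rewrite mulr_gt0 ?exprn_gt0 ?powR_gt0.
Qed.

Let ms : measurable_fun setT (fun u : gstate => u.1.1.1).
Proof. by apply: (measurableT_comp measurable_fst); apply: (measurableT_comp measurable_fst). Qed.
Let mv : measurable_fun setT (fun u : gstate => u.1.1.2).
Proof. by apply: (measurableT_comp measurable_snd); apply: (measurableT_comp measurable_fst). Qed.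
Let ml : measurable_fun setT (fun u : gstate => u.1.2).
Proof. by apply: (measurableT_comp measurable_snd). Qed.
Let mh : measurable_fun setT (fun u : gstate => u.2).
Proof. exact: measurable_snd. Qed.

Let mtight : measurable_fun setT tight.
Proof. by apply: measurable_fun_ltr => //; apply: measurable_funM. Qed.
Let mlbig : measurable_fun setT lbig.
Proof. by apply: measurable_fun_ler => //; apply: measurable_funM. Qed.

Lemma measurable_ident : measurable_fun setT ident.
Proof.
apply: measurable_or => //; apply: measurable_fun_ler => //.
apply: (measurableT_comp (@normr_measurable R setT)); apply: measurable_funB => //.
by apply: measurable_funM => //; apply: measurable_powRT.
Qed.

Let mrr : measurable_fun setT rr.
Proof. by apply: measurable_powRT; apply: measurable_funM => //; apply: measurable_powRT. Qed.

Let menv : measurable_fun setT env.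
Proof.
have mn : measurable_fun setT (fun ux : gstate * R => `|ux.2|).
  by apply: (measurableT_comp (@normr_measurable R setT)).
have mr : measurable_fun setT (fun ux : gstate * R => rr ux.1).
  exact: (measurableT_comp mrr measurable_fst).
apply: measurable_fun_ifT; first exact: (measurableT_comp mtight measurable_fst).
  apply: measurable_funD; last by apply: measurable_funM => //; exact: measurable_powRT.
  have msd : measurable_fun [set: R] (sden al) by exact: sden_measurable.
  apply: measurable_funM => //; apply: (measurableT_comp msd).
  by apply: measurable_funM.
apply: measurable_fun_ifT; first exact: (measurableT_comp mlbig measurable_fst).
  by apply: measurable_funM => //; exact: measurable_powRT.
by apply: measurable_funM => //; exact: measurable_powRT.
Qed.

Let mgain : measurable_fun setT gain.
Proof.
apply: measurable_fun_ifT => //; apply: measurable_fun_ifT => //.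
exact: measurable_ident.
Qed.

Lemma measurable_score : measurable_fun setT score.
Proof.
apply: measurable_lnT; apply: measurable_funM; apply: measurable_powRT; last first.
  exact: (measurableT_comp mgain measurable_fst).
apply: measurable_funM => //; apply: measurable_powRT.
have msd : measurable_fun [set: R] (sden al0) by exact: sden_measurable.
exact: (measurableT_comp msd measurable_snd).
Qed.

Lemma score_split s v l h x : 0 < s -> 0 < v -> x != 0 ->
  ln (env ((s, v, l, h), x)) - ln (sden al0 x) =
  2 * (score ((s, v, l, h), x) + ln (gain (s, v, l, h))).
Proof.
move=> s0 v0 xn; have e0 := env_gt0 l h s0 v0 xn; have g0 := gain_gt0 (s, v, l, h).
rewrite /score lnM ?posrE ?powR_gt0 ?mulr_gt0 ?powR_gt0//= ln_powR ln_powR.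
rewrite lnM ?posrE ?powR_gt0// ln_powR; by field.
Qed.

Lemma gain_le u : ln (gain u) <=
  - c * (ident u)%:R + eh * J + (K0 + 2) * (~~ tight u && ~~ lbig u)%:R.
Proof.
have h : 0 <= eh * J by rewrite mulr_ge0// ltW.
have g1 : -1 < gain u - 1 by have := gain_gt0 u; lra.
have := le_ln1Dx g1; rewrite subrKC => /le_trans; apply.
have cl := c_le; have k0 := K0_ge0; have cg := c_gt0; rewrite /gain.
have i1 : c * (ident u)%:R <= c by case: (ident u); rewrite ?mulr1 ?mulr0// ltW.
case: (tight u) => /=; last by case: (lbig u) => /=; rewrite ?mulr1 ?mulr0; lra.
by case: (ident u); rewrite ?mulr1 ?mulr0; lra.
Qed.

Lemma env_dominates (s v l h y be x : R) : 0 < s -> 0 < l -> l <= v <= h -> l <= y <= h ->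
  `|be - al| <= d1 -> x != 0 ->
  Num.sqrt (s / y) * sden be (Num.sqrt (s / y) * x) <= env ((s, v, l, h), x).
Proof.
move=> s0 l0 lv ly bed xn; have x0 : 0 < `|x| by rewrite normr_gt0.
have v0 : 0 < v by case/andP: lv => ? _; exact: lt_le_trans l0 _.
have y0 : 0 < y by case/andP: ly => ? _; exact: lt_le_trans l0 _.
have d1I' : 0 < d1 < 1 by case/andP: d1I => -> /=; lra.
have [beI _] := Hd1 (s := 1) 0 bed (ltac:(by rewrite subrr normr0; case/andP: d1I => /ltW)).
have be2 : a <= be < 2 by case/andP: beI => h1 ->; rewrite (le_trans aal).
have be0 : 0 < be < 2 by case/andP: be2 => h1 ->; rewrite (lt_le_trans a_gt0).
rewrite /env/=; case: ifP => [ti|_].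
  have rE : rr (s, v, l, h) = Num.sqrt (s / v).
    by rewrite /rr/= powR_inv1 ?(ltW v0)// powR12_sqrt// ltW// divr_gt0.
  have tc := sqrt_ratio_close d1I' l0 ly lv ti.
  have E : Num.sqrt (s / y) = Num.sqrt (v / y) * Num.sqrt (s / v).
    by rewrite -sqrtrM ?divr_ge0 ?(ltW v0) ?(ltW y0)//; congr Num.sqrt; field; rewrite !gt_eqF.
  have r0 : 0 < Num.sqrt (s / v) by rewrite sqrtr_gt0 divr_gt0.
  rewrite rE E; set r := Num.sqrt (s / v); set t := Num.sqrt (v / y).
  have rx : r * x != 0 by rewrite mulf_neq0// gt_eqF.
  have [_ /(_ rx) H] := Hd1 (r * x) bed tc.
  have := ler_wpM2l (ltW r0) H; rewrite -/r -/t mulrDr.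
  have -> : r * (eh ^+ 2 / `|r * x|) = eh ^+ 2 * `|x| `^ (-1).
    have rn : r != 0 by rewrite gt_eqF.
    by rewrite powR_inv1 ?(ltW x0)// normrM (gtr0_norm r0) invfM mulrCA (mulrA r) mulfV// mul1r.
  have -> : t * (r * x) = t * r * x by rewrite mulrA.
  by have -> : r * (t * sden be (t * r * x)) = t * r * sden be (t * r * x) by ring.
have r0 : 0 < Num.sqrt (s / y) by rewrite sqrtr_gt0 divr_gt0.
have [h1 h2 _] := HK (Num.sqrt (s / y) * x) be2.
set r := Num.sqrt (s / y) in r0 h1 h2 *.
have t0 : 0 < r * sden be (r * x) by rewrite mulr_gt0// sden_gt0.
have k1 : r * sden be (r * x) <= K * r by rewrite mulrC ler_pM2r.
have k2 : r * sden be (r * x) <= K * `|x| `^ (-1).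
  rewrite powR_inv1 ?(ltW x0)// ler_pdivlMr// mulrAC; move: h2.
  by rewrite normrM (gtr0_norm r0).
case: ifP => // lb.
have q01 : 0 <= a / 2 <= 1.
  by case/andP: aI => ? ?; rewrite divr_ge0 ?(ltW a_gt0)//=; lra.
apply: (le_trans (powR_interp K_gt0 r0 x0 t0 q01 k1 k2)).
rewrite mulrA ler_wpM2r ?powR_ge0// ler_pM2l//.
have sy : s / y <= V0^-1.
  rewrite ler_pdivrMr// ler_pdivlMl//.
  by case/andP: ly => ly _; apply: le_trans ly; exact: lb.
rewrite /r -powR12_sqrt ?divr_ge0 ?(ltW s0) ?(ltW y0)// -powRrM.
rewrite (_ : 2^-1 * (a / 2) = a / 4); last by field.
rewrite powRN.
have -> : (V0 `^ (a / 4))^-1 = V0^-1 `^ (a / 4).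
  by rewrite -[V0^-1](powR_inv1 (ltW V0_gt0)) -powRrM mulN1r powRN.
by apply: powR_le_base => //; rewrite ?divr_ge0 ?(ltW s0) ?(ltW y0) ?(ltW a_gt0).
Qed.

Let iJ : mu.-integrable [set: R] (EFin \o (fun x => sden al0 x `^ 2^-1 * `|x| `^ (- 2^-1))).
Proof. by apply: (@sden_power_integrable _ al0 a) => //; have := a_gt0; lra. Qed.

Let iJ1 : mu.-integrable [set: R]
  (EFin \o (fun x => sden al0 x `^ 2^-1 * `|x| `^ (- ((1 - a / 2) / 2)))).
Proof. by apply: (@sden_power_integrable _ al0 a) => //; have := a_gt0; lra. Qed.

Let half_env (k b x : R) : 0 <= k -> (k * `|x| `^ (- b) * sden al0 x) `^ 2^-1 =
  k `^ 2^-1 * (sden al0 x `^ 2^-1 * `|x| `^ (- (b / 2))).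
Proof.
move=> k0; rewrite !powRM ?mulr_ge0 ?powR_ge0 ?(ltW (f0_gt0 _))// -powRrM mulNr.
by rewrite -mulrA (mulrC (`|x| `^ _)).
Qed.

Lemma hellinger_bound s v l h : 0 < s -> 0 < v -> exists B : R -> R,
  [/\ mu.-integrable [set: R] (EFin \o B), forall x, 0 <= B x,
   forall x, (env ((s, v, l, h), x) * sden al0 x) `^ 2^-1 <= B x &
   \int[mu]_x B x <= gain (s, v, l, h)].
Proof.
move=> s0 v0.
have r0 : 0 < rr (s, v, l, h) by rewrite /rr/= powR_gt0// mulr_gt0// powR_gt0.
rewrite /env /gain /=; case: (tight (s, v, l, h)).
  set r := rr (s, v, l, h) in r0 *.
  have ih := affinity_integrable al0I alI r0.
  have iehJ := integrableZ_leb eh measurableT iJ.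
  exists (fun x => (sden al0 x * (r * sden al (r * x))) `^ 2^-1 +
                   eh * (sden al0 x `^ 2^-1 * `|x| `^ (- 2^-1))); split.
  - exact: integrableD_leb.
  - by move=> x; rewrite addr_ge0 ?mulr_ge0 ?powR_ge0// ltW.
  - move=> x; rewrite mulrDl; apply: (le_trans (powR_half_subadd _ _)).
    + by rewrite mulr_ge0 ?ltW// mulr_gt0.
    + by apply: mulr_ge0; [apply: mulr_ge0; [exact: sqr_ge0|exact: powR_ge0]|exact: ltW].
    rewrite (mulrC (sden al0 x) (r * _)) lerD2l half_env ?sqr_ge0//.
    rewrite -powR_mulrn ?(ltW eh_gt0)// -powRrM mulfV// powRr1 ?(ltW eh_gt0)//.
    by rewrite div1r.
  - rewrite RintegralD// RintegralZl// -JE -/(affinity al0 al r).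
    case: ifP => id; rewrite lerD2r; last exact: affinity_le1.
    apply: Hc => //.
    move/orP: id => [/eqP ne|far]; first by left=> E; apply: ne.
    right; have rE : r = Num.sqrt (s / v).
      by rewrite /r /rr/= powR_inv1 ?(ltW v0)// powR12_sqrt// ltW// divr_gt0.
    rewrite rE; apply: sqrt_ratio_far => //.
    by move: far; rewrite /= powR_inv1// ltW.
case: (lbig _).
  exists (fun x => (K * V0 `^ (- (a / 4))) `^ 2^-1 * (sden al0 x `^ 2^-1 * `|x| `^ (- ((1 - a / 2) / 2)))); split.
  - exact: integrableZ_leb.
  - by move=> x; rewrite !mulr_ge0 ?powR_ge0.
  - by move=> x; rewrite half_env// mulr_ge0 ?powR_ge0 ?(ltW K_gt0).
  - by rewrite RintegralZl// -J1E.
exists (fun x => K `^ 2^-1 * (sden al0 x `^ 2^-1 * `|x| `^ (- 2^-1))); split.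
- exact: integrableZ_leb.
- by move=> x; rewrite !mulr_ge0 ?powR_ge0.
- by move=> x; rewrite half_env ?(ltW K_gt0)// div1r.
- by rewrite RintegralZl// -JE (le_trans HK0)// lerDl.
Qed.

Lemma score_mean s v l h : 0 < s -> 0 < v ->
  (\int[mu]_x (expR (score ((s, v, l, h), x)) * sden al0 x)%:E <= 1)%E.
Proof.
move=> s0 v0; have [B [iB B0 hB BG]] := hellinger_bound l h s0 v0.
have g0 := gain_gt0 (s, v, l, h).
apply: (@int_le_of_bound _ _ (fun x => (gain (s, v, l, h))^-1 * B x) 1).
- apply: measurable_funM; last exact: sden_measurable.
  apply: (measurableT_comp (@measurable_expR R)).
  exact: (measurable_fun_pair2 (s, v, l, h) measurable_score).
- by move=> x; rewrite mulr_ge0 ?expR_ge0// ltW.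
- exact: integrableZ_leb.
- by move=> x; rewrite mulr_ge0// invr_ge0 ltW.
- move=> x xn; have e0 := env_gt0 l h s0 v0 xn.
  rewrite /score lnK; last first.
    by rewrite posrE mulr_gt0 ?powR_gt0// mulr_gt0// powR_gt0.
  rewrite /= (powR_inv1 (ltW g0)) mulrAC mulrC ler_pM2l ?invr_gt0//.
  apply: le_trans (hB x); rewrite le_eqVlt; apply/orP; left; apply/eqP.
  have fx := f0_gt0 x.
  have {2}-> : sden al0 x = (sden al0 x ^+ 2) `^ 2^-1.
    by rewrite -powR_mulrn ?(ltW fx)// -powRrM mulfV// powRr1// ltW.
  have E2 : env ((s, v, l, h), x) * sden al0 x `^ (-1) * sden al0 x ^+ 2 =
      env ((s, v, l, h), x) * sden al0 x.
    by rewrite powR_inv1 ?(ltW fx)//; field; rewrite gt_eqF.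
  transitivity ((env ((s, v, l, h), x) * sden al0 x `^ (-1) * sden al0 x ^+ 2) `^ 2^-1); last by rewrite E2.
  apply/esym/powRM; last exact: sqr_ge0.
  by rewrite mulr_ge0 ?powR_ge0 ?(ltW e0).
- by rewrite RintegralZl// mulrC ler_pdivrMr// mul1r.
Qed.

End envelope.

Definition pclose (R : realType) (dl : R) (th th' : param R) :=
  [/\ (1 - dl) * p_om th <= p_om th' <= (1 + dl) * p_om th,
      (1 - dl) * p_php th <= p_php th' <= (1 + dl) * p_php th,
      (1 - dl) * p_phm th <= p_phm th' <= (1 + dl) * p_phm th,
      (1 - dl) * p_psi th <= p_psi th' <= (1 + dl) * p_psi th &
      `|p_alpha th' - p_alpha th| <= dl].

Lemma ae_and (R : realType) (d : measure_display) (T : measurableType d) (P : probability T R)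
    (A B : T -> Prop) : {ae P, forall w, A w} -> {ae P, forall w, B w} ->
  {ae P, forall w, A w /\ B w}.
Proof. by move=> a b; apply: filterI. Qed.

Section gap_constants.
Variable R : realType.

Lemma large_ratio_threshold (K J1 a : R) : 0 < K -> 0 <= J1 -> 0 < a ->
  exists2 V0 : R, 0 < V0 & (K * V0 `^ (- (a / 4))) `^ 2^-1 * J1 <= 2^-1.
Proof.
move=> K0 J10 a0; have KH : 0 < K `^ 2^-1 by rewrite powR_gt0.
pose M := 2 * K `^ 2^-1 * J1 + 1.
have M0 : 0 < M by rewrite /M ltr_wpDl// !mulr_ge0// ltW.
exists (M `^ (8 / a)); first by rewrite powR_gt0.
rewrite -powRrM (_ : 8 / a * - (a / 4) = -1 * 2); last by field; rewrite gt_eqF.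
rewrite powRM ?powR_ge0 ?(ltW K0)// -powRrM (_ : -1 * 2 * 2^-1 = -1) ?powR_inv1 ?(ltW M0)//; last by field.
rewrite mulrAC ler_pdivrMr//.
have k0 : 0 <= K `^ 2^-1 * J1 by rewrite mulr_ge0// ltW.
by rewrite /M; lra.
Qed.

End gap_constants.

Section gap.
Context (R : realType) (d : measure_display) (T : measurableType d) (P : probability T R).
Local Notation mu := (@lebesgue_measure R).
Variables (e : nat -> T -> R) (th0 : param R) (z : R).
Hypotheses (th0P : param_pos th0) (z0 : p_om th0 <= z)
  (iid : iid_density P e (sden (p_alpha th0))).
Let f := sden (p_alpha th0).
Let al0I : 0 < p_alpha th0 < 2. Proof. by case: th0P. Qed.
Let sv n w := svol th0 z (fun k => e k w) n.
Let fv th n w := fvol th0 z (fun k => e k w) th n.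
Variable th : param R.
Hypothesis thP : param_pos th.
Let alI : 0 < p_alpha th < 2. Proof. by case: thP. Qed.

Let lo_le_hi dl th' n w : 0 < dl < 1 -> param_pos th' -> pclose dl th th' ->
  fv (pscale (1 - dl) th) n w <= fv th' n w <= fv (pscale (1 + dl) th) n w.
Proof.
move=> /andP[dl0 dl1] th'P [/andP[a1 a2] /andP[b1 b2] /andP[c1 c2] /andP[d1 d2] _].
have loP : param_pos (pscale (1 - dl) th) by apply: pscale_pos => //; rewrite subr_gt0.
by apply/andP; split; apply: fvol_mono.
Qed.

Let pclose_refl dl : 0 < dl -> pclose dl th th.
Proof.
move=> dl0; have Q a : 0 < a -> (1 - dl) * a <= a <= (1 + dl) * a.
  by move=> a0; rewrite ler_piMl ?ler_peMl ?(ltW a0)//; lra.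
by case: thP => q1 q2 q3 q4 _; split; rewrite ?Q// subrr normr0 ltW.
Qed.

Lemma likelihood_gap (tau p : R) : 0 < tau < 1 -> 0 < p ->
  {ae P, forall w, \forall n \near \oo, p * n%:R <= \sum_(0 <= k < n)
     ((p_alpha th != p_alpha th0) || (tau <= `|fv th k w / sv k w - 1|))%:R} ->
  exists2 dl : R, 0 < dl < 1 & exists2 c : R, 0 < c &
  {ae P, forall w, \forall n \near \oo, forall th', param_pos th' -> pclose dl th th' ->
    \sum_(0 <= k < n) (lterm th0 z (fun k => e k w) th' k - ln (f (e k w))) <= - c * n%:R}.
Proof.
move=> tauI p0 freq.
pose al0 := p_alpha th0; pose al := p_alpha th.
have al0_gt0 : 0 < al0 by case/andP: al0I.
have al_gt0 : 0 < al by case/andP: alI.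
pose a := Num.min (Num.min 2^-1 al0) (al / 2).
have a0 : 0 < a by rewrite !lt_min invr_gt0 ltr0n al0_gt0 divr_gt0.
have a1 : a <= 2^-1 by rewrite !ge_min lexx.
have aal0 : a <= al0 by rewrite !ge_min lexx orbT.
have aal : a <= al / 2 by rewrite !ge_min lexx !orbT.
have aI : 0 < a <= 2^-1 by rewrite a0.
have [K K_gt0 HK] := sden_bounds aI.
have t4 : 0 < tau / 4 < 1 by case/andP: tauI => ? ?; apply/andP; split; lra.
have [c1 c10 Hc1] := @affinity_gap R al0 al al0I alI
  (fun r => al0 <> al \/ (r <= 1 - tau / 4 \/ 1 + tau / 4 <= r)) (tau / 4) t4 (fun r _ h => h).
pose c := Num.min c1 2^-1.
have cI : 0 < c <= 2^-1 by rewrite lt_min c10 invr_gt0 ltr0n ge_min lexx orbT.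
have c_gt0 : 0 < c by case/andP: cI.
have Hc r : 0 < r -> al0 <> al \/ (r <= 1 - tau / 4 \/ 1 + tau / 4 <= r) ->
    affinity al0 al r <= 1 - c.
  by move=> r0 h; apply: (le_trans (Hc1 r r0 h)); rewrite lerD2l lerN2 ge_min lexx.
have [J JE] : exists J : R, J = \int[mu]_x (sden al0 x `^ 2^-1 * `|x| `^ (- 2^-1)) by eexists.
have [J1 J1E] : exists J : R, J = \int[mu]_x (sden al0 x `^ 2^-1 * `|x| `^ (- ((1 - a / 2) / 2))) by eexists; reflexivity.
have J0 : 0 <= J by rewrite JE; apply: Rintegral_ge0 => x _; rewrite mulr_ge0 ?powR_ge0.
have J10 : 0 <= J1 by rewrite J1E; apply: Rintegral_ge0 => x _; rewrite mulr_ge0 ?powR_ge0.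
pose eh := c * p / (8 * (J + 1)).
have J11 : 0 < 8 * (J + 1) by rewrite mulr_gt0// ltr_wpDl.
have eh_gt0 : 0 < eh by rewrite divr_gt0// mulr_gt0.
have ehJ : eh * J <= c * p / 8.
  have -> : eh * J = c * p / 8 * (J / (J + 1)).
    by rewrite /eh; field; rewrite gt_eqF// ltr_wpDl.
  by rewrite ler_piMr// ?divr_ge0 ?mulr_ge0 ?(ltW c_gt0) ?(ltW p0)// ler_pdivrMr ?ltr_wpDl// mul1r lerDl.
have [d1 d1I Hd1] := sden_index_scale_continuous alI (exprn_gt0 2 eh_gt0).
have [V0 V0_gt0 HV0] := large_ratio_threshold K_gt0 J10 a0.
pose K0 := K `^ 2^-1 * J.
have K0_ge0 : 0 <= K0 by rewrite mulr_ge0 ?powR_ge0.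
have HK0 : K `^ 2^-1 * J <= K0 by [].
pose kap := c * p / (8 * (K0 + 2)).
have K02 : 0 < K0 + 2 by rewrite ltr_wpDl.
have kap0 : 0 < kap by rewrite divr_gt0 ?mulr_gt0.
have kapK : (K0 + 2) * kap = c * p / 8 by rewrite /kap; field; rewrite gt_eqF.
have d10 : 0 < d1 by case/andP: d1I.
have [dl [dl0 dld1 dl1 rare]] := bracket_rare th0P z0 iid thP d10 V0_gt0 kap0 d10.
have dlI : 0 < dl < 1 by rewrite dl0.
exists dl => //; exists (c * p); first by rewrite mulr_gt0.
pose lo := pscale (1 - dl) th; pose hi := pscale (1 + dl) th.
have loP : param_pos lo by apply: pscale_pos => //; rewrite subr_gt0.
pose F (u : gstate R * R) : gstate R :=
  (p_om th0 + u.1.1.1.1 * (arch th0 u.2 + p_psi th0),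
   p_om th + u.1.1.1.1 * arch th u.2 + p_psi th * u.1.1.1.2,
   p_om lo + u.1.1.1.1 * arch lo u.2 + p_psi lo * u.1.1.2,
   p_om hi + u.1.1.1.1 * arch hi u.2 + p_psi hi * u.1.2).
pose Z n w : gstate R := (sv n w, fv th n w, fv lo n w, fv hi n w).
have Z0 w : Z 0 w = (z, p_om th, p_om lo, p_om hi) by [].
have ZS n w : Z n.+1 w = F (Z n w, e n w) by [].
have m1 : measurable_fun setT (fun u : gstate R * R => u.1.1.1.1).
  by do 3 apply: (measurableT_comp measurable_fst).
have m2 : measurable_fun setT (fun u : gstate R * R => u.1.1.1.2).
  by apply: (measurableT_comp measurable_snd); do 2 apply: (measurableT_comp measurable_fst).
have m3 : measurable_fun setT (fun u : gstate R * R => u.1.1.2).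
  by apply: (measurableT_comp measurable_snd); apply: (measurableT_comp measurable_fst).
have m4 : measurable_fun setT (fun u : gstate R * R => u.1.2).
  by apply: (measurableT_comp measurable_snd).
have ma t : measurable_fun setT (fun u : gstate R * R => arch t u.2) by apply: measurable_archT.
have mupd t (g : gstate R * R -> R) : measurable_fun setT g ->
    measurable_fun setT (fun u : gstate R * R => p_om t + u.1.1.1.1 * arch t u.2 + p_psi t * g u).
  move=> mg; apply: measurable_funD; last exact: measurable_funM.
  by apply: measurable_funD => //; apply: measurable_funM.
have mF : measurable_fun setT F.
  apply: measurable_fun_pair; first apply: measurable_fun_pair; first apply: measurable_fun_pair.
  - by apply: measurable_funD => //; apply: measurable_funM => //; apply: measurable_funD.
  - exact: mupd.
  - exact: mupd.
  - exact: mupd.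
have s0 n w : 0 < sv n w by exact: svol_gt0.
have v0 t n w : param_pos t -> 0 < fv t n w by exact: fvol_gt0.
pose xi := score al0 al a K eh d1 V0 K0 c tau J.
have mxi : measurable_fun setT xi by exact: measurable_score.
have mean n w : (\int[mu]_x (expR (xi (Z n w, x)) * f x)%:E <= 1)%E.
  by eapply (@score_mean R al0 al a K eh d1 V0 K0 c tau J J1); try eassumption; rewrite ?v0.
have fx0 x : 0 < f x by exact: sden_gt0.
have mf : measurable_fun [set: R] f by exact: sden_measurable.
have xs := @chain_exp_sum R d T P e f iid mf (fun x => ltW (fx0 x)) _ (gstate R) F _ Z mF Z0 ZS xi mxi mean.
have := ae_and (ae_and xs freq) (ae_and rare (innovation_neq0 iid)).
apply: filterS => w [[xw fw] [rw nw]].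
have cp8 : 0 < c * p / 8 by rewrite divr_gt0 ?mulr_gt0.
have {}xw := xw _ cp8.
near=> n => th' th'P cl.
have h1 : \sum_(0 <= k < n) xi (Z k w, e k w) <= c * p / 8 * n%:R by near: n.
have h2 : p * n%:R <= \sum_(0 <= k < n)
     ((p_alpha th != p_alpha th0) || (tau <= `|fv th k w / sv k w - 1|))%:R by near: n.
have h3 : \sum_(0 <= k < n) (((1 + d1) * fv lo k w <= fv hi k w)
       && (fv lo k w < V0 * sv k w))%:R <= kap * n%:R by near: n.
pose G k := ln (gain al0 al eh d1 V0 K0 c tau J (Z k w)).
have t1 : \sum_(0 <= k < n) (lterm th0 z (fun k => e k w) th' k - ln (f (e k w))) <=
    \sum_(0 <= k < n) 2 * (xi (Z k w, e k w) + G k).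
  apply: ler_sum => k _.
  have <- : ln (env al a K eh d1 V0 (Z k w, e k w)) - ln (f (e k w)) = 2 * (xi (Z k w, e k w) + G k).
    by eapply score_split; try eassumption; rewrite ?v0.
  rewrite lerD2r /lterm.
  have r0 : 0 < Num.sqrt (sv k w / fv th' k w) by rewrite sqrtr_gt0 divr_gt0// v0.
  have th'I : 0 < p_alpha th' < 2 by case: th'P.
  rewrite ler_ln ?posrE ?mulr_gt0 ?sden_gt0//; last first.
    by eapply env_gt0; try eassumption; rewrite ?v0.
  have k1 : fv lo k w <= fv th k w <= fv hi k w by apply: lo_le_hi => //; exact: pclose_refl.
  have k2 : fv lo k w <= fv th' k w <= fv hi k w by exact: lo_le_hi.
  have k3 : `|p_alpha th' - al| <= d1 by case: cl => _ _ _ _ /le_trans; apply.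
  by eapply env_dominates; try eassumption; rewrite ?v0.
have t2 : \sum_(0 <= k < n) G k <= - c * (p * n%:R) + c * p / 8 * n%:R + c * p / 8 * n%:R.
  apply: (@le_trans _ _ (\sum_(0 <= k < n) (- c * ((p_alpha th != p_alpha th0) ||
     (tau <= `|fv th k w / sv k w - 1|))%:R + eh * J + (K0 + 2) * (((1 + d1) * fv lo k w <= fv hi k w)
       && (fv lo k w < V0 * sv k w))%:R))).
    apply: ler_sum => k _.
    have gl : G k <= - c * (ident al0 al tau (Z k w))%:R + eh * J +
        (K0 + 2) * (~~ tight d1 (Z k w) && ~~ lbig V0 (Z k w))%:R.
      by eapply gain_le; try eassumption.
    apply: (le_trans gl).
    by rewrite /ident /tight /lbig /Z/= powR_inv1 ?(ltW (s0 _ _))// -leNgt -ltNge.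
  rewrite !big_split/= -!mulr_sumr; apply: lerD; first apply: lerD.
  - by rewrite !mulNr lerN2 ler_pM2l.
  - rewrite big_const_nat subn0 iter_addr addr0.
    have -> : eh * (J *+ n) = eh * J * n%:R by rewrite -(mulr_natr J) mulrA.
    exact: ler_wpM2r.
  - by rewrite -kapK -mulrA ler_pM2l.
apply: (le_trans t1); rewrite -mulr_sumr big_split/=.
have np : 0 <= c * p * n%:R by rewrite !mulr_ge0// ltW.
move: h1 t2 np; set A := \sum_(0 <= k < n) _; set B := \sum_(0 <= k < n) _.
rewrite (mulrA (- c)) !mulNr; move: A B => A B.
rewrite (mulrAC (c * p)); by move: (c * p * n%:R) => X; clear_after pclose_refl; lra.
Unshelve. all: end_near. Qed.

End gap.

(** * Identification *)

Section step_algebra.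
Variable R : realType.
Implicit Types th : param R.

(* If the filtered and the true volatility agree up to a factor [tau] before and after a step,
   the two recursions nearly agree at that step. *)
Lemma close_step th0 th (tau s v x : R) : 0 < s -> 0 < v -> 0 < tau ->
  param_pos th0 -> param_pos th ->
  let s' := p_om th0 + s * a_fun th0 x in
  let v' := p_om th + s * arch th x + p_psi th * v in
  `|v / s - 1| < tau -> `|v' / s' - 1| < tau ->
  `|p_om th - p_om th0 + s * (arch th x - arch th0 x + (p_psi th - p_psi th0))| <
  tau * (p_om th0 + s * (a_fun th0 x + p_psi th)).
Proof.
move=> s0 v0 ta0 th0P thP s' v' h1 h2.
have om0 : 0 < p_om th0 by case: th0P.
have ps0 : 0 < p_psi th by case: thP.
have s'0 : 0 < s'.
  by rewrite ltr_wpDr// mulr_ge0 ?(ltW s0)// a_funE addr_ge0 ?arch_ge0//; case: th0P => _ _ _ /ltW.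
have k1 : `|v - s| < tau * s.
  have -> : v - s = (v / s - 1) * s by field; rewrite gt_eqF.
  by rewrite normrM (gtr0_norm s0) ltr_pM2r.
have k2 : `|v' - s'| < tau * s'.
  have -> : v' - s' = (v' / s' - 1) * s' by field; rewrite gt_eqF.
  by rewrite normrM (gtr0_norm s'0) ltr_pM2r.
have -> : p_om th - p_om th0 + s * (arch th x - arch th0 x + (p_psi th - p_psi th0)) =
   (v' - s') - p_psi th * (v - s) by rewrite /v' /s' a_funE; ring.
apply: (le_lt_trans (ler_normB _ _)).
have -> : tau * (p_om th0 + s * (a_fun th0 x + p_psi th)) = tau * s' + p_psi th * (tau * s).
  by rewrite /s'; ring.
by rewrite ltrD// normrM (gtr0_norm ps0) ltr_pM2l.
Qed.

End step_algebra.

Section frequency.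
Variable R : realType.

Lemma count_succE (q : nat -> bool) n :
  (q 0%N)%:R + \sum_(0 <= k < n) (q k.+1)%:R = \sum_(0 <= k < n) (q k)%:R + (q n)%:R :> R.
Proof.
elim: n => [|n IH]; first by rewrite !big_geq// addr0 add0r.
by rewrite !big_nat_recr//= addrA IH.
Qed.

Lemma count_succ (q : nat -> bool) n :
  \sum_(0 <= k < n) (q k.+1)%:R <= \sum_(0 <= k < n) (q k)%:R + 1 :> R.
Proof.
apply: (@le_trans _ _ ((q 0%N)%:R + \sum_(0 <= k < n) (q k.+1)%:R)); first by rewrite lerDr.
by rewrite count_succE lerD2l lern1 leq_b1.
Qed.

Lemma count_pred (q : nat -> bool) n :
  \sum_(0 <= k < n) (q k)%:R <= \sum_(0 <= k < n) (q k.+1)%:R + 1 :> R.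
Proof.
apply: (@le_trans _ _ (\sum_(0 <= k < n) (q k)%:R + (q n)%:R)); first by rewrite lerDl.
by rewrite -count_succE addrC lerD2l lern1 leq_b1.
Qed.

Lemma freq_from_window (q I : nat -> bool) (c : R) : 0 < c ->
  (forall k, q k -> I k || I k.+1 || I k.+2) ->
  (\forall n \near \oo, c * n%:R <= \sum_(0 <= k < n) (q k)%:R) ->
  \forall n \near \oo, c / 6 * n%:R <= \sum_(0 <= k < n) (I k)%:R.
Proof.
move=> c0 qI Hq.
have big : \forall n \near \oo, 3 <= c / 2 * n%:R.
  have c2 : 0 < c / 2 by rewrite divr_gt0.
  by near=> n; rewrite -ler_pdivrMl// mulrC; near: n; exact: nbhs_infty_ger.
near=> n.
have h1 : c * n%:R <= \sum_(0 <= k < n) (q k)%:R by near: n.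
have h2 : 3 <= c / 2 * n%:R by near: n.
have h3 : \sum_(0 <= k < n) (q k)%:R <= \sum_(0 <= k < n) (I k)%:R +
   \sum_(0 <= k < n) (I k.+1)%:R + \sum_(0 <= k < n) (I k.+2)%:R :> R.
  rewrite -!big_split/=; apply: ler_sum => k _.
  have := qI k; case: (q k) => [/(_ isT)|_]; last by rewrite !addr_ge0.
  case: (I k) (I k.+1) (I k.+2) => [] [] [] //= _; rewrite ?addr0 ?add0r//; lra.
have h4 := count_succ I n; have h5 := count_succ (fun k => I k.+1) n.
lra.
Unshelve. all: end_near. Qed.

End frequency.

Section identification.
Context (R : realType) (d : measure_display) (T : measurableType d) (P : probability T R).
Variables (e : nat -> T -> R) (th0 : param R) (z : R).
Hypotheses (th0P : param_pos th0) (z0 : p_om th0 <= z)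
  (iid : iid_density P e (sden (p_alpha th0))).
Let alI : 0 < p_alpha th0 < 2. Proof. by case: th0P. Qed.
Let sv n w := svol th0 z (fun k => e k w) n.
Let fv th n w := fvol th0 z (fun k => e k w) th n.

Let prev n w : R := if n is n'.+1 then e n' w else 0.
Let mfst : measurable_fun [set: R * R] (fun u : R * R => u.2). Proof. exact: measurable_snd. Qed.

Let mitv (a b : R) : measurable_fun [set: R] (fun x : R => a <= x <= b).
Proof. by apply: measurable_and; apply: measurable_fun_ler. Qed.

Let sum_true n : \sum_(0 <= k < n) (true%:R : R) = n%:R.
Proof. by rewrite big_const_nat subn0 iter_addr addr0. Qed.

Lemma itv_freq (a b : R) : a < b -> exists2 c : R, 0 < c &
  {ae P, forall w, \forall n \near \oo, c * n%:R <= \sum_(0 <= k < n) (a <= e k w <= b)%R%:R}.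
Proof.
move=> ab; have [c cI Hc] := sden_itv_mean alI ab; have c0 : 0 < c by case/andP: cI.
have c2 : 0 < c / 2 by rewrite divr_gt0.
exists (c / 2) => //.
have := @chain_count R d T P e _ alI iid _ R (fun u => u.2) 0 prev mfst (fun _ => erefl)
  (fun _ _ => erefl) (fun _ => true) (fun x => a <= x <= b) c (@measurable_cst _ _ _ _ setT true) (mitv a b) cI Hc.
apply: filterS => w Hw; apply: filterS (Hw _ c2) => n.
by rewrite sum_true/= => h; lra.
Qed.

Lemma itv_pair_freq (a b : R) : a < b -> exists2 c : R, 0 < c &
  {ae P, forall w, \forall n \near \oo,
     c * n%:R <= \sum_(0 <= k < n) ((a <= e k w <= b) && (a <= e k.+1 w <= b))%R%:R}.
Proof.
move=> ab; have [c cI Hc] := sden_itv_mean alI ab; have c0 : 0 < c by case/andP: cI.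
have [c' c'0 H'] := itv_freq ab.
have e0 : 0 < c * c' / 4 by rewrite divr_gt0// mulr_gt0.
exists (c * c' / 4) => //.
have := @chain_count R d T P e _ alI iid _ R (fun u => u.2) 0 prev mfst (fun _ => erefl)
  (fun _ _ => erefl) (fun x => a <= x <= b) (fun x => a <= x <= b) c (mitv a b) (mitv a b) cI Hc.
move=> /(ae_and H'); apply: filterS => w [fw] /(_ _ e0) Hw.
have big : \forall n \near \oo, 2 <= c * c' / 4 * n%:R.
  by near=> n; rewrite -ler_pdivrMl// mulrC; near: n; exact: nbhs_infty_ger.
near=> n.
have h1 : c' * n%:R <= \sum_(0 <= k < n) (a <= e k w <= b)%R%:R by near: n.
have h2 : c * (\sum_(0 <= k < n) (a <= prev k w <= b)%R%:R) <=
    \sum_(0 <= k < n) ((a <= prev k w <= b) && (a <= e k w <= b))%R%:R + c * c' / 4 * n%:R by near: n.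
have h3 : 2 <= c * c' / 4 * n%:R by near: n.
have h4 : \sum_(0 <= k < n) (a <= e k w <= b)%R%:R <= \sum_(0 <= k < n) (a <= prev k w <= b)%R%:R + 1 :> R.
  exact: (@count_succ R (fun k => a <= prev k w <= b) n).
have h5 : \sum_(0 <= k < n) ((a <= prev k w <= b) && (a <= e k w <= b))%R%:R <=
   \sum_(0 <= k < n) ((a <= e k w <= b) && (a <= e k.+1 w <= b))%R%:R + 1 :> R.
  exact: (@count_pred R (fun k => (a <= prev k w <= b) && (a <= e k w <= b)) n).
have h6 : c * (c' * n%:R) <= c * \sum_(0 <= k < n) (a <= prev k w <= b)%R%:R + 1.
  have : c * (c' * n%:R) <= c * (\sum_(0 <= k < n) (a <= prev k w <= b)%R%:R + 1).
    by rewrite ler_pM2l//; apply: le_trans h4.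
  by case/andP: cI => _ c1; move: (\sum_(0 <= k < n) _) => S; lra.
move: h2 h3 h5 h6; rewrite mulrA (mulrAC (c * c')); move: (c * c' * n%:R) (c * _) => X Y.
move: (\sum_(0 <= k < n) _) (\sum_(0 <= k < n) _) => A B; lra.
Unshelve. all: end_near. Qed.

Variable th : param R.
Hypothesis thP : param_pos th.
Let I tau k w := tau <= `|fv th k w / sv k w - 1|.

Let s0 k w : 0 < sv k w. Proof. exact: svol_gt0. Qed.
Let v0 k w : 0 < fv th k w. Proof. exact: fvol_gt0. Qed.

Let step tau k w : 0 < tau -> ~~ I tau k w -> ~~ I tau k.+1 w ->
  `|p_om th - p_om th0 + sv k w * (arch th (e k w) - arch th0 (e k w) + (p_psi th - p_psi th0))| <
  tau * (p_om th0 + sv k w * (a_fun th0 (e k w) + p_psi th)).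
Proof.
move=> ta0; rewrite /I -!ltNge => h1 h2.
exact: (close_step (s0 k w) (v0 k w) ta0 th0P thP h1 h2).
Qed.

Definition identified := exists tau p : R, [/\ 0 < tau < 1, 0 < p &
  {ae P, forall w, \forall n \near \oo, p * n%:R <= \sum_(0 <= k < n) (I tau k w)%:R}].

(* [D] is the size of the drift produced by an innovation in [a, b], where the ARCH
   coefficients differ by at least [D] after the other discrepancies are paid for. *)
Let ident_drift (a b M : R) : a < b -> 0 < M ->
  (forall x, a <= x <= b -> a_fun th0 x <= M) ->
  (forall x, a <= x <= b -> 1 + `|p_om th - p_om th0| / p_om th0 + `|p_psi th - p_psi th0| <=
     `|arch th x - arch th0 x|) -> identified.
Proof.
move=> ab M0 HM HD.
have om0 : 0 < p_om th0 by case: th0P.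
have ps0 : 0 < p_psi th by case: thP.
have [c c0 Hc] := itv_freq ab.
pose tau := (2 + M + p_psi th)^-1.
have den : 1 < 2 + M + p_psi th by lra.
have den0 : 0 < 2 + M + p_psi th by lra.
have ta0 : 0 < tau by rewrite invr_gt0.
have taM : tau * (2 + M + p_psi th) = 1 by rewrite mulVf// gt_eqF.
exists tau, (c / 6); split; [by rewrite ta0 invf_lt1|by rewrite divr_gt0|].
apply: filterS Hc => w Hw; apply: freq_from_window Hw => // k kI.
apply: contraT; rewrite !negb_or => /andP[/andP[n1 n2] _].
have := step ta0 n1 n2; have := HD _ kI; have := HM _ kI.
have so : p_om th0 <= sv k w by exact: svol_ge_om.
have := s0 k w; move: (sv k w) so => s so ss.
move: (arch th (e k w) - arch th0 (e k w)) (a_fun th0 (e k w)) => A aa haa hA.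
have omE : `|p_om th - p_om th0| <= `|p_om th - p_om th0| / p_om th0 * s.
  by rewrite mulrAC ler_pdivlMr// ler_wpM2l.
move: (p_om th - p_om th0) (p_psi th - p_psi th0) (`|p_om th - p_om th0| / p_om th0) hA omE => Om Ps q hA omE.
have k1 : s <= `|Om + s * (A + Ps)|.
  have : `|s * A| <= `|Om + s * (A + Ps)| + `|Om| + `|s * Ps|.
    have -> : s * A = (Om + s * (A + Ps)) - Om - s * Ps by ring.
    by apply: (le_trans (ler_normB _ _)); rewrite lerD2r ler_normB.
  rewrite !normrM (gtr0_norm ss).
  have : s * (1 + q + `|Ps|) <= s * `|A| by rewrite ler_pM2l.
  lra.
have k2 : tau * (p_om th0 + s * (aa + p_psi th)) <= tau * (s * (2 + M + p_psi th)).
  rewrite ler_pM2l//.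
  have : s * aa <= s * M by rewrite ler_pM2l.
  lra.
have k3 : tau * (s * (2 + M + p_psi th)) = s by rewrite mulrCA taM mulr1.
by move=> lt; have := lt_le_trans (le_lt_trans k1 lt) k2; rewrite k3 ltxx.
Qed.

Let a_fun_pos x : 0 <= x -> a_fun th0 x = p_php th0 * x ^+ 2 + p_psi th0.
Proof. by move=> x0; have [pE nE] := posp_ge0E x0; rewrite a_funE /arch pE nE expr0n/= mulr0 addr0. Qed.

Lemma ident_php : p_php th != p_php th0 -> identified.
Proof.
move=> ne; have dp : 0 < `|p_php th - p_php th0| by rewrite normr_gt0 subr_eq0.
have om0 : 0 < p_om th0 by case: th0P.
have [ph0 ps0] : 0 < p_php th0 /\ 0 < p_psi th0 by case: th0P.
pose q := 1 + `|p_om th - p_om th0| / p_om th0 + `|p_psi th - p_psi th0|.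
have q0 : 0 <= q by rewrite !addr_ge0// divr_ge0// ltW.
pose B := 1 + q / `|p_php th - p_php th0|.
have B1 : 1 <= B by rewrite lerDl divr_ge0// ltW.
have dB : q <= `|p_php th - p_php th0| * B by rewrite /B mulrDr mulr1 mulrCA mulfV ?gt_eqF// mulr1 lerDr ltW.
apply: (@ident_drift B (B + 1) (p_php th0 * (B + 1) ^+ 2 + p_psi th0)).
- by lra.
- by rewrite addr_gt0// mulr_gt0// exprn_gt0//; lra.
- move=> x /andP[x1 x2]; rewrite a_fun_pos; last by lra.
  by rewrite lerD2r ler_pM2l// lerXn2r// nnegrE; lra.
- move=> x /andP[x1 x2]; have x0 : 0 <= x by lra.
  have [pE nE] := posp_ge0E x0; rewrite /arch pE nE expr0n/= !mulr0 !addr0 -mulrBl normrM.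
  apply: (le_trans dB); rewrite ler_pM2l// ger0_norm ?sqr_ge0//; nra.
Qed.

Lemma ident_phm : p_phm th != p_phm th0 -> identified.
Proof.
move=> ne; have dp : 0 < `|p_phm th - p_phm th0| by rewrite normr_gt0 subr_eq0.
have om0 : 0 < p_om th0 by case: th0P.
have [ph0 ps0] : 0 < p_phm th0 /\ 0 < p_psi th0 by case: th0P.
pose q := 1 + `|p_om th - p_om th0| / p_om th0 + `|p_psi th - p_psi th0|.
have q0 : 0 <= q by rewrite !addr_ge0// divr_ge0// ltW.
pose B := 1 + q / `|p_phm th - p_phm th0|.
have B1 : 1 <= B by rewrite lerDl divr_ge0// ltW.
have dB : q <= `|p_phm th - p_phm th0| * B by rewrite /B mulrDr mulr1 mulrCA mulfV ?gt_eqF// mulr1 lerDr ltW.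
apply: (@ident_drift (- (B + 1)) (- B) (p_phm th0 * (B + 1) ^+ 2 + p_psi th0)).
- by lra.
- by rewrite addr_gt0// mulr_gt0// exprn_gt0//; lra.
- move=> x /andP[x1 x2]; have x0 : x <= 0 by lra.
  have [pE nE] := posp_le0E x0; rewrite a_funE /arch pE nE expr0n/= mulr0 add0r.
  have y0 : 0 <= - x by lra.
  have y1 : - x <= B + 1 by lra.
  by rewrite lerD2r ler_pM2l//; move: (- x) y0 y1 => y y0 y1; nra.
- move=> x /andP[x1 x2]; have x0 : x <= 0 by lra.
  have [pE nE] := posp_le0E x0; rewrite /arch pE nE expr0n/= !mulr0 !add0r -mulrBl normrM.
  apply: (le_trans dB); rewrite ler_pM2l// ger0_norm ?sqr_ge0//; nra.
Qed.

(* Two successive innovations at which the true volatility grows at least threefold cannot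
   both match a drift in [omega] compensating a drift in [psi]. *)
Lemma ident_psi : p_php th = p_php th0 -> p_phm th = p_phm th0 -> p_psi th != p_psi th0 ->
  identified.
Proof.
move=> hp hm ne; have dp : 0 < `|p_psi th - p_psi th0| by rewrite normr_gt0 subr_eq0.
have om0 : 0 < p_om th0 by case: th0P.
have [ph0 ps0] : 0 < p_php th0 /\ 0 < p_psi th0 by case: th0P.
have psi0 : 0 < p_psi th by case: thP.
have archE x : arch th x = arch th0 x by rewrite /arch hp hm.
pose B := 1 + 3 / p_php th0.
have B1 : 1 <= B by rewrite lerDl divr_ge0// ltW.
have phB : 3 <= p_php th0 * B by rewrite /B mulrDr mulr1 mulrCA mulfV ?gt_eqF// mulr1 lerDr ltW.
have [c c0 Hc] := @itv_pair_freq B (B + 1) (ltac:(lra)).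
pose M := p_php th0 * (B + 1) ^+ 2 + p_psi th0.
have M0 : 0 < M by rewrite addr_gt0// mulr_gt0// exprn_gt0//; lra.
pose N := 1 + M + p_psi th.
have N0 : 0 < N by rewrite /N; lra.
pose tau := Num.min 2^-1 (`|p_psi th - p_psi th0| / (4 * N)).
have ta0 : 0 < tau by rewrite lt_min invr_gt0 ltr0n divr_gt0// mulr_gt0.
have ta1 : tau < 1.
  by apply: (@le_lt_trans _ _ 2^-1); [rewrite ge_min lexx|lra].
have taN : 4 * (tau * N) <= `|p_psi th - p_psi th0|.
  by rewrite mulrCA -ler_pdivlMr ?mulr_gt0// ge_min lexx orbT.
exists tau, (c / 6); split; [by rewrite ta0|by rewrite divr_gt0|].
apply: filterS Hc => w Hw; apply: freq_from_window Hw => // k /andP[k1 k2].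
apply: contraT; rewrite !negb_or => /andP[/andP[n1 n2] n3].
have aB x : B <= x <= B + 1 -> 3 <= a_fun th0 x <= M.
  move=> /andP[x1 x2]; rewrite a_fun_pos; last by lra.
  apply/andP; split; last by rewrite lerD2r ler_pM2l// lerXn2r// nnegrE; move: B1 x1 x2; clear_after a_fun_pos; lra.
  apply: (le_trans phB); rewrite ler_wpDr ?(ltW ps0)// ler_pM2l//; move: B1 x1; clear_after a_fun_pos; nra.
have D j : B <= e j w <= B + 1 -> ~~ I tau j w -> ~~ I tau j.+1 w ->
   `|p_om th - p_om th0 + sv j w * (p_psi th - p_psi th0)| < tau * N * sv j w.
  move=> jB m1 m2; have := step ta0 m1 m2; rewrite archE subrr add0r => /lt_le_trans; apply.
  rewrite -mulrA ler_pM2l//.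
  have so : p_om th0 <= sv j w by exact: svol_ge_om.
  have /andP[_ aM] := aB _ jB; have ss := s0 j w.
  have : sv j w * a_fun th0 (e j w) <= sv j w * M by rewrite ler_pM2l.
  by rewrite /N; lra.
have h1 := D _ k1 n1 n2; have h2 := D _ k2 n2 n3.
have s3 : 3 * sv k w <= sv k.+1 w.
  have /andP[a3 _] := aB _ k1.
  rewrite /sv /=; apply: (@le_trans _ _ (svol th0 z (e^~ w) k * a_fun th0 (e k w))).
    by rewrite mulrC ler_pM2l//; exact: s0.
  by rewrite lerDr ltW.
move: h1 h2 s3 taN (s0 k w) (s0 k.+1 w); move: (sv k w) (sv k.+1 w) => s s'.
have et0 : 0 < tau * N by rewrite mulr_gt0.
move: (tau * N) et0 (p_om th - p_om th0) (p_psi th - p_psi th0) => et et0 Om Ps.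
move=> h1 h2 s3 etP ss ss'.
have j1 : (s' - s) * `|Om| <= 2 * et * s * s'.
  have -> : (s' - s) * `|Om| = `|s' * (Om + s * Ps) - s * (Om + s' * Ps)|.
    rewrite -[X in X * _]gtr0_norm; last by move: s3 ss; clear_after a_fun_pos; lra.
    by rewrite -normrM; congr (Num.norm _); ring.
  apply: (le_trans (ler_normB _ _)); rewrite !normrM (gtr0_norm ss) (gtr0_norm ss').
  have i1 : s' * `|Om + s * Ps| <= s' * (et * s) by rewrite ler_pM2l// ltW.
  have i2 : s * `|Om + s' * Ps| <= s * (et * s') by rewrite ler_pM2l// ltW.
  by move: i1 i2; clear_after a_fun_pos; lra.
have j2 : `|Om| <= 3 * et * s.
  rewrite -(ler_pM2l ss').
  have i1 : 2 * s' * `|Om| <= 3 * (s' - s) * `|Om|.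
    by rewrite ler_wpM2r//; move: s3; clear_after a_fun_pos; lra.
  by move: i1 j1; clear_after a_fun_pos; lra.
have j3 : s * `|Ps| < 4 * et * s.
  have : `|s * Ps| <= `|Om + s * Ps| + `|Om|.
    have {1}-> : s * Ps = (Om + s * Ps) - Om by ring.
    exact: ler_normB.
  by rewrite normrM (gtr0_norm ss); move: h1 j2; clear_after a_fun_pos; lra.
by move: j3; rewrite mulrC ltr_pM2r//; move: etP; clear_after a_fun_pos; lra.
Qed.

Lemma ident_omega (S0 p : R) : 0 < S0 -> 0 < p ->
  {ae P, forall w, \forall n \near \oo, p * n%:R <= \sum_(0 <= k < n) (sv k w <= S0)%R%:R} ->
  p_php th = p_php th0 -> p_phm th = p_phm th0 -> p_psi th = p_psi th0 ->
  p_om th != p_om th0 -> identified.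
Proof.
move=> S00 p0 Hs hp hm hps ne; have dp : 0 < `|p_om th - p_om th0| by rewrite normr_gt0 subr_eq0.
have om0 : 0 < p_om th0 by case: th0P.
have [ph0 ps0] : 0 < p_php th0 /\ 0 < p_psi th0 by case: th0P.
have psi0 : 0 < p_psi th by case: thP.
have archE x : arch th x = arch th0 x by rewrite /arch hp hm.
have [c cI Hc] := sden_itv_mean alI (@ltr01 R); have c0 : 0 < c by case/andP: cI.
pose F (u : R * R) := p_om th0 + u.1 * (arch th0 u.2 + p_psi th0).
have mF : measurable_fun setT F.
  apply: measurable_funD => //; apply: measurable_funM => //; apply: measurable_funD => //.
  exact: measurable_archT.
have mS : measurable_fun [set: R] (fun s : R => s <= S0) by apply: measurable_fun_ler.
have := @chain_count R d T P e _ alI iid _ R F z sv mF (fun _ => erefl)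
  (fun _ _ => erefl) (fun s => s <= S0) (fun x => 0 <= x <= 1) c mS (mitv 0 1) cI Hc.
move=> /(ae_and Hs) Hcnt.
pose N := p_om th0 + S0 * (p_php th0 + p_psi th0 + p_psi th).
have N0 : 0 < N by rewrite addr_gt0// mulr_gt0// !addr_gt0.
pose tau := Num.min 2^-1 (`|p_om th - p_om th0| / N).
have ta0 : 0 < tau by rewrite lt_min invr_gt0 ltr0n divr_gt0.
have ta1 : tau < 1.
  by apply: (@le_lt_trans _ _ 2^-1); [rewrite ge_min lexx|lra].
have taN : tau * N <= `|p_om th - p_om th0|.
  by rewrite -ler_pdivlMr// ge_min lexx orbT.
have cp : 0 < c * p / 2 by rewrite divr_gt0// mulr_gt0.
exists tau, (c * p / 2 / 6); split; [by rewrite ta0|by rewrite divr_gt0|].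
apply: filterS Hcnt => w [h1 /(_ _ cp) h2].
apply: (@freq_from_window _ (fun k => (sv k w <= S0) && (0 <= e k w <= 1))) => //.
  move=> k /andP[sk kI]; apply: contraT; rewrite !negb_or => /andP[/andP[n1 n2] _].
  have := step ta0 n1 n2; rewrite archE hps !subrr addr0 mulr0 addr0 => lt.
  suff kk : tau * (p_om th0 + sv k w * (a_fun th0 (e k w) + p_psi th0)) <= tau * N.
    by have := lt_le_trans lt kk; rewrite ltNge taN.
  rewrite ler_pM2l// lerD2l; apply: ler_pM => //.
  - exact: ltW.
  - by rewrite addr_ge0 ?(ltW ps0)// a_funE addr_ge0 ?arch_ge0// ltW.
  case/andP: kI => x0 x1; rewrite hps lerD2r a_fun_pos// lerD2r.
  by rewrite -[leRHS]mulr1 ler_pM2l// exprn_ile1.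
near=> n.
have i1 : p * n%:R <= \sum_(0 <= k < n) (sv k w <= S0)%R%:R by near: n.
have i2 : c * (\sum_(0 <= k < n) (sv k w <= S0)%R%:R) <=
    \sum_(0 <= k < n) ((sv k w <= S0) && (0 <= e k w <= 1))%R%:R + c * p / 2 * n%:R by near: n.
have i3 : c * (p * n%:R) <= c * (\sum_(0 <= k < n) (sv k w <= S0)%R%:R) by rewrite ler_pM2l.
move: i2 i3; rewrite mulrA (mulrAC (c * p)); by move: (c * p * n%:R) (c * _) => X Y; clear_after a_fun_pos; lra.
Unshelve. all: end_near. Qed.

End identification.

(** * Frequency of low volatility *)

Section moment.
Variable R : realType.
Local Notation mu := (@lebesgue_measure R).

Lemma powR_subadd (q x y : R) : 0 < q <= 1 -> 0 < x -> 0 < y -> (x + y) `^ q <= x `^ q + y `^ q.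
Proof.
move=> /andP[q0 q1] x0 y0; have xy : 0 < x + y by rewrite addr_gt0.
have key t : 0 < t -> t <= x + y -> t / (x + y) <= (t / (x + y)) `^ q.
  move=> t0 tx; have tt : 0 < t / (x + y) by rewrite divr_gt0.
  rewrite -{1}[t / (x + y)]powRr1 ?(ltW tt)// ger_powR// tt/= ler_pdivrMr// mul1r//.
have := lerD (key x x0 (ltac:(by rewrite lerDl ltW))) (key y y0 (ltac:(by rewrite lerDr ltW))).
rewrite -mulrDl mulfV ?gt_eqF// !powRM ?invr_ge0 ?(ltW x0) ?(ltW y0) ?(ltW xy)// -mulrDl.
have -> : (x + y)^-1 `^ q = ((x + y) `^ q)^-1.
  by rewrite -[(x + y)^-1](powR_inv1 (ltW xy)) -powRrM mulN1r powRN.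
by rewrite ler_pdivlMr ?powR_gt0// mul1r.
Qed.

Lemma expR_diff_bound (L q : R) : 0 < q ->
  L <= (expR (q * L) - 1) / q /\ (expR (q * L) - 1) / q <= L * expR (q * L).
Proof.
move=> q0; split.
  by rewrite ler_pdivlMr//; have := expR_ge1Dx (q * L); lra.
rewrite ler_pdivrMr//; have := expR_ge1Dx (- (q * L)); rewrite expRN => h.
have e0 := expR_gt0 (q * L).
have : (1 - q * L) * expR (q * L) <= 1.
  by rewrite -ler_pdivlMr// div1r.
lra.
Qed.

Lemma expR_diff_cvg (L : R) (q : R^nat) : (forall n, 0 < q n) -> q n @[n --> \oo] --> 0 ->
  (expR (q n * L) - 1) / q n @[n --> \oo] --> L.
Proof.
move=> q0 qc.
have c1 : L * expR (q n * L) @[n --> \oo] --> L.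
  rewrite -[X in _ --> X]mulr1 -expR0 -(mul0r L).
  apply: cvgM; first exact: cvg_cst.
  apply: (@cvg_comp _ _ _ (fun n => q n * L) (@expR R) \oo (nbhs (0 * L))).
    by apply: cvgM => //; exact: cvg_cst.
  exact: continuous_expR.
have c0 : (fun=> L) @ \oo --> L by exact: cvg_cst.
apply: squeeze_cvgr c0 c1.
by apply: nearW => n; apply/andP; exact: expR_diff_bound.
Qed.

Variable th : param R.
Hypothesis thP : param_pos th.
Let al := p_alpha th.
Let alI : 0 < al < 2. Proof. by case: thP. Qed.
Let al_gt0 : 0 < al. Proof. by case/andP: alI. Qed.
Let f := sden al.
Let f_gt0 x : 0 < f x. Proof. exact: sden_gt0. Qed.
Let A := a_fun th.
Let psi_gt0 : 0 < p_psi th. Proof. by case: thP. Qed.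
Let A_ge x : p_psi th <= A x. Proof. by rewrite /A a_funE lerDr arch_ge0. Qed.
Let A_gt0 x : 0 < A x. Proof. exact: lt_le_trans psi_gt0 (A_ge x). Qed.
Let mA : measurable_fun [set: R] A.
Proof. by apply: measurable_funD => //; exact: measurable_archT. Qed.
Let mf : measurable_fun [set: R] f. Proof. exact: sden_measurable. Qed.

Let A_le x : A x <= (p_php th + p_phm th + p_psi th) * (1 + `|x|) ^+ 2.
Proof.
case: thP => _ h1 h2 h3 _; rewrite /A a_funE /arch.
have n0 := normr_ge0 x.
have p1 : posp x ^+ 2 <= (1 + `|x|) ^+ 2.
  have [x0|/ltW x0] := leP 0 x.
    by have [-> _] := posp_ge0E x0; rewrite ger0_norm//; nra.
  by have [-> _] := posp_le0E x0; nra.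
have p2 : negp x ^+ 2 <= (1 + `|x|) ^+ 2.
  have [x0|/ltW x0] := leP 0 x.
    by have [_ ->] := posp_ge0E x0; nra.
  by have [_ ->] := posp_le0E x0; rewrite ler0_norm//; nra.
have p3 : 1 <= (1 + `|x|) ^+ 2 by nra.
have k1 := ler_wpM2l (ltW h1) p1; have k2 := ler_wpM2l (ltW h2) p2; have k3 := ler_wpM2l (ltW h3) p3.
lra.
Qed.

Lemma a_fun_moment_integrable : exists2 r : R, 0 < r <= 1 &
  mu.-integrable [set: R] (EFin \o (fun x => A x `^ r * f x)).
Proof.
pose a := Num.min 2^-1 al.
have a0 : 0 < a by rewrite lt_min invr_gt0 ltr0n al_gt0.
have a1 : a <= 2^-1 by rewrite ge_min lexx.
have aal : a <= al by rewrite ge_min lexx orbT.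
have aI : 0 < a <= 2^-1 by rewrite a0.
pose r := a / 4.
have r0 : 0 < r by rewrite divr_gt0.
exists r; first by rewrite r0/= /r; lra.
pose M := p_php th + p_phm th + p_psi th.
have M0 : 0 < M by case: thP => *; rewrite !addr_gt0.
have i1 := sden_integrable alI.
have i2 : mu.-integrable [set: R] (EFin \o (fun x => sden al x `^ 1 * `|x| `^ (- (- (2 * r))))).
  by apply: (@sden_power_integrable _ al a) => //; rewrite /r; lra.
apply: (@integrable_dom_leb _ _ _ (fun x => M `^ r * 2 * (f x + sden al x `^ 1 * `|x| `^ (- (- (2 * r)))))) => //.
- by apply: measurable_funM => //; exact: measurable_powRT.
- by apply: integrableZ_leb => //; exact: integrableD_leb.
move=> x _; have n0 := normr_ge0 x.
rewrite ger0_norm ?mulr_ge0 ?powR_ge0 ?(ltW (f_gt0 x))//.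
have -> : sden al x `^ 1 * `|x| `^ (- (- (2 * r))) = `|x| `^ (2 * r) * f x.
  by rewrite powRr1 ?(ltW (f_gt0 x))// opprK mulrC.
rewrite -[X in X + _]mul1r -mulrDl mulrA ler_pM2r//.
apply: (@le_trans _ _ ((M * (1 + `|x|) ^+ 2) `^ r)).
  by apply: powR_le_base; [exact: ltW|exact: ltW|exact: A_le].
rewrite powRM ?sqr_ge0 ?(ltW M0)// -mulrA ler_pM2l ?powR_gt0//.
have p1 : 0 <= 1 + `|x| by rewrite addr_ge0.
rewrite -powR_mulrn// -powRrM.
have r2 : 0 <= 2 * r by rewrite mulr_ge0// ltW.
have two : 2 `^ (2 * r) <= 2 :> R.
  by rewrite -[leRHS]powRr1// ler_powR// ?ler1n// /r; lra.
have [x1|x1] := leP `|x| 1.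
  apply: (@le_trans _ _ (2 `^ (2 * r))); first by apply: powR_le_base => //; lra.
  by apply: (le_trans two); rewrite mulrDr mulr1 lerDl mulr_ge0 ?powR_ge0.
apply: (@le_trans _ _ ((2 * `|x|) `^ (2 * r))); first by apply: powR_le_base => //; lra.
rewrite powRM//; apply: (@le_trans _ _ (2 * `|x| `^ (2 * r))); first by rewrite ler_wpM2r ?powR_ge0.
by rewrite ler_pM2l// lerDr.
Qed.

Lemma lyap_negative_moment : (lyap th < 0)%E ->
  exists2 q : R, 0 < q <= 1 & exists2 kap : R, 0 < kap < 1 &
    (\int[mu]_x (A x `^ q * f x)%:E <= kap%:E)%E.
Proof.
move=> ly; have [r /andP[r0 r1] ir] := a_fun_moment_integrable.
pose q0 := r / 2; have q00 : 0 < q0 by rewrite divr_gt0.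
pose q n := q0 / n.+1%:R.
have qn0 n : 0 < q n by rewrite divr_gt0.
have qnq n : q n <= q0 by rewrite ler_pdivrMr// ler_peMr ?(ltW q00)// ler1n.
have qc : q n @[n --> \oo] --> 0.
  rewrite -(mulr0 q0); apply: cvgM; first exact: cvg_cst.
  exact: cvg_harmonic.
pose L x := ln (A x).
have AE p x : A x `^ p = expR (p * L x) by rewrite /powR gt_eqF.
pose h n x := (A x `^ (q n) - 1) / q n * f x.
have mh n : measurable_fun [set: R] (h n).
  apply: measurable_funM => //; apply: measurable_funM => //; apply: measurable_funB => //.
  exact: measurable_powRT.
pose C := 4 * (`|ln (p_psi th)| + q0^-1).
have C0 : 0 <= C by rewrite mulr_ge0// addr_ge0// invr_ge0 ltW.
have igg : mu.-integrable [set: R] (EFin \o (fun x => C * (f x + A x `^ r * f x))).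
  by apply: integrableZ_leb => //; apply: integrableD_leb => //; exact: sden_integrable.
have Lb x : `|L x| <= `|ln (p_psi th)| + q0^-1 * A x `^ q0.
  have [l0|l0] := leP 0 (L x).
    rewrite ger0_norm// ler_wpDl// AE ler_pdivlMl//.
    by have := expR_ge1Dx (q0 * L x); lra.
  rewrite ltr0_norm// ler_wpDr ?mulr_ge0 ?powR_ge0 ?invr_ge0 ?(ltW q00)//.
  have lp : ln (p_psi th) <= L x by rewrite ler_ln ?posrE.
  by rewrite ltr0_norm ?lerN2//; exact: le_lt_trans l0.
have Yb x : (`|ln (p_psi th)| + q0^-1 * A x `^ q0) * (2 + A x `^ q0) <= C * (1 + A x `^ r).
  have -> : A x `^ r = (A x `^ q0) ^+ 2.
    by rewrite -powR_mulrn ?powR_ge0// -powRrM; congr (_ `^ _); rewrite /q0; field.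
  have y0 := powR_ge0 (A x) q0; move: (A x `^ q0) y0 => y y0.
  have c0 := normr_ge0 (ln (p_psi th)); rewrite /C; move: `|ln (p_psi th)| c0 => c c0.
  have i0 : 0 < q0^-1 by rewrite invr_gt0.
  move: q0^-1 i0 => i i0.
  have k1 : (2 + y) <= 4 * (1 + y ^+ 2) by have := sqr_ge0 (y - 1); nra.
  have k2 : y * (2 + y) <= 4 * (1 + y ^+ 2) by have := sqr_ge0 (y - 1); nra.
  have k3 := ler_wpM2l c0 k1; have k4 := ler_wpM2l (ltW i0) k2; lra.
have dom n x : `|h n x| <= C * (f x + A x `^ r * f x).
  have -> : C * (f x + A x `^ r * f x) = C * (1 + A x `^ r) * f x by ring.
  rewrite /h normrM (gtr0_norm (f_gt0 x)) ler_pM2r//.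
  apply: le_trans (Yb x).
  have [b1 b2] := expR_diff_bound (L x) (qn0 n); rewrite AE.
  have ey : expR (q n * L x) <= 1 + A x `^ q0.
    have [l0|l0] := leP 0 (L x).
      rewrite ler_wpDl// AE ler_expR ler_wpM2r//.
    by rewrite ler_wpDr ?powR_ge0// -expR0 ler_expR mulr_ge0_le0 ?(ltW (qn0 n)) ?(ltW l0).
  have e0 := expR_gt0 (q n * L x).
  apply: (@le_trans _ _ (`|L x| * (1 + expR (q n * L x)))).
    have n1 := ler_norm (L x); have n2 := ler_norm (- L x); rewrite normrN in n2.
    have nn := normr_ge0 (L x).
    rewrite ler_norml; apply/andP; split; first by nra.
    by apply: (le_trans b2); nra.
  have y0 := powR_ge0 (A x) q0.
  by apply: ler_pM => //; lra.
have ptw x : h n x @[n --> \oo] --> L x * f x.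
  apply: cvgM; last exact: cvg_cst.
  rewrite (_ : (fun n => (A x `^ q n - 1) / q n) = (fun n => (expR (q n * L x) - 1) / q n)).
    exact: expR_diff_cvg.
  by apply/funext => n; rewrite AE.
have cv := @dominated_cvg_leb R setT h (fun x => L x * f x) (fun x => C * (f x + A x `^ r * f x))
  measurableT mh (fun x _ => ptw x) igg (fun n x _ => dom n x).
have iL : mu.-integrable [set: R] (EFin \o (fun x => L x * f x)).
  apply: (@integrable_dom_leb _ _ _ (fun x => C * (f x + A x `^ r * f x))) => //.
    by apply: measurable_funM => //; exact: measurable_lnT.
  move=> x _; have -> : C * (f x + A x `^ r * f x) = C * (1 + A x `^ r) * f x by ring.
  rewrite normrM (gtr0_norm (f_gt0 x)) ler_pM2r//; apply: le_trans (Yb x).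
  apply: (le_trans (Lb x)); rewrite ler_peMr//; last by have := powR_ge0 (A x) q0; lra.
  by rewrite addr_ge0// mulr_ge0 ?powR_ge0 ?invr_ge0 ?(ltW q00).
have I0 : \int[mu]_x (L x * f x) < 0.
  rewrite -lte_fin /Rintegral fineK; last exact: integrable_fin_num iL.
  by move: ly; rewrite /lyap -sdenE.
have [N _ HN] : \forall n \near \oo, \int[mu]_x h n x < 0 by exact: (cvgr_lt _ cv).
have {HN} hN := HN N (leqnn N).
have qN1 : q N <= 1 by apply: (le_trans (qnq N)); rewrite /q0; lra.
exists (q N); first by rewrite qn0.
have iq : mu.-integrable [set: R] (EFin \o (fun x => A x `^ q N * f x)).
  apply: (@integrable_dom_leb _ _ _ (fun x => f x + A x `^ r * f x)) => //.
  - by apply: measurable_funM => //; exact: measurable_powRT.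
  - by apply: integrableD_leb => //; exact: sden_integrable.
  move=> x _; rewrite ger0_norm ?mulr_ge0 ?powR_ge0 ?(ltW (f_gt0 x))//.
  rewrite -[X in X + _]mul1r -mulrDl ler_pM2r// AE.
  have [l0|l0] := leP 0 (L x).
    rewrite ler_wpDl// AE ler_expR ler_wpM2r//.
    by apply: (le_trans (qnq N)); rewrite /q0; lra.
  by rewrite ler_wpDr ?powR_ge0// -expR0 ler_expR mulr_ge0_le0 ?(ltW (qn0 N)) ?(ltW l0).
have i1 := sden_integrable alI; have m1 := sden_Rmass_le1 alI.
have E : \int[mu]_x h N x = (q N)^-1 * (\int[mu]_x (A x `^ q N * f x) - \int[mu]_x f x).
  rewrite -RintegralB// -RintegralZl//; last exact: integrableB_leb.
  by apply: eq_Rintegral => x _; rewrite /h; ring.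
rewrite E pmulr_rlt0 ?invr_gt0// in hN.
have p0 : 0 <= \int[mu]_x (A x `^ q N * f x).
  by apply: Rintegral_ge0 => x _; rewrite mulr_ge0 ?powR_ge0 ?(ltW (f_gt0 x)).
have E2 : (\int[mu]_x (A x `^ q N * f x)%:E = (\int[mu]_x (A x `^ q N * f x))%:E)%E.
  by rewrite /Rintegral fineK//; exact: integrable_fin_num iq.
rewrite E2.
have d0 : 0 < \int[mu]_x f x - \int[mu]_x (A x `^ q N * f x) by rewrite -oppr_lt0 opprB.
have [c /andP[c0 c1] Jc] := deficit d0 m1 p0.
by exists (1 - c); [move: c0 c1; clear_after A_le; apply/andP; split; lra|rewrite lee_fin].
Qed.

End moment.

Section low_volatility.
Context (R : realType) (d : measure_display) (T : measurableType d) (P : probability T R).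
Local Notation mu := (@lebesgue_measure R).
Variables (e : nat -> T -> R) (th0 : param R) (z : R).
Hypotheses (th0P : param_pos th0) (z0 : p_om th0 <= z)
  (iid : iid_density P e (sden (p_alpha th0))).
Let f := sden (p_alpha th0).
Let alI : 0 < p_alpha th0 < 2. Proof. by case: th0P. Qed.
Let sv n w := svol th0 z (fun k => e k w) n.

(* [1 + sv ^ q] is a Lyapunov function, since [lyap th0 < 0] makes a small moment of [a_fun th0]
   smaller than [1]. *)
Lemma low_volatility_freq : (lyap th0 < 0)%E -> exists S0 p : R, [/\ 0 < S0, 0 < p &
  {ae P, forall w, \forall n \near \oo, p * n%:R <= \sum_(0 <= k < n) (sv k w <= S0)%R%:R}].
Proof.
move=> ly; have [q /andP[q0 q1] [kap /andP[k0 k1] Hk]] := lyap_negative_moment th0P ly.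
have om0 : 0 < p_om th0 by case: th0P.
have ps0 : 0 < p_psi th0 by case: th0P.
pose o := p_om th0 `^ q.
have o0 : 0 < o by rewrite powR_gt0.
pose g : R := (1 - kap) / 2.
have g0 : 0 < g by rewrite /g; lra.
pose S0 := ((1 + o) / g) `^ q^-1.
have og : 0 < (1 + o) / g by rewrite divr_gt0// addr_gt0.
have S00 : 0 < S0 by rewrite powR_gt0.
have S0q : S0 `^ q = (1 + o) / g by rewrite -powRrM mulVf ?gt_eqF// powRr1// ltW.
pose Lam := ln (2 + o) - ln (1 - g).
have g1 : g < 1 by rewrite /g; lra.
have l1 : ln (1 - g) <= - g by apply: le_ln1Dx; lra.
have l2 : 0 <= ln (2 + o) by apply: ln_ge0; lra.
have Lam0 : 0 < Lam by rewrite /Lam; lra.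
exists S0, (g / 2 / Lam); split; [by []|by apply: divr_gt0 => //; exact: divr_gt0|].
pose F (u : R * R) := p_om th0 + u.1 * (arch th0 u.2 + p_psi th0).
have mF : measurable_fun setT F.
  apply: measurable_funD => //; apply: measurable_funM => //; apply: measurable_funD => //.
  exact: measurable_archT.
pose H (s : R) := 1 + s `^ q.
have mH : measurable_fun [set: R] H by apply: measurable_funD => //; exact: measurable_powRT.
pose lam (s : R) : R := if s <= S0 then 2 + o else 1 - g.
have mlam : measurable_fun [set: R] lam.
  by apply: measurable_fun_ifT => //; apply: measurable_fun_ler.
have lam0 s : 0 < lam s by rewrite /lam; case: ifP => _; lra.
pose xi (u : R * R) := ln (H (F u)) - ln (H u.1) - ln (lam u.1).
have mxi : measurable_fun setT xi.
  apply: measurable_funB; first apply: measurable_funB.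
  - by apply: measurable_lnT; apply: (measurableT_comp mH mF).
  - by apply: measurable_lnT; apply: (measurableT_comp mH measurable_fst).
  - by apply: measurable_lnT; apply: (measurableT_comp mlam measurable_fst).
have fx0 x : 0 < f x by exact: sden_gt0.
have mf : measurable_fun [set: R] f by apply: sden_measurable; case/andP: alI.
have H0 s : 0 < H s by rewrite /H ltr_wpDr ?powR_ge0.
have mean n w : (\int[mu]_x (expR (xi (sv n w, x)) * f x)%:E <= 1)%E.
  have : 0 < sv n w by exact: svol_gt0.
  move: (sv n w) => s s0.
  have HL : 0 < H s * lam s by rewrite mulr_gt0.
  have sq : 0 < s `^ q by rewrite powR_gt0.
  pose A := (1 + o) / (H s * lam s); pose B := s `^ q / (H s * lam s).
  have A0 : 0 <= A by rewrite divr_ge0 ?(ltW HL)// addr_ge0// ltW.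
  have B0 : 0 <= B by rewrite divr_ge0 ?(ltW HL)// ltW.
  have mW : measurable_fun [set: R] (fun x => a_fun th0 x `^ q).
    by apply: measurable_powRT; apply: measurable_funD => //; exact: measurable_archT.
  have := @sden_affine_mean R _ alI A B kap (fun x => a_fun th0 x `^ q) A0 B0 mW (fun x => powR_ge0 _ _) Hk.
  move=> AB; apply: (@le_trans _ _ (A + B * kap)%:E).
    apply: le_trans AB; apply: (sden_le_mean alI).
    - by apply: (measurableT_comp (@measurable_expR R)); exact: (measurable_fun_pair2 s mxi).
    - by apply: measurable_funD => //; apply: measurable_funM.
    - by move=> x; rewrite expR_ge0.
    - by move=> x; rewrite addr_ge0// mulr_ge0 ?powR_ge0.
    move=> x _.
    have -> : expR (xi (s, x)) = H (F (s, x)) / (H s * lam s).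
      rewrite /xi /= -ln_div ?posrE// -ln_div ?posrE ?divr_gt0// lnK ?posrE ?divr_gt0 ?divr_gt0//.
      by rewrite invfM mulrA.
    have -> : A + B * a_fun th0 x `^ q = (1 + o + s `^ q * a_fun th0 x `^ q) / (H s * lam s).
      by rewrite /A /B; ring.
    rewrite ler_pM2r ?invr_gt0// /H -addrA lerD2l /F/= -/(a_fun th0 x).
    have a0 : 0 < a_fun th0 x by rewrite a_funE ltr_wpDl// arch_ge0.
    rewrite -powRM ?(ltW s0) ?(ltW a0)//; apply: powR_subadd => //; first by rewrite q0.
    exact: mulr_gt0.
  rewrite lee_fin.
  have -> : A + B * kap = (1 + o + s `^ q * kap) / (H s * lam s) by rewrite /A /B; ring.
  rewrite ler_pdivrMr// mul1r /H /lam; case: ifPn => [_|]; first by nra.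
  rewrite -ltNge => sS.
  have : (1 + o) / g <= s `^ q by rewrite -S0q; apply: powR_le_base; exact: ltW.
  rewrite ler_pdivrMr// => k3; rewrite /g in k3 *; lra.
have := @chain_exp_sum R d T P e f iid mf (fun x => ltW (fx0 x)) _ R F z sv mF (fun _ => erefl)
  (fun _ _ => erefl) xi mxi mean.
apply: filterS => w Hw.
have g4 : 0 < g / 4 by rewrite divr_gt0.
have {}Hw := Hw _ g4.
have big : \forall n \near \oo, ln (H z) <= g / 4 * n%:R.
  by near=> n; rewrite -ler_pdivrMl// mulrC; near: n; exact: nbhs_infty_ger.
near=> n.
have h1 : \sum_(0 <= k < n) xi (sv k w, e k w) <= g / 4 * n%:R by near: n.
have h2 : ln (H z) <= g / 4 * n%:R by near: n.
have E : \sum_(0 <= k < n) xi (sv k w, e k w) =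
    ln (H (sv n w)) - ln (H (sv 0 w)) - \sum_(0 <= k < n) ln (lam (sv k w)).
  elim: (n) => [|m IHm]; first by rewrite !big_geq// !subrr.
  rewrite !big_nat_recr//= IHm {1}/xi.
  have -> : F (sv m w, e m w) = sv m.+1 w by [].
  by rewrite /=; ring.
have Hn : 0 <= ln (H (sv n w)) by apply: ln_ge0; rewrite /H lerDl powR_ge0.
have lamS : \sum_(0 <= k < n) ln (lam (sv k w)) =
    ln (1 - g) * n%:R + Lam * \sum_(0 <= k < n) (sv k w <= S0)%R%:R.
  have -> : ln (1 - g) * n%:R = \sum_(0 <= k < n) ln (1 - g).
    by rewrite big_const_nat subn0 iter_addr addr0 mulr_natr.
  rewrite mulr_sumr -big_split/=; apply: eq_bigr => k _; rewrite /lam /Lam.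
  by case: ifP => _; rewrite ?mulr1 ?mulr0; ring.
rewrite mulrAC ler_pdivrMr// [leRHS]mulrC.
move: h1; rewrite E lamS.
have : ln (1 - g) * n%:R <= - g * n%:R by rewrite ler_wpM2r.
have -> : sv 0 w = z by [].
move: (Lam * _) h2 Hn; move: (ln (H z)) (ln (H (sv n w))) => a1 a2 X h2 Hn h3 h4.
lra.
Unshelve. all: end_near. Qed.

End low_volatility.

(** * Likelihood at the true parameter *)

Section cesaro.
Variable R : realType.

Lemma sum_ge_of_eventually (t : nat -> R) :
  (forall eps, 0 < eps -> \forall n \near \oo, - eps <= t n) ->
  forall eps, 0 < eps -> \forall n \near \oo, - eps * n%:R <= \sum_(0 <= k < n) t k.
Proof.
move=> H eps e0; have e2 : 0 < eps / 2 by rewrite divr_gt0.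
have [N _ HN] := H _ e2.
pose C := \sum_(0 <= k < N) `|t k|.
have low n : - (eps / 2) * n%:R - C <= \sum_(0 <= k < n) t k.
  have C0 m : 0 <= \sum_(0 <= k < m) `|t k| by apply: sumr_ge0.
  have [nN|Nn] := leqP n N.
    apply: (@le_trans _ _ (- \sum_(0 <= k < n) `|t k|)); last first.
      by rewrite -sumrN; apply: ler_sum => k _; rewrite lerNl -normrN ler_norm.
    have : \sum_(0 <= k < n) `|t k| <= C.
      by rewrite /C [leRHS](big_cat_nat (n := n))//=; rewrite lerDl; apply: sumr_ge0.
    have : 0 <= eps / 2 * n%:R by rewrite mulr_ge0// ltW.
    lra.
  rewrite (big_cat_nat (n := N))//= ?(ltnW Nn)// addrC; apply: lerD; last first.
    by rewrite /C -sumrN; apply: ler_sum => k _; rewrite lerNl -normrN ler_norm.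
  apply: (@le_trans _ _ (\sum_(N <= k < n) - (eps / 2))); last first.
    by apply: ler_sum_nat => k /andP[Nk _]; exact: HN.
  rewrite big_const_nat iter_addr addr0 -[leRHS]mulr_natr !mulNr lerN2.
  by rewrite ler_wpM2l ?(ltW e2)// ler_nat leq_subr.
near=> n.
have : C <= eps / 2 * n%:R.
  by near: n; near=> n; rewrite -ler_pdivrMl// mulrC; near: n; exact: nbhs_infty_ger.
by have := low n; lra.
Unshelve. all: end_near. Qed.

Lemma exp_decay_eventually (C b eps : R) : 0 < b -> 0 < eps ->
  \forall n \near \oo, C * expR (- (b * n%:R)) <= eps.
Proof.
move=> b0 e0; near=> n.
have h : `|C| / (eps * b) <= n%:R by near: n; exact: nbhs_infty_ger.
rewrite expRN ler_pdivrMr ?expR_gt0//.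
apply: (le_trans (ler_norm C)).
rewrite ler_pdivrMr ?mulr_gt0// in h.
have := expR_ge1Dx (b * n%:R).
rewrite (_ : n%:R * (eps * b) = eps * (b * n%:R)) in h; last by ring.
move=> k; apply: (le_trans h); rewrite ler_pM2l//; lra.
Unshelve. all: end_near. Qed.

End cesaro.

Section true_parameter.
Context (R : realType) (d : measure_display) (T : measurableType d) (P : probability T R).
Local Notation mu := (@lebesgue_measure R).
Variables (e : nat -> T -> R) (th0 : param R) (z : R).
Hypotheses (th0P : param_pos th0) (z0 : p_om th0 <= z)
  (iid : iid_density P e (sden (p_alpha th0))).
Let al := p_alpha th0.
Let alI : 0 < al < 2. Proof. by case: th0P. Qed.
Let al_gt0 : 0 < al. Proof. by case/andP: alI. Qed.
Let f := sden al.
Let f_gt0 x : 0 < f x. Proof. exact: sden_gt0. Qed.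
Let mf : measurable_fun [set: R] f. Proof. exact: sden_measurable. Qed.
Let sv n w := svol th0 z (fun k => e k w) n.
Let fv n w := fvol th0 z (fun k => e k w) th0 n.
Let om0 : 0 < p_om th0. Proof. by case: th0P. Qed.
Let ps0 : 0 < p_psi th0. Proof. by case: th0P. Qed.
Let a_gt0 x : 0 < a_fun th0 x.
Proof. by rewrite a_funE ltr_wpDl// arch_ge0. Qed.

Let fv_ge n w : p_om th0 * \prod_(0 <= k < n) a_fun th0 (e k w) <= fv n w.
Proof.
elim: n => [|n IH]; first by rewrite big_geq// mulr1.
rewrite big_nat_recr//= mulrA /fv/= -/(fv n w).
have us : fv n w <= svol th0 z (e^~ w) n.
  rewrite (fvol_true_gap th0 z (e^~ w) n) -/(fv n w) lerDl mulr_ge0 ?subr_ge0//.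
  by rewrite exprn_ge0// ltW.
have u0 : 0 < fv n w by exact: fvol_gt0.
apply: (@le_trans _ _ (fv n w * a_fun th0 (e n w))).
  by rewrite ler_wpM2r// ltW.
rewrite a_funE mulrDr (mulrC (fv n w) (p_psi th0)) lerD2r.
rewrite -[leLHS]add0r; apply: lerD; first exact: ltW.
by rewrite ler_wpM2r// arch_ge0.
Qed.

Let ratio_decay : exists2 b : R, 0 < b & {ae P, forall w, \forall n \near \oo,
  sv n w / fv n w - 1 <= (z - p_om th0) / p_om th0 * expR (- (b * n%:R))}.
Proof.
pose g x := p_psi th0 / a_fun th0 x.
have gE : g = fun x => p_psi th0 * a_fun th0 x `^ (-1).
  by apply/funext => x; rewrite /g powR_inv1// ltW.
have mg : measurable_fun [set: R] g.
  rewrite gE; apply: measurable_funM => //; apply: measurable_powRT.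
  by apply: measurable_funD => //; exact: measurable_archT.
have g0 x : 0 < g x by rewrite divr_gt0.
have g01 x : 0 <= g x <= 1.
  by rewrite ltW//= ler_pdivrMr// mul1r a_funE lerDr arch_ge0.
have cg : {for 1, continuous g}.
  have H : \forall x \near (1 : R), p_psi th0 / (p_php th0 * x ^+ 2 + p_psi th0) = g x.
    near=> x; have x0 : 0 <= x by rewrite ltW//; near: x; apply: lt_nbhsr.
    by rewrite /g a_funE /arch; have [-> ->] := posp_ge0E x0; rewrite expr0n/= mulr0 addr0.
  have c1 : {for 1, continuous (fun x : R => p_psi th0 / (p_php th0 * x ^+ 2 + p_psi th0))}.
    apply: continuousM; first exact: cvg_cst.
    apply: continuousV.
      by rewrite gt_eqF// ltr_wpDl// mulr_ge0 ?sqr_ge0//; case: th0P => _ /ltW.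
    apply: continuousD; last exact: cvg_cst.
    by apply: continuousM; [exact: cvg_cst|exact: exprn_continuous].
  have := nbhs_singleton H => E; rewrite /prop_for /continuous_at -E.
  exact: cvg_trans (near_eq_cvg H) c1.
have g1 : g 1 < 1.
  rewrite /g ltr_pdivrMr// mul1r a_funE ltrDr /arch.
  have [-> ->] := posp_ge0E (@ler01 R).
  by case: th0P => _ h *; rewrite expr0n/= mulr0 addr0 expr1n mulr1.
have [c /andP[c0 c1] Hc] := sden_mean_lt1 alI mg g01 cg g1.
have c1' : 0 < 1 - c by lra.
have l1 : ln (1 - c) <= - c by apply: le_ln1Dx; lra.
exists (c / 2); first by rewrite divr_gt0.
pose xi (u : R * R) := ln (g u.2) - ln (1 - c).
have mxi : measurable_fun setT xi.
  apply: measurable_funB => //; apply: measurable_lnT.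
  exact: (measurableT_comp mg measurable_snd).
pose Z (n : nat) (w : T) : R := 0.
have mean n w : (\int[mu]_x (expR (xi (Z n w, x)) * f x)%:E <= 1)%E.
  have -> : (\int[mu]_x (expR (xi (Z n w, x)) * f x)%:E =
     \int[mu]_x ((1 - c)^-1%:E * (g x * f x)%:E))%E.
    apply: eq_integral => x _; rewrite /xi expRD expRN !lnK ?posrE// -EFinM; congr _%:E.
    by rewrite /=; ring.
  rewrite ge0_integralZl_EFin ?invr_ge0 ?(ltW c1')//.
  - apply: (@le_trans _ _ ((1 - c)^-1%:E * (1 - c)%:E)%E).
      by rewrite lee_wpmul2l// lee_fin invr_ge0 ltW.
    by rewrite -EFinM mulVf ?gt_eqF.
  - by move=> x _; rewrite lee_fin mulr_ge0// ltW.
  - by apply/measurable_EFinP; exact: measurable_funM.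
have := @chain_exp_sum R d T P e f iid mf (fun x => ltW (f_gt0 x)) _ R (fun=> 0) (0 : R) Z
  (@measurable_cst _ _ _ _ setT (0 : R)) (fun _ => erefl) (fun _ _ => erefl) xi mxi mean.
have c2 : 0 < c / 2 by rewrite divr_gt0.
apply: filterS => w /(_ _ c2); apply: filterS => n Hn.
have u0 : 0 < fv n w by exact: fvol_gt0.
have pr0 : 0 < \prod_(0 <= k < n) a_fun th0 (e k w) by apply: prodr_gt0.
have -> : sv n w / fv n w - 1 = p_psi th0 ^+ n * (z - p_om th0) / fv n w.
  rewrite /sv (fvol_true_gap th0 z (e^~ w) n) -/(fv n w) mulrDl mulfV ?gt_eqF//.
  by rewrite addrC addKr.
have zo : 0 <= z - p_om th0 by rewrite subr_ge0.
apply: (@le_trans _ _ (p_psi th0 ^+ n * (z - p_om th0) / (p_om th0 * \prod_(0 <= k < n) a_fun th0 (e k w)))).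
  rewrite ler_wpM2l ?mulr_ge0 ?exprn_ge0 ?(ltW ps0)// lef_pV2 ?posrE ?mulr_gt0//.
have -> : p_psi th0 ^+ n * (z - p_om th0) / (p_om th0 * \prod_(0 <= k < n) a_fun th0 (e k w)) =
   (z - p_om th0) / p_om th0 * \prod_(0 <= k < n) g (e k w).
  rewrite /g prodf_div prodr_const_nat subn0; field.
  by rewrite !gt_eqF.
rewrite ler_wpM2l ?divr_ge0 ?(ltW om0)//.
rewrite -[leLHS]lnK; last by rewrite posrE; apply: prodr_gt0.
rewrite ler_expR.
have -> : ln (\prod_(0 <= k < n) g (e k w)) = \sum_(0 <= k < n) ln (g (e k w)).
  elim: (n) => [|m IHm]; first by rewrite !big_geq// ln1.
  by rewrite !big_nat_recr//= lnM ?posrE ?prodr_gt0// IHm.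
move: Hn; rewrite /xi/= big_split/= big_const_nat subn0 iter_addr addr0 mulNrn -(mulr_natr (ln (1 - c))).
have : ln (1 - c) * n%:R <= - c * n%:R by rewrite ler_wpM2r.
move: (\sum_(0 <= k < n) _) (ln (1 - c) * n%:R) => X Y; lra.
Unshelve. all: end_near. Qed.

Let tails : exists2 kap : R, 0 < kap & {ae P, forall w, \forall n \near \oo,
  `|e n w| <= ((n.+1 * n.+2)%:R) `^ kap /\ (f (e n w))^-1 <= ((n.+1 * n.+2)%:R) `^ kap}.
Proof.
pose a := Num.min 2^-1 al.
have a0 : 0 < a by rewrite lt_min invr_gt0 ltr0n al_gt0.
have a1 : a <= 2^-1 by rewrite ge_min lexx.
have aal : a <= al by rewrite ge_min lexx orbT.
have aI : 0 < a <= 2^-1 by rewrite a0.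
pose k := a / 4.
have k0 : 0 < k by rewrite divr_gt0.
have i1 : mu.-integrable [set: R] (EFin \o (fun x => sden al x `^ 1 * `|x| `^ (- (- k)))).
  by apply: (@sden_power_integrable _ al a) => //; rewrite /k; lra.
have i2 : mu.-integrable [set: R] (EFin \o (fun x => sden al x `^ (1 - k) * `|x| `^ (- 0))).
  by apply: (@sden_power_integrable _ al a) => //; rewrite /k; [lra|nra].
have fin (h : R -> R) : mu.-integrable [set: R] (EFin \o h) -> (forall x, 0 <= h x) ->
    exists2 K : R, 0 <= K & (\int[mu]_x (h x)%:E <= K%:E)%E.
  move=> ih h0; exists (\int[mu]_x h x); first exact: Rintegral_ge0.
  by rewrite /Rintegral fineK//; exact: integrable_fin_num ih.
have E1 : (fun x => sden al x `^ 1 * `|x| `^ (- (- k))) = fun x => `|x| `^ k * f x.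
  by apply/funext => x; rewrite powRr1 ?(ltW (f_gt0 x))// opprK mulrC.
have E2 : (fun x => sden al x `^ (1 - k) * `|x| `^ (- 0)) = fun x => f x `^ (- k) * f x.
  apply/funext => x; rewrite oppr0 powRr0 mulr1 powRD; last by rewrite (gt_eqF (f_gt0 x)) implybT.
  by rewrite powRr1 ?(ltW (f_gt0 x))// mulrC.
rewrite E1 in i1; rewrite E2 in i2.
have [K1 K10 H1] := fin _ i1 (fun x => mulr_ge0 (powR_ge0 _ _) (ltW (f_gt0 x))).
have [K2 K20 H2] := fin _ i2 (fun x => mulr_ge0 (powR_ge0 _ _) (ltW (f_gt0 x))).
have m1 : measurable_fun [set: R] (fun x : R => `|x| `^ k).
  by apply: measurable_powRT; exact: normr_measurable.
have m2 : measurable_fun [set: R] (fun x : R => f x `^ (- k)) by exact: measurable_powRT.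
have A1 := innovation_le_pronic iid mf (fun x => ltW (f_gt0 x)) m1 (fun x => powR_ge0 _ _) K10 H1.
have A2 := innovation_le_pronic iid mf (fun x => ltW (f_gt0 x)) m2 (fun x => powR_ge0 _ _) K20 H2.
exists k^-1; first by rewrite invr_gt0.
have inv (x y : R) : 0 <= x -> x `^ k <= y -> x <= y `^ k^-1.
  move=> x0 xy; have -> : x = (x `^ k) `^ k^-1 by rewrite -powRrM mulfV ?gt_eqF// powRr1.
  by apply: powR_le_base => //; [rewrite invr_ge0 ltW|exact: powR_ge0].
apply: filterS (ae_and A1 A2) => w [B1 B2].
apply: filterS2 B1 B2 => n b1 b2; split; first exact: inv.
apply: inv; first by rewrite invr_ge0 ltW.
by rewrite -[(f _)^-1](powR_inv1 (ltW (f_gt0 _))) -powRrM mulN1r.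
Qed.

Lemma true_likelihood : {ae P, forall w, forall eps : R, 0 < eps -> \forall n \near \oo,
  - eps * n%:R <= \sum_(0 <= k < n) (lterm th0 z (fun k => e k w) th0 k - ln (f (e k w)))}.
Proof.
have [b b0 Hb] := ratio_decay; have [kap kap0 Ht] := tails.
have [L L0 HL] := sden_lipschitz al_gt0.
apply: filterS (ae_and Hb Ht) => w [Rw Tw].
apply: sum_ge_of_eventually => eps e0.
pose Cz := (z - p_om th0) / p_om th0.
have Cz0 : 0 <= Cz by rewrite divr_ge0 ?subr_ge0// ltW.
pose ep := Num.min (eps / 2) 2^-1.
have ep0 : 0 < ep by rewrite lt_min invr_gt0 ltr0n divr_gt0.
have epe : ep <= eps / 2 by rewrite ge_min lexx.
have ep1 : ep <= 2^-1 by rewrite ge_min lexx orbT.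
pose q := b / (4 * kap).
have q0 : 0 < q by rewrite divr_gt0// mulr_gt0.
have b2 : 0 < b / 2 by rewrite divr_gt0.
near=> n.
have rn : sv n w / fv n w - 1 <= Cz * expR (- (b * n%:R)) by near: n.
have [t1 t2] : `|e n w| <= ((n.+1 * n.+2)%:R) `^ kap /\ (f (e n w))^-1 <= ((n.+1 * n.+2)%:R) `^ kap by near: n.
have pn : ((n.+1 * n.+2)%:R : R) <= expR (q * n%:R) by near: n; exact: pronic_le_exp.
have dn : L * Cz * expR (- (b / 2 * n%:R)) <= ep by near: n; exact: exp_decay_eventually.
have s0 : 0 < sv n w by exact: svol_gt0.
have u0 : 0 < fv n w by exact: fvol_gt0.
have x0 : 0 <= sv n w / fv n w - 1.
  rewrite subr_ge0 ler_pdivlMr// mul1r /sv (fvol_true_gap th0 z (e^~ w) n) lerDl.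
  by rewrite mulr_ge0 ?subr_ge0// exprn_ge0// ltW.
rewrite /lterm -/(sv n w) -/(fv n w) -/al -/f.
have pk : ((n.+1 * n.+2)%:R : R) `^ kap <= expR (b / 4 * n%:R).
  have -> : expR (b / 4 * n%:R) = expR (q * n%:R) `^ kap.
    rewrite /powR gt_eqF ?expR_gt0// expRK; congr expR; rewrite /q; field.
    by rewrite gt_eqF.
  by apply: powR_le_base => //; exact: ltW.
have t1' := le_trans t1 pk; have t2' := le_trans t2 pk.
set x := sv n w / fv n w - 1 in rn x0.
have fe := f_gt0 (e n w).
have yb : L * x * `|e n w| * (f (e n w))^-1 <= ep.
  apply: le_trans dn.
  apply: (@le_trans _ _ (L * (Cz * expR (- (b * n%:R))) * expR (b / 4 * n%:R) * expR (b / 4 * n%:R))).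
    apply: ler_pM => //; [by rewrite !mulr_ge0// ltW|by rewrite invr_ge0 ltW|].
    apply: ler_pM => //; first by rewrite mulr_ge0// ltW.
    by rewrite ler_pM2l.
  have -> : expR (- (b / 2 * n%:R)) = expR (- (b * n%:R)) * expR (b / 4 * n%:R) * expR (b / 4 * n%:R) :> R.
    by rewrite -!expRD; congr expR; field.
  by rewrite !mulrA.
have E : sv n w / fv n w = 1 + x by rewrite /x subrKC.
rewrite E; set r := Num.sqrt (1 + x).
have r2 : r ^+ 2 = 1 + x by rewrite sqr_sqrtr// addr_ge0.
have r0 : 0 <= r := sqrtr_ge0 _.
have r1 : 1 <= r by move: r2 r0 x0; clear_after tails; nra.
have rx : r - 1 <= x by move: r2 r1; clear_after tails; nra.
set y := e n w in t1' t2' fe yb *.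
have lip := HL al (r * y) y (lexx _).
have k1 : `|r * y - y| <= x * `|y|.
  rewrite -[X in _ - X]mul1r -mulrBl normrM ger0_norm ?subr_ge0//.
  by rewrite ler_wpM2r.
have k2 : f y - L * (x * `|y|) <= f (r * y).
  have : `|f (r * y) - f y| <= L * (x * `|y|) by apply: (le_trans lip); rewrite ler_pM2l.
  by rewrite ler_norml => /andP[h _]; move: h; clear_after tails; lra.
have k3 : f y * (1 - ep) <= f (r * y).
  apply: le_trans k2; rewrite mulrBr mulr1 lerD2l lerN2.
  by rewrite [leRHS]mulrC -ler_pdivrMr// mulrA.
have k4 : 0 < 1 - ep by move: (ep1); clear_after tails; lra.
have k5 : f y * (1 - ep) <= r * f (r * y).
  apply: (le_trans k3); rewrite ler_peMl//; exact: ltW.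
have : ln (f y * (1 - ep)) <= ln (r * f (r * y)).
  by rewrite ler_ln ?posrE ?mulr_gt0//; exact: lt_le_trans r1.
rewrite lnM ?posrE// => k6.
have k7 : - (2 * ep) <= ln (1 - ep).
  rewrite -lerN2 opprK -lnV ?posrE//.
  have i0 : 0 < (1 - ep)^-1 by rewrite invr_gt0.
  have h : -1 < (1 - ep)^-1 - 1 by rewrite ltrBrDr addNr.
  have := le_ln1Dx h; rewrite subrKC => /le_trans; apply.
  rewrite -(ler_pM2r k4) mulrBl mulVf ?gt_eqF//; move: (ep0) (ep1); clear_after tails; nra.
by move: k6 k7 epe; clear_after tails; lra.
Unshelve. all: end_near. Qed.

End true_parameter.

(** * Consistency *)

Lemma compact_ae_cvg (R : realType) (d : measure_display) (T : measurableType d)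
    (P : probability T R) (X : topologicalType) (Y : pseudoMetricType R) (Theta : set X)
    (pr : X -> Y) (x0 : X) (xhat : nat -> T -> X) :
  compact Theta -> continuous pr -> (forall n w, Theta (xhat n w)) ->
  (forall x, Theta x -> pr x <> pr x0 ->
     exists2 V, nbhs x V & {ae P, forall w, \forall n \near \oo, ~ V (xhat n w)}) ->
  {ae P, forall w, (fun n => pr (xhat n w)) @ \oo --> pr x0}.
Proof.
move=> /compact_near_coveringP cpt cpr xT away.
have H m : {ae P, forall w, \forall n \near \oo, ball (pr x0) m.+1%:R^-1 (pr (xhat n w))}.
  have m0 : 0 < m.+1%:R^-1 :> R by rewrite invr_gt0.
  pose Q w n y := ball (pr x0) m.+1%:R^-1 (pr y) \/ xhat n w <> y.
  have := cpt T (almost_everywhere P) (fun w x => \forall y \near x & n \near \oo, Q w n y) _.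
  have loc x : Theta x -> \forall x' \near x & w \near almost_everywhere P,
      \forall y \near x' & n \near \oo, Q w n y.
    move=> Tx; have [px|px] := pselect (pr x = pr x0).
      pose U := [set y | ball (pr x0) m.+1%:R^-1 (pr y)].
      have nU : nbhs x U.
        by apply: (cpr x); rewrite px; exact: nbhsx_ballx.
      exists (U°, setT); first by split; [exact: nbhs_interior|exact: filterT].
      move=> [x' w] [/= Ux' _]; exists (U, setT); first by split => //; exact: filterT.
      by move=> [y n] [/= Uy _]; left.
    have [V nV aV] := away x Tx px.
    exists (V°, [set w | \forall n \near \oo, ~ V (xhat n w)]).
      by split => //; exact: nbhs_interior.
    move=> [x' w] [/= Vx' nw]; exists (V, [set n | ~ V (xhat n w)]); first by [].
    by move=> [y n] [/= Vy nVy]; right => E; apply: nVy; rewrite E.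
  move=> /(_ _ loc); apply: filterS => w Hw.
  have := cpt nat \oo (Q w) _ Hw.
  move=> /(_ _)/filterS; apply => n Hn.
  by have [//|] := Hn _ (xT n w).
have := ae_foralln H; apply: filterS => w Hw.
apply/cvg_ballP => eps e0.
have [m _ Hm] := near_infty_natSinv_lt (PosNum e0).
apply: filterS (Hw m) => n; apply: le_ball; apply: ltW; exact: (Hm m (leqnn m)).
Qed.

Section nbhs_pclose.
Variable R : realType.

Let mul_bounds (X : topologicalType) (g : X -> R) (x : X) (dl : R) :
  {for x, continuous g} -> 0 < g x -> 0 < dl ->
  \forall y \near x, (1 - dl) * g x <= g y <= (1 + dl) * g x.
Proof.
move=> cg g0 d0; near=> y; apply/andP; split.
  near: y; apply: (cvgr_ge _ cg); rewrite mulrBl mul1r ltrBlDr ltrDl; exact: mulr_gt0.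
near: y; apply: (cvgr_le _ cg); rewrite mulrDl mul1r ltrDl; exact: mulr_gt0.
Unshelve. all: end_near. Qed.

Lemma nbhs_pclose (dl : R) (th : param R) : param_pos th -> 0 < dl ->
  nbhs th (pclose dl th).
Proof.
move=> [h1 h2 h3 h4 _] d0.
have c1 : {for th, continuous (@p_om R)} by exact: cvg_fst.
have s2 : (fun x : param R => x.2) @ th --> th.2 by exact: cvg_snd.
have c5 : {for th, continuous (@p_alpha R)}.
  by apply: cvg_comp s2 _; exact: cvg_snd.
have s3 : (fun x : param R => x.2.1) @ th --> th.2.1.
  by apply: cvg_comp s2 _; exact: cvg_fst.
have c4 : {for th, continuous (@p_psi R)}.
  by apply: cvg_comp s3 _; exact: cvg_snd.
have s4 : (fun x : param R => x.2.1.1) @ th --> th.2.1.1.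
  by apply: cvg_comp s3 _; exact: cvg_fst.
have c2 : {for th, continuous (@p_php R)}.
  by apply: cvg_comp s4 _; exact: cvg_fst.
have c3 : {for th, continuous (@p_phm R)}.
  by apply: cvg_comp s4 _; exact: cvg_snd.
have e1 := mul_bounds c1 h1 d0; have e2 := mul_bounds c2 h2 d0.
have e3 := mul_bounds c3 h3 d0; have e4 := mul_bounds c4 h4 d0.
have e5 : \forall y \near th, `|p_alpha y - p_alpha th| <= dl.
  by move/cvgr_distC_le : c5; apply.
near=> y; split; near: y => //.
Unshelve. all: end_near. Qed.

End nbhs_pclose.

Section consistency.
Context (R : realType) (d : measure_display) (T : measurableType d) (P : probability T R).
Variables (eta : nat -> T -> R) (y0 s0 : R) (th0 : param R).
Hypotheses (th0P : param_pos th0) (s00 : 0 <= s0)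
  (iid : iid_density P (fun t => eta t.+1) (sden (p_alpha th0))).
Let z := vol1 th0 y0 s0.
Let z0 : p_om th0 <= z. Proof. exact: vol1_ge_om. Qed.
Let e n w := eta n.+1 w.
Let y w t := (sagarch th0 y0 s0 (fun k => eta k w) t).1.
Let iide : iid_density P e (sden (p_alpha th0)) := iid.

Let away th : param_pos th -> p_alpha th <> p_alpha th0 \/ identified P e th0 z th ->
  exists2 V, nbhs th V & {ae P, forall w, \forall n \near \oo, forall th', V th' ->
    param_pos th' -> loglik n th' (y w) < loglik n th0 (y w)}.
Proof.
move=> thP idt.
have [tau [p [tauI p0 freq]]] : exists tau p : R, [/\ 0 < tau < 1, 0 < p &
    {ae P, forall w, \forall n \near \oo, p * n%:R <= \sum_(0 <= k < n)
     ((p_alpha th != p_alpha th0) || (tau <= `|fvol th0 z (fun k => e k w) th k / svol th0 z (fun k => e k w) k - 1|))%:R}].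
  case: idt => [/eqP ne|[tau [p [tauI p0 freq]]]].
    exists 2^-1, 1; split => //; first lra.
    apply: aeW => w; near=> n; under eq_bigr do rewrite ne/=.
    by rewrite mul1r big_const_nat subn0 iter_addr addr0.
  exists tau, p; split => //; apply: filterS freq => w; apply: filterS => n /le_trans; apply.
  by apply: ler_sum => k _; rewrite ler_nat leq_b1 || rewrite ler_nat; case: (_ != _); case: (_ <= _).
have [dl /andP[dl0 dl1] [c c0 Hc]] := likelihood_gap th0P z0 iide thP tauI p0 freq.
exists (pclose dl th); first exact: nbhs_pclose.
have := ae_and Hc (true_likelihood th0P z0 iide).
apply: filterS => w [Hw1 Hw2].
have c2 : 0 < c / 2 by rewrite divr_gt0.
have {}Hw2 := Hw2 _ c2.
near=> n => th' cl thP'.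
have a1 : \sum_(0 <= k < n) (lterm th0 z (fun k => e k w) th' k - ln (sden (p_alpha th0) (e k w))) <= - c * n%:R.
  by move: th' thP' cl; near: n.
have a2 : - (c / 2) * n%:R <= \sum_(0 <= k < n) (lterm th0 z (fun k => e k w) th0 k - ln (sden (p_alpha th0) (e k w))).
  by near: n.
have n0 : 0 < n%:R :> R by rewrite ltr0n; near: n; exact: nbhs_infty_gt.
have cn : 0 < c * n%:R by rewrite mulr_gt0.
rewrite /y !loglikE//.
move: a1 a2; rewrite !sumrB ltrD2r /z /e.
move: (\sum_(0 <= k < n) ln (sden _ _)) (\sum_(0 <= k < n) lterm _ _ _ _ _) (\sum_(0 <= k < n) lterm _ _ _ _ _) => A B C; lra.
Unshelve. all: end_near. Qed.

Variables (Theta : set (param R)) (thhat : nat -> T -> param R).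
Hypotheses (cptTheta : compact Theta) (ThetaP : param_space Theta) (Theta0 : Theta th0)
  (mle : forall n w, is_mle Theta n (y w) (thhat n w)).

Let mle_away th : Theta th -> p_alpha th <> p_alpha th0 \/ identified P e th0 z th ->
  exists2 V, nbhs th V & {ae P, forall w, \forall n \near \oo, ~ V (thhat n w)}.
Proof.
move=> Tth idt; have [V nV aV] := away (ThetaP Tth) idt.
exists V => //; apply: filterS aV => w; apply: filterS => n Hn Vn.
have [Tn Mn] := mle n w.
by have := Hn _ Vn (ThetaP Tn); rewrite ltNge Mn.
Qed.

Let identified_shape th : param_pos th -> th.2 <> th0.2 ->
  p_alpha th <> p_alpha th0 \/ identified P e th0 z th.
Proof.
move=> thP ne; have [ea|] := pselect (p_alpha th = p_alpha th0); [right|by left].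
have [hp|/eqP] := pselect (p_php th = p_php th0); last exact: ident_php.
have [hm|/eqP] := pselect (p_phm th = p_phm th0); last exact: ident_phm.
apply: ident_psi => //; apply/eqP => hs; apply: ne.
move: ea hp hm hs; rewrite /p_alpha /p_php /p_phm /p_psi.
by case: (th) => [? [[[? ?] ?] ?]]; case: (th0) => [? [[[? ?] ?] ?]] /= -> -> -> ->.
Qed.

Lemma mle_shape_consistent : {ae P, forall w, (fun n => (thhat n w).2) @ \oo --> th0.2}.
Proof.
apply: (@compact_ae_cvg R d T P (param R) _ Theta snd th0 thhat) => //.
- by move=> x; exact: cvg_snd.
- by move=> n w; case: (mle n w).
- by move=> x Tx ne; apply: mle_away => //; apply: identified_shape => //; exact: ThetaP.
Qed.

Lemma mle_consistent : (lyap th0 < 0)%E ->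
  {ae P, forall w, (fun n => thhat n w) @ \oo --> th0}.
Proof.
move=> ly; have [S0 [p [S00 p0 freq]]] := low_volatility_freq th0P z0 iide ly.
apply: (@compact_ae_cvg R d T P (param R) _ Theta id th0 thhat) => //.
- by move=> x; exact: cvg_id.
- by move=> n w; case: (mle n w).
- move=> x Tx ne; apply: mle_away => //.
  have xP := ThetaP Tx.
  have [e2|] := pselect (x.2 = th0.2); last exact: identified_shape.
  right; apply: (ident_omega th0P z0 iide xP S00 p0 freq); rewrite /p_php /p_phm /p_psi ?e2//.
  apply/eqP => e1; apply: ne; move: e1 e2; rewrite /p_om.
  by case: (x) => ? ?; case: (th0) => ? ? /= -> ->.
Qed.

End consistency.

Theorem theorem2p1 (R : realType) (d : measure_display) (T : measurableType d)
  (P : probability T R) (eta : nat -> T -> R) (y0 s0 : R)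
  (Theta : set (param R)) (th0 : param R) (thhat : nat -> T -> param R) :
  0 <= s0 ->
  iid_density P (fun t => eta t.+1) (f_alpha (p_alpha th0)) ->
  compact Theta -> param_space Theta -> Theta th0 ->
  (forall n w, is_mle Theta n (fun t => (sagarch th0 y0 s0 (fun k => eta k w) t).1)
                  (thhat n w)) ->
  ((lyap th0 < 0)%E -> (forall th, Theta th -> p_psi th < 1) ->
     {ae P, forall w, (fun n => thhat n w) @ \oo --> th0}) /\
  ((0 < lyap th0)%E ->
     {ae P, forall w, (fun n => (thhat n w).2) @ \oo --> th0.2}).
Proof.
rewrite -sdenE => s00 iid cptTheta ThetaP Theta0 mle.
have th0P := ThetaP _ Theta0.
split=> [ly _|_]; [exact: mle_consistent mle ly|exact: mle_shape_consistent mle].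
Qed.
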